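(* Fix $0<\eta<1/2$ and a symmetric forbidden-pattern system $(\Sigma,k,\mathscr P,\Gamma)$ (defined in the context). Suppose: (i) $(\mathscr P,\Gamma)$ is rigid; (ii) $\mathscr P$ has power-replaceable one-coordinate derivatives; (iii) uniformly for $p\in[p_\eta,p_{1-\eta}]$, $pN_n(\mathscr P)=\Theta(n)$; (iv) for every $A_0,B_0>0$ there is $c=c(A_0,B_0)>0$ such that, whenever $1\le K\le c\log n$, $$\sup_{p\in[p_\eta,p_{1-\eta}]}\mu_p\bigl(\mathrm{Small}_{n,B_0K}(\mathscr P)\bigr)\le e^{-A_0K}.$$ Then there is a constant $C_{\eta,\mathscr P}$ such that for all sufficiently large $n$ $$W_\eta(n)\le C_{\eta,\mathscr P}\,\frac{n}{\log n}.$$ If conditions (iii) and (iv) also hold with $\eta$ replaced by $\eta/4$, then the same bound (with a possibly different constant) holds at central level $\eta$ in the uniform fixed-size model and in the model of independently sampled constraints, i.e. $\widehat W_\eta(n)=O(n/\log n)$ and $\widetilde W_\eta(n)=O(n/\log n)$.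
   Context: Symmetric forbidden-pattern system. $\Sigma$ is a finite alphabet, $k\ge2$ an integer, $\mathscr P$ a nonempty finite family of nonempty proper subsets of $\Sigma^k$ that is closed under permutations of the $k$ coordinates, and $\Gamma\le\operatorname{Sym}(\Sigma)$ is a group such that every $P\in\mathscr P$ is invariant under the diagonal action of $\Gamma$ on $\Sigma^k$. A $\mathscr P$-constraint on a $k$-set $S=\{i_1<\dots<i_k\}\subseteq[n]$ is a pair $(S,P)$ with $P\in\mathscr P$; it covers the assignments $x\in\Sigma^n$ with $x_S:=(x_{i_1},\dots,x_{i_k})\in P$. Let $\Omega_n(\mathscr P)=\binom{[n]}{k}\times\mathscr P$ and $N_n(\mathscr P)=|\mathscr P|\binom nk$. The monotone event $\mathcal F_n(\mathscr P)\subseteq 2^{\Omega_n(\mathscr P)}$ says that the selected constraints cover all of $\Sigma^n$; it is assumed nontrivial (nonempty and not everything) for all sufficiently large $n$. Product measure. $\mu_p$ selects each constraint independently with probability $p$; $p_\alpha=p_\alpha(n)=\inf\{p\in[0,1]:\mu_p(\mathcal F_n(\mathscr P))\ge\alpha\}$; $W_\eta(n)=N_n(\mathscr P)(p_{1-\eta}-p_\eta)$. For real $s\ge1$, $\mathrm{Small}_{n,s}(\mathscr P)$ is the event that the selected set of constraints contains an inclusion-minimal cover of $\Sigma^n$ (an inclusion-minimal element of $\mathcal F_n(\mathscr P)$) with at most $s$ constraints. Uniform fixed-size model. $a_m$ is the probability that a uniformly random $m$-subset of $\Omega_n(\mathscr P)$ lies in $\mathcal F_n(\mathscr P)$; $m_\alpha=\min\{m:a_m\ge\alpha\}$;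 $\widehat W_\eta(n)=m_{1-\eta}-m_\eta$. Independent model. $\widetilde a_m$ is the probability that the set of distinct elements among $m$ independent uniform elements of $\Omega_n(\mathscr P)$ lies in $\mathcal F_n(\mathscr P)$; $\widetilde m_\alpha=\min\{m:\widetilde a_m\ge\alpha\}$; $\widetilde W_\eta(n)=\widetilde m_{1-\eta}-\widetilde m_\eta$. Rigidity. For $u,v\in\Sigma^k$ write $u\preceq_{\mathscr P}v$ iff $\{P\in\mathscr P:u\in P\}\subseteq\{P\in\mathscr P:v\in P\}$. For a finite set $R$, $x\in\Sigma^R$ and an injection $\phi:[k]\to R$, let $x_\phi=(x_{\phi(1)},\dots,x_{\phi(k)})$. $(\mathscr P,\Gamma)$ is rigid if there is an integer $L\ge k$ such that whenever $R$ is finite, every symbol of $\Sigma$ occurs at least $L$ times in $\sigma\in\Sigma^R$, and $\tau\in\Sigma^R$ satisfies $\tau_\phi\preceq_{\mathscr P}\sigma_\phi$ for every injection $\phi:[k]\to R$, then $\tau=g\sigma$ (coordinatewise action) for some $g\in\Gamma$. Power-replaceable derivatives. For $a\in\Sigma$, $P\in\mathscr P$ let $\partial_aP=\{z\in\Sigma^{k-1}:(a,z)\in P\}$, and let $\mathscr D(\mathscr P)=\{(a,P):a\in\Sigma,P\in\mathscr P,\partial_aP\neq\varnothing\}$ (an indexed family: equal derivative sets retain their multiplicities). For $S\subseteq\Sigma^m$, $\rho_{\mathscr P,m}(S)$ is the probability that a uniformly random $(U,P)\in\binom{[m]}{k}\times\mathscr P$ satisfies $S\subseteq\{x\in\Sigma^m:x_U\in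 P\}$, and $\rho_{\partial\mathscr P,m}(S)$ is the probability that a uniformly random $(U,a,P)\in\binom{[m]}{k-1}\times\mathscr D(\mathscr P)$ satisfies $S\subseteq\{x\in\Sigma^m:x_U\in\partial_aP\}$ (coordinates of $U$ in increasing order; probabilities over an empty index set are read as $0$). $\mathscr P$ has power-replaceable one-coordinate derivatives if there are constants $c_*,C_*,b>0$ and $\gamma\ge1$ such that for every $m\ge1$, every $S\subseteq\Sigma^m$ and every real $\varepsilon$, $$\rho_{\partial\mathscr P,m}(S)\ge\varepsilon\ge C_*m^{-b}\ \Longrightarrow\ \rho_{\mathscr P,m}(S)\ge c_*\varepsilon^\gamma.$$ *)

(* Defs.v *)
From HB Require Import structures.
From mathcomp Require Import all_boot all_order all_algebra all_fingroup.
From mathcomp Require Import all_classical all_reals all_analysis.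

Set Implicit Arguments.
Unset Strict Implicit.
Unset Printing Implicit Defensive.

Import Order.TTheory GRing.Theory Num.Theory.
Import numFieldNormedType.Exports.

Local Open Scope classical_set_scope.
Local Open Scope ring_scope.

(* Minimum of a set of natural numbers; the junk value for the empty set is 0. *)
Definition nat_min (P : pred nat) : nat :=
  match pselect (exists m, P m) with
  | left exP => ex_minn exP
  | right _ => 0%N
  end.

Section RandomSubsets.
Variables (R : realType) (T : finType) (Om : {set T}) (F : {set {set T}}).

Definition product_measure (p : R) : R :=
  \sum_(A in powerset Om | A \in F) p ^+ #|A| * (1 - p) ^+ #|Om :\: A|.

Definition product_threshold (alpha : R) : R :=
  inf [set p : R | 0 <= p <= 1 /\ alpha <= product_measure p].

(* For m > #|Om| there is no m-subset and the quotient is 0 / 0 = 0. *)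
Definition fixed_size_prob (m : nat) : R :=
  #|[set A in powerset Om | (A \in F) && (#|A| == m)]%SET|%:R / 'C(#|Om|, m)%:R.

Definition fixed_size_threshold (alpha : R) : nat :=
  nat_min (fun m => alpha <= fixed_size_prob m).

Definition independent_prob (m : nat) : R :=
  #|[set f : {ffun 'I_m -> T} | (f \in ffun_on Om)
                                && (f @: [set: 'I_m] \in F)]%SET|%:R
  / (#|Om| ^ m)%:R.

Definition independent_threshold (alpha : R) : nat :=
  nat_min (fun m => alpha <= independent_prob m).

End RandomSubsets.

Section ForbiddenPatterns.
Variables (Sigma : finType) (k : nat).
Implicit Types (PP : {set {set k.-tuple Sigma}}) (n m : nat).

(* [enum U] lists the elements of U : {set 'I_m} in increasing order, so that
   [seq x i | i <- enum U] is the restriction x_U; it can only equal a j-tuple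
   when #|U| = j. *)
Definition cylinder (m j : nat) (U : {set 'I_m}) (Q : {set j.-tuple Sigma}) :
    {set {ffun 'I_m -> Sigma}} :=
  [set x : {ffun 'I_m -> Sigma} |
    [exists w in Q, tval w == [seq x i | i <- enum U]]]%SET.

Definition ksets (m j : nat) : {set {set 'I_m}} :=
  [set U : {set 'I_m} | #|U| == j]%SET.

Definition constraints PP n : {set {set 'I_n} * {set k.-tuple Sigma}} :=
  finset.setX (ksets n k) PP.

Definition num_constraints PP n : nat := (#|PP| * 'C(n, k))%N.

Definition covers PP n : {set {set {set 'I_n} * {set k.-tuple Sigma}}} :=
  [set A in powerset (constraints PP n) |
    \bigcup_(c in A) cylinder c.1 c.2 == [set: {ffun 'I_n -> Sigma}]]%SET.

Definition permute_coords (s : 'S_k) (x : k.-tuple Sigma) : k.-tuple Sigma :=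
  [tuple tnth x (s i) | i < k].

Record symmetric_system PP (Gamma : {group {perm Sigma}}) : Prop :=
  SymmetricSystem {
    system_k : (2 <= k)%N;
    system_family : PP != finset.set0;
    system_nonempty : forall P, P \in PP -> P != finset.set0;
    system_proper : forall P, P \in PP -> P != [set: k.-tuple Sigma]%SET;
    (* the family is closed; its individual members need not be symmetric *)
    system_permute : forall (s : 'S_k) P, P \in PP ->
      permute_coords s @: P \in PP;
    system_invariant : forall g P, g \in Gamma -> P \in PP ->
      [set map_tuple g x | x in P]%SET = P;
    system_nontrivial : \forall n \near \oo,
      covers PP n != finset.set0 /\ covers PP n != powerset (constraints PP n)
  }.

Definition pattern_le PP (u v : k.-tuple Sigma) : bool :=
  [set P in PP | u \in P]%SET \subset [set P in PP | v \in P]%SET.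

Definition rigid PP (Gamma : {group {perm Sigma}}) : Prop :=
  exists2 L : nat, (k <= L)%N &
    forall (I : finType) (sigma tau : {ffun I -> Sigma}),
      (forall a : Sigma, (L <= #|[set r | sigma r == a]%SET|)%N) ->
      (forall phi : 'I_k -> I, injective phi ->
         pattern_le PP [tuple tau (phi i) | i < k]
                       [tuple sigma (phi i) | i < k]) ->
      exists2 g : {perm Sigma}, g \in Gamma & forall r, tau r = g (sigma r).

Definition derivative (a : Sigma) (P : {set k.-tuple Sigma}) :
    {set k.-1.-tuple Sigma} :=
  [set z : k.-1.-tuple Sigma | [exists w in P, tval w == a :: tval z]]%SET.

Definition derivatives PP : {set Sigma * {set k.-tuple Sigma}} :=
  [set d : Sigma * {set k.-tuple Sigma} |
    (d.2 \in PP) && (derivative d.1 d.2 != finset.set0)]%SET.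

Section Real.
Variable R : realType.

(* Division by zero yields 0, the value prescribed for empty index sets. *)
Definition rho PP m (S : {set {ffun 'I_m -> Sigma}}) : R :=
  #|[set c in finset.setX (ksets m k) PP | S \subset cylinder c.1 c.2]%SET|%:R
  / #|finset.setX (ksets m k) PP|%:R.

Definition rho_derivative PP m (S : {set {ffun 'I_m -> Sigma}}) : R :=
  #|[set c in finset.setX (ksets m k.-1) (derivatives PP) |
      S \subset cylinder c.1 (derivative c.2.1 c.2.2)]%SET|%:R
  / #|finset.setX (ksets m k.-1) (derivatives PP)|%:R.

Definition power_replaceable PP : Prop :=
  exists cs Cs b gamma : R, [/\ 0 < cs, 0 < Cs, 0 < b, 1 <= gamma &
    forall m (S : {set {ffun 'I_m -> Sigma}}) (eps : R), (1 <= m)%N ->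
      eps <= rho_derivative PP S -> Cs * m%:R `^ (- b) <= eps ->
      cs * eps `^ gamma <= rho PP S].

Definition mu PP n (F : {set {set {set 'I_n} * {set k.-tuple Sigma}}}) (p : R) :
    R :=
  product_measure (constraints PP n) F p.

Definition p_thr PP n (alpha : R) : R :=
  product_threshold (constraints PP n) (covers PP n) alpha.

Definition central_interval PP n (eta : R) : set R :=
  [set p | p_thr PP n eta <= p <= p_thr PP n (1 - eta)].

Definition small PP n (s : R) : {set {set {set 'I_n} * {set k.-tuple Sigma}}} :=
  [set A in powerset (constraints PP n) |
    [exists B : {set {set 'I_n} * {set k.-tuple Sigma}},
      [&& B \subset A, minset (fun D => D \in covers PP n) B
        & #|B|%:R <= s]]]%SET.

Definition width PP (eta : R) n : R :=
  (num_constraints PP n)%:R * (p_thr PP n (1 - eta) - p_thr PP n eta).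

Definition width_fixed PP (eta : R) n : R :=
  (fixed_size_threshold (constraints PP n) (covers PP n) (1 - eta))%:R
  - (fixed_size_threshold (constraints PP n) (covers PP n) eta)%:R.

Definition width_indep PP (eta : R) n : R :=
  (independent_threshold (constraints PP n) (covers PP n) (1 - eta))%:R
  - (independent_threshold (constraints PP n) (covers PP n) eta)%:R.

Definition linear_scale PP (eta : R) : Prop :=
  exists c C : R, [/\ 0 < c, 0 < C & \forall n \near \oo,
    forall p, central_interval PP n eta p ->
      c * n%:R <= p * (num_constraints PP n)%:R <= C * n%:R].

Definition few_small_covers PP (eta : R) : Prop :=
  forall A0 B0 : R, 0 < A0 -> 0 < B0 -> exists2 c : R, 0 < c &
    forall (n : nat) (K : R), 1 <= K <= c * ln n%:R ->
      sup [set mu PP (small PP n (B0 * K)) p | p in central_interval PP n eta]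
        <= expR (- (A0 * K)).

End Real.
End ForbiddenPatterns.

(* Main.v *)
(** Suppose the window at level [eta] were much wider than [n / log n].  Some
    [p] in it then has total influence at most [K = c log n], while adding
    [n^(1-o(1))] random constraints raises the covering probability by at most a
    negative power of [n].  Let [F'] be the event that a minimal cover with more
    than [B0 K] constraints is present; by (iv) it differs from covering only
    with probability [exp (- A0 K)], and the pigeonhole choice of [p] controls
    its influence as well.

    A KKL-type argument, based on hypercontractivity for global functions in the
    biased cube, gives a set [S] of [O(K)] constraints that boosts [F'] by
    [exp (- O(K))].  A large minimal cover is not contained in [S], hence meets
    it in a satisfiable set, so some satisfiable [D] inside [S] boosts covering
    by [exp (- O(K))].  If [sigma] satisfies [D] and [S0] is the set of the
    [O(K)] coordinates that [D] reads, covering with the help of [D] forces the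
    random constraints to cover every assignment that agrees with [sigma] on
    [S0].  Random constraints meeting [S0] in two coordinates are negligible;
    the [O(K)] that meet it once act as constraints of the one-coordinate
    derivative family, and (ii) replaces them one at a time by [n^(1-o(1))]
    constraints avoiding [S0].  So the boost is at most the increment above plus
    a negative power of [n]: a contradiction for small [c].

    Binomial concentration transfers the bound at level [eta / 4] to the
    fixed-size model, and a bound on the number of collisions to independent
    sampling. *)
Require Import Defs.
From HB Require Import structures.
From mathcomp Require Import all_boot all_order all_algebra all_fingroup.
From mathcomp Require Import all_classical all_reals all_analysis.
From mathcomp Require Import finset zify ring lra.

Set Implicit Arguments.
Unset Strict Implicit.
Unset Printing Implicit Defensive.

Import Order.TTheory GRing.Theory Num.Theory.
Import numFieldNormedType.Exports.
(* [classical_sets] shadows the names of the finite-set lemmas used below. *)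
Import fintype finset.

Local Open Scope ring_scope.

(** * Biased product measures *)

Section BiasedMeasure.
Variables (R : realFieldType) (T : finType).
Implicit Types (p q : R) (A B S U D : {set T}) (c : {set T} -> R).

(** In the window [p] is a negative power of [n], and hypercontractive constants for arbitrary
    functions degrade with [1 / p], while the argument can only afford factors [n ^ O(c)]. The
    global version pays with the boosts of small sets instead, and a small set with a large boost is
    exactly what the rest refutes. Such a set could boost covering trivially, by containing a cover;
    passing to large minimal covers excludes this.

    Every loss is then of the form [exp (O(K)) = n ^ O(c)]. The exponents depend only on [eta], the
    system and the constants of (ii) and (iii), so [c] can be chosen after them.

    Linked constraints are not replaced simultaneously, because (ii) speaks of one cylinder
    containing a given set. A linked constraint is compared with the set [Y] of assignments that the
    other chosen ones leave to it. If many linked constraints contain [Y], then (ii) yields many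
    free ones and a sparse fresh random set probably holds one of them. If few do, the presence of
    any is itself unlikely. *)

Definition wt p A : R := \prod_i (if i \in A then p else 1 - p).
Definition Ex p (phi : {set T} -> R) : R := \sum_A wt p A * phi A.
(* The base point of [chi] need not be the bias of the measure: base point [p]
   gives the Fourier basis of bias [p], base point 0 the indicators of
   [S \subset A], and base point 1, up to sign, the indicators of
   [[disjoint S & A]], for which unions of independent sets are multiplicative. *)
Definition chi p S A : R := \prod_(i in S) ((i \in A)%:R - p).
Definition ev p c A : R := \sum_S c S * chi p S A.

Lemma big_set_split i (F : {set T} -> R) :
  \sum_A F A = \sum_(A : {set T} | i \notin A) (F A + F (i |: A)).
Proof.
rewrite (bigID (fun A : {set T} => i \notin A)) /= big_split /=; congr (_ + _).
rewrite (reindex_onto (fun A => i |: A) (fun A => A :\ i)) /=; last first.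
  by move=> A; rewrite negbK => /setD1K.
apply: eq_bigl => A; rewrite negbK setU11 /=.
apply/eqP/idP => [<-|iA]; first by rewrite !inE eqxx.
by rewrite setU1K.
Qed.

Lemma wt_setU1 p i A : i \notin A -> (1 - p) * wt p (i |: A) = p * wt p A.
Proof.
move=> iA; rewrite /wt (bigD1 i) //= (bigD1 (P := predT) i) //= setU11 (negPf iA).
rewrite mulrCA; congr (_ * (_ * _)); apply: eq_bigr => j ji.
by rewrite in_setU1 (negPf ji).
Qed.

Lemma wt_ge0 p A : 0 <= p <= 1 -> 0 <= wt p A.
Proof.
move=> /andP[p0 p1]; apply: prodr_ge0 => i _.
by case: ifP => // _; rewrite subr_ge0.
Qed.

Lemma eq_Ex p phi psi : phi =1 psi -> Ex p phi = Ex p psi.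
Proof. by move=> e; apply: eq_bigr => A _; rewrite e. Qed.

Lemma Ex_prod p (u v : T -> R) :
  Ex p (fun A => \prod_i (if i \in A then u i else v i)) =
  \prod_i (p * u i + (1 - p) * v i).
Proof.
rewrite bigA_distr /Ex; apply: eq_bigr => A _.
by rewrite /wt -big_split /=; apply: eq_bigr => i _; case: ifP.
Qed.

Lemma ExD p phi psi : Ex p (fun A => phi A + psi A) = Ex p phi + Ex p psi.
Proof. by rewrite -big_split; apply: eq_bigr => A _; rewrite mulrDr. Qed.

Lemma ExZ p a phi : Ex p (fun A => a * phi A) = a * Ex p phi.
Proof. by rewrite /Ex big_distrr /=; apply: eq_bigr => A _; rewrite mulrCA. Qed.

Lemma ExN p phi : Ex p (fun A => - phi A) = - Ex p phi.
Proof. by rewrite -[RHS]mulN1r -ExZ; apply: eq_Ex => A; rewrite mulN1r. Qed.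

Lemma ExB p phi psi : Ex p (fun A => phi A - psi A) = Ex p phi - Ex p psi.
Proof. by rewrite ExD ExN. Qed.

Lemma Ex_sum p (I : finType) (P : pred I) (F : I -> {set T} -> R) :
  Ex p (fun A => \sum_(i | P i) F i A) = \sum_(i | P i) Ex p (F i).
Proof.
rewrite /Ex exchange_big /=; apply: eq_bigr => A _.
by rewrite big_distrr.
Qed.

Lemma Ex_ge0 p phi : 0 <= p <= 1 -> (forall A, 0 <= phi A) -> 0 <= Ex p phi.
Proof. by move=> hp h; apply: sumr_ge0 => A _; rewrite mulr_ge0 ?wt_ge0. Qed.

Lemma le_Ex p phi psi : 0 <= p <= 1 -> (forall A, phi A <= psi A) ->
  Ex p phi <= Ex p psi.
Proof. by move=> hp h; apply: ler_sum => A _; rewrite ler_wpM2l ?wt_ge0. Qed.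

Lemma ExC p a : Ex p (fun=> a) = a.
Proof.
have := Ex_prod p (fun=> 1) (fun=> 1).
rewrite !mulr1 subrKC big1_eq => h; rewrite -[RHS]mulr1 -[in RHS]h -ExZ.
by apply: eq_Ex => A; rewrite big1 ?mulr1 // => i _; rewrite if_same.
Qed.

Lemma Ex_chi p r S : Ex p (chi r S) = (p - r) ^+ #|S|.
Proof.
rewrite -(prodr_const (mem S) (p - r)) [RHS]big_mkcond /=.
rewrite (eq_Ex _ (psi := fun A => \prod_i (if i \in A then
   (if i \in S then 1 - r else 1) else (if i \in S then - r else 1)))).
  rewrite Ex_prod; apply: eq_bigr => i _; case: ifP => _; ring.
move=> A; rewrite /chi big_mkcond /=; apply: eq_bigr => i _.
by case: (i \in S); case: (i \in A); rewrite ?sub0r.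
Qed.

(** Fourier inversion without division by [p * (1 - p)], so that base points 0 and 1 are allowed. *)
Lemma ev_exists p (f : {set T} -> R) : exists c, f =1 ev p c.
Proof.
(* The coefficients of the indicator of [A]: at one coordinate it equals [p + ((i \in B)%:R - p)] if
   [i \in A], and [(1 - p) - ((i \in B)%:R - p)] otherwise. *)
pose d A S : R := \prod_i (if i \in S then if i \in A then 1 else -1
                           else if i \in A then p else 1 - p).
exists (fun S => \sum_A f A * d A S) => B.
rewrite /ev; under eq_bigr do rewrite big_distrl.
rewrite exchange_big /= (bigD1 B) //= [X in _ + X]big1 ?addr0 => [|A AB].
  under eq_bigr => S _ do rewrite -mulrA; rewrite -big_distrr /=.
  rewrite -[LHS]mulr1; congr (_ * _).
  transitivity (\prod_(i : T) ((if i \in B then 1 else -1) * ((i \in B)%:R - p)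
                    + (if i \in B then p else 1 - p))).
    by rewrite big1 // => i _; case: (i \in B) => /=; ring.
  rewrite bigA_distr; apply: eq_bigr => S _.
  rewrite /d /chi [X in _ = _ * X]big_mkcond -big_split /=.
  by apply: eq_bigr => i _; case: (i \in S); rewrite ?mulr1.
under eq_bigr => S _ do rewrite -mulrA; rewrite -big_distrr /=.
suff -> : \sum_i d A i * chi p i B = 0 by rewrite mulr0.
transitivity (\prod_(i : T) ((if i \in A then 1 else -1) * ((i \in B)%:R - p)
                    + (if i \in A then p else 1 - p))).
  rewrite bigA_distr; apply: eq_bigr => S _.
  rewrite /d /chi [X in _ * X = _]big_mkcond -big_split /=.
  by apply: eq_bigr => i _; case: (i \in S); rewrite ?mulr1.
have /existsP[i iAB] : [exists i, (i \in A) != (i \in B)].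
  apply: contraNT AB => /existsPn h; apply/eqP/setP => i.
  by have := h i; rewrite negbK => /eqP.
by rewrite (bigD1 i) //=; case: (i \in A) (i \in B) iAB => [] [] //= _;
  rewrite [X in X * _](_ : _ = 0) ?mul0r //; ring.
Qed.

Lemma Ex_ev p r c : Ex p (ev r c) = \sum_S c S * (p - r) ^+ #|S|.
Proof.
rewrite /ev Ex_sum; apply: eq_bigr => S _.
by rewrite ExZ Ex_chi.
Qed.

Lemma Ex_union p q phi :
  Ex p (fun A => Ex q (fun B => phi (A :|: B))) = Ex (p + q - p * q) phi.
Proof.
have [c hc] := ev_exists 1 phi.
rewrite (eq_Ex _ hc) Ex_ev.
under eq_Ex => A do under eq_Ex => B do rewrite hc.
rewrite /ev; under eq_Ex => A do rewrite Ex_sum.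
rewrite Ex_sum; apply: eq_bigr => S _.
transitivity (c S * (-1) ^+ #|S| * Ex p (fun A => chi 1 S A * Ex q (chi 1 S))).
  rewrite -ExZ; apply: eq_Ex => A; rewrite -!ExZ; apply: eq_Ex => B.
  rewrite -!mulrA; congr (_ * _).
  rewrite /chi -(prodr_const (mem S)) -!big_split /=; apply: eq_bigr => i _.
  rewrite in_setU; case: (i \in A); case: (i \in B) => /=; ring.
under eq_Ex do rewrite mulrC.
rewrite ExZ !Ex_chi -mulrA; congr (_ * _).
rewrite -!exprMn; congr (_ ^+ _); ring.
Qed.

(** Expanded at base point 0, each [S] splits into its parts inside and outside [C]. The identity
    turns the two parts of one random set into separate independent variables. *)
Lemma Ex_split p C phi :
  Ex p (fun A => Ex p (fun B => phi ((A :&: C) :|: (B :\: C)))) = Ex p phi.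
Proof.
have [c hc] := ev_exists 0 phi.
rewrite (eq_Ex _ hc) Ex_ev.
under eq_Ex => A do under eq_Ex => B do rewrite hc.
rewrite /ev; under eq_Ex => A do rewrite Ex_sum.
rewrite Ex_sum; apply: eq_bigr => S _.
transitivity (c S * Ex p (fun A => chi 0 (S :&: C) A * Ex p (chi 0 (S :\: C)))).
  rewrite -ExZ; apply: eq_Ex => A; rewrite -!ExZ; apply: eq_Ex => B.
  congr (_ * _); rewrite /chi (big_setID C) /=.
  congr (_ * _); apply: eq_bigr => i; rewrite !inE => /andP[].
    by move=> _ ->; rewrite andbT orbF.
  by move=> /negPf -> _; rewrite andbF.
under eq_Ex do rewrite mulrC.
rewrite ExZ !Ex_chi !subr0 -exprD addnC; congr (_ * _ ^+ _).
by rewrite cardsID.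
Qed.

Lemma Ex_sub p S : Ex p (fun A => (S \subset A)%:R) = p ^+ #|S|.
Proof.
rewrite -[p]subr0 -(Ex_chi p 0) subr0; apply: eq_Ex => A.
rewrite /chi; have [/subsetP SA|/subsetPn[i iS iA]] := boolP (S \subset A).
  by rewrite big1 // => i /SA ->; rewrite subr0.
by rewrite (bigD1 i) //= (negPf iA) subrr mul0r.
Qed.

Lemma Ex_chi2 p S U :
  Ex p (fun A => chi p S A * chi p U A) =
  (S == U)%:R * (p * (1 - p)) ^+ #|S|.
Proof.
rewrite (eq_Ex _ (psi := fun A => \prod_i (if i \in A then
   (if i \in S then 1 - p else 1) * (if i \in U then 1 - p else 1)
   else (if i \in S then - p else 1) * (if i \in U then - p else 1)))); last first.
  move=> A; rewrite /chi [in LHS]big_mkcond [X in _ * X]big_mkcond -big_split /=.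
  apply: eq_bigr => i _.
  by case: (i \in S); case: (i \in U); case: (i \in A); rewrite ?sub0r.
rewrite Ex_prod; have [<-|SU] := eqVneq S U.
  rewrite mul1r -(prodr_const (mem S)) [RHS]big_mkcond /=.
  by apply: eq_bigr => i _; case: (i \in S); ring.
have /existsP[i iAB] : [exists i, (i \in S) != (i \in U)].
  apply: contraNT SU => /existsPn h; apply/eqP/setP => i.
  by have := h i; rewrite negbK => /eqP.
by rewrite mul0r (bigD1 i) //=; case: (i \in S) (i \in U) iAB => [] [] //= _;
  rewrite [X in X * _](_ : _ = 0) ?mul0r //; ring.
Qed.

Lemma Ex_ev2 p c c' :
  Ex p (fun A => ev p c A * ev p c' A) =
  \sum_S c S * c' S * (p * (1 - p)) ^+ #|S|.
Proof.
transitivity (Ex p (fun A => \sum_S \sum_U (c S * c' U) * (chi p S A * chi p U A))).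
  apply: eq_Ex => A; rewrite /ev big_distrl /=; apply: eq_bigr => S _.
  rewrite big_distrr /=; apply: eq_bigr => U _; ring.
rewrite Ex_sum; apply: eq_bigr => S _; rewrite Ex_sum (bigD1 S) //=.
rewrite ExZ Ex_chi2 eqxx mul1r [X in _ + X]big1 ?addr0 // => U US.
by rewrite ExZ Ex_chi2 eq_sym (negPf US) mul0r mulr0.
Qed.

Lemma Ex_coord p i phi :
  Ex p phi = Ex p (fun A => p * phi (i |: A) + (1 - p) * phi (A :\ i)).
Proof.
rewrite /Ex !(big_set_split i); apply: eq_bigr => A iA.
have -> : i |: (i |: A) = i |: A by rewrite setUA setUid.
have -> : (i |: A) :\ i = A by rewrite setU1K.
have -> : A :\ i = A by apply/setDidPl; rewrite disjoint_sym disjoints1.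
have := wt_setU1 p iA; set x := wt p A; set y := wt p _ => h.
have [s [-> ->]] : exists s, x = (1 - p) * s /\ y = p * s.
  by exists (x + y); split; rewrite mulrDr; [rewrite h|rewrite -h]; ring.
ring.
Qed.


Lemma chi_setU1 p i S A : i \notin S ->
  chi p (i |: S) A = ((i \in A)%:R - p) * chi p S A.
Proof. by move=> iS; rewrite /chi big_setU1. Qed.

Lemma chi_indep p i S A : i \notin S -> chi p S (i |: A) = chi p S A.
Proof.
move=> iS; apply: eq_bigr => j jS; rewrite in_setU1; case: eqP => // ji.
by rewrite -ji jS in iS.
Qed.

Lemma chi_indepD p i S A : i \notin S -> chi p S (A :\ i) = chi p S A.
Proof.
move=> iS; apply: eq_bigr => j jS; rewrite in_setD1; case: eqP => // ji.
by rewrite -ji jS in iS.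
Qed.

Definition dcoef i c S : R := if i \in S then 0 else c (i |: S).

Lemma ev_dcoef p i c A :
  ev p (dcoef i c) A = ev p c (i |: A) - ev p c (A :\ i).
Proof.
rewrite /ev !(big_set_split i) -sumrB /=; apply: eq_bigr => S iS.
rewrite /dcoef setU11 (negPf iS) mul0r addr0 !chi_setU1 //.
rewrite !chi_indep // !chi_indepD // !inE eqxx /=; ring.
Qed.

(* [Ex p] of the square of the iterated discrete derivative of [ev p c] along [S]. *)
Definition weight p c S : R :=
  \sum_(U : {set T} | S \subset U) c U ^+ 2 * (p * (1 - p)) ^+ #|U :\: S|.

Lemma weight_ge0 p c S : 0 <= p <= 1 -> 0 <= weight p c S.
Proof.
move=> hp; apply: sumr_ge0 => U _; rewrite mulr_ge0 ?sqr_ge0 // exprn_ge0 //.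
by case/andP: hp => ? ?; rewrite mulr_ge0 // subr_ge0.
Qed.

Lemma weight_dcoef p i c S :
  weight p (dcoef i c) S = if i \in S then 0 else weight p c (i |: S).
Proof.
rewrite /weight; case: ifP => iS.
  rewrite big1 // => U /subsetP SU; by rewrite /dcoef SU // expr0n mul0r.
rewrite big_mkcond (big_set_split i) [RHS]big_mkcond (big_set_split i) /=.
apply: eq_bigr => U iU; rewrite /dcoef setU11 expr0n mul0r if_same addr0 (negPf iU).
rewrite !subUset !sub1set setU11 (negPf iU) /= add0r.
have -> : (S \subset i |: U) = (S \subset U).
  rewrite -subDset (_ : S :\: [set i] = S) //.
  by apply/setDidPl; rewrite disjoint_sym disjoints1 iS.
case: ifP => // _; congr (_ * _ ^+ _).
by rewrite -[U in LHS](setU1K iU) setDDl.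
Qed.

End BiasedMeasure.

(** * Hypercontractivity and influences *)

Section Hypercontractivity.
Variables (R : realFieldType) (T : finType) (p : R).
Hypothesis hp : 0 <= p <= 1.
Implicit Types (A B S U D : {set T}) (c : {set T} -> R).
Let w := p * (1 - p).

Let w_ge0 : 0 <= w.
Proof. by case/andP: hp => ? ?; rewrite mulr_ge0 // subr_ge0. Qed.

(** Hypercontractivity on one coordinate. The term [g1 ^+ 2 * h1 ^+ 2] carries [p * (1 - p)] and not
    its square, because the fourth moment of a centred biased bit is of that order; this is how
    [weight] enters the general bound. *)
Lemma two_point_ineq (g0 g1 h0 h1 : R) :
  p * ((g0 + (1 - p) * (2^-1 * g1)) ^+ 2 * (h0 + (1 - p) * (2^-1 * h1)) ^+ 2)
  + (1 - p) * ((g0 - p * (2^-1 * g1)) ^+ 2 * (h0 - p * (2^-1 * h1)) ^+ 2) <=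
  g0 ^+ 2 * h0 ^+ 2
  + p * (1 - p) * (g0 ^+ 2 * h1 ^+ 2 + g1 ^+ 2 * h0 ^+ 2 + g1 ^+ 2 * h1 ^+ 2).
Proof.
have [p0 p1] := andP hp; rewrite -subr_ge0.
(* The difference of the two sides is written as a nonnegative combination of squares. The third and
   fourth central moments of the bit are [w * t] and [w * (1 - 3 * w)], which explains the
   coefficients. *)
pose t := 1 - 2 * p.
have : 0 <= w * (2^-1 * (g0 * h1 - g1 * h0) ^+ 2
    + 4^-1 * (g0 * h1 - t / 2 * (g1 * h1)) ^+ 2
    + 4^-1 * (h0 * g1 - t / 2 * (g1 * h1)) ^+ 2
    + (g1 * h1) ^+ 2 * (1 - t ^+ 2 / 8 - (1 - 3 * w) / 16)).
  apply: mulr_ge0 => //; rewrite !addr_ge0 //; last first.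
    by apply: mulr_ge0; [exact: sqr_ge0 | have := w_ge0; rewrite /t /w; nra].
  - by apply: mulr_ge0; [rewrite invr_ge0 | exact: sqr_ge0].
  - by apply: mulr_ge0; [rewrite invr_ge0 | exact: sqr_ge0].
  - by apply: mulr_ge0; [rewrite invr_ge0 | exact: sqr_ge0].
rewrite /w /t; set X := (X in 0 <= X -> _); set Y := (Y in _ -> 0 <= Y).
suff -> : X = Y by [].
by rewrite /X /Y; field.
Qed.

(* The noise operator with parameter 1/2, on Fourier coefficients. *)
Definition half c S : R := 2^-1 ^+ #|S| * c S.

Lemma weight_decomp i c S : i \notin S ->
  weight p c S = weight p (fun U => if i \in U then 0 else c U) S
                 + w * weight p (dcoef i c) S.
Proof.
move=> iS; rewrite /weight !(big_mkcond (fun U => S \subset U)) !(big_set_split i).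
rewrite big_distrr -big_split /=; apply: eq_bigr => U iU.
rewrite setU11 (negPf iU) /dcoef setU11 (negPf iU) expr0n /= mul0r !if_same addr0.
rewrite addr0; congr (_ + _).
have -> : (S \subset i |: U) = (S \subset U).
  rewrite -subDset (_ : S :\: [set i] = S) //.
  by apply/setDidPl; rewrite disjoint_sym disjoints1.
case: ifP => // SU; last by rewrite mulr0.
rewrite (_ : (i |: U) :\: S = i |: (U :\: S)); last first.
  by rewrite setDUl; congr (_ :|: _); apply/setDidPl; rewrite disjoints1.
by rewrite cardsU1 inE (negPf iU) andbF /= -/w (exprS w) mulrCA.
Qed.

(* Stating the bound for two functions lets the induction on the number of
   coordinates close without any use of Cauchy-Schwarz. *)
Lemma hypercontractive_ev c c' :
  Ex p (fun A => ev p (half c) A ^+ 2 * ev p (half c') A ^+ 2) <=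
  \sum_(S : {set T}) w ^+ #|S| * (weight p c S * weight p c' S).
Proof.
suff H n : forall D c c', #|D| = n ->
    (forall S, ~~ (S \subset D) -> c S = 0) ->
    (forall S, ~~ (S \subset D) -> c' S = 0) ->
  Ex p (fun A => ev p (half c) A ^+ 2 * ev p (half c') A ^+ 2) <=
  \sum_(S : {set T}) w ^+ #|S| * (weight p c S * weight p c' S).
  by apply: (H _ setT) => // S; rewrite subsetT.
elim: n => [|n IH] D {}c {}c' cD h h'.
  have D0 : D = set0 by apply/eqP; rewrite -cards_eq0 cD.
  have ev0 e A : (forall S, ~~ (S \subset D) -> e S = 0) -> ev p (half e) A = e set0.
    move=> he; rewrite /ev (bigD1 set0) //= big1 => [|S S0].
      by rewrite /half /chi cards0 big_set0 expr0 !mul1r mulr1 addr0.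
    by rewrite /half he ?mulr0 ?mul0r // D0 subset0.
  have w0 e : (forall S, ~~ (S \subset D) -> e S = 0) -> weight p e set0 = e set0 ^+ 2.
    move=> he; rewrite /weight (bigD1 set0) //= big1 => [|S /andP[_ S0]].
      by rewrite set0D cards0 expr0 mulr1 addr0.
    by rewrite he ?expr0n ?mul0r // D0 subset0.
  rewrite (eq_Ex _ (psi := fun=> c set0 ^+ 2 * c' set0 ^+ 2)); last first.
    by move=> A; rewrite !ev0.
  rewrite ExC (bigD1 set0) //= cards0 expr0 mul1r !w0 // lerDl.
  apply: sumr_ge0 => S _; rewrite mulr_ge0 ?exprn_ge0 // mulr_ge0 ?weight_ge0 //.
have [i iD] : exists i, i \in D by apply/card_gt0P; rewrite cD.
(* [c0 e] and [dcoef i e] are the parts of [e] without and with the coordinate [i]. Both are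
   supported on subsets of [D :\ i], and the noise adds a factor 1/2 to the second only. *)
pose c0 e S : R := if i \in S then 0 else e S.
have cD' : #|D :\ i| = n by move: cD; rewrite (cardsD1 i) iD add1n => -[].
have s0 e : (forall S, ~~ (S \subset D) -> e S = 0) ->
    forall S, ~~ (S \subset D :\ i) -> c0 e S = 0.
  move=> he S; rewrite /c0 subsetD1; case: (i \in S) => //=.
  by rewrite andbT => /he.
have s1 (e : {set T} -> R) : (forall S, ~~ (S \subset D) -> e S = 0) ->
    forall S, ~~ (S \subset D :\ i) -> dcoef i e S = 0.
  move=> he S; rewrite /dcoef subsetD1; case: (i \in S) => //=.
  rewrite andbT => hS; apply: he; apply: contra hS => /subsetP hS.
  by apply/subsetP => j jS; apply: hS; rewrite inE jS orbT.
have evE e A : ev p (half e) A = ev p (half (c0 e)) A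
    + ((i \in A)%:R - p) * (2^-1 * ev p (half (dcoef i e)) A).
  rewrite /ev !(big_set_split i) !big_distrr -big_split /=; apply: eq_bigr => S iS.
  rewrite /c0 /dcoef /half setU11 (negPf iS) cardsU1 iS exprS !mulr0 !mul0r.
  rewrite chi_setU1 //; ring.
have ind0 e A : ev p (half (c0 e)) (i |: A) = ev p (half (c0 e)) A /\
    ev p (half (c0 e)) (A :\ i) = ev p (half (c0 e)) A.
  split; apply: eq_bigr => S _; rewrite /half /c0; case: ifP => iS;
  by rewrite ?mulr0 ?mul0r // ?chi_indep ?chi_indepD ?iS.
have ind1 e A : ev p (half (dcoef i e)) (i |: A) = ev p (half (dcoef i e)) A /\
    ev p (half (dcoef i e)) (A :\ i) = ev p (half (dcoef i e)) A.
  split; apply: eq_bigr => S _; rewrite /half /dcoef; case: ifP => iS;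
  by rewrite ?mulr0 ?mul0r // ?chi_indep ?chi_indepD ?iS.
pose g0 A := ev p (half (c0 c)) A; pose g1 A := ev p (half (dcoef i c)) A.
pose h0 A := ev p (half (c0 c')) A; pose h1 A := ev p (half (dcoef i c')) A.
rewrite (Ex_coord p i).
apply: (@le_trans _ _ (Ex p (fun A => g0 A ^+ 2 * h0 A ^+ 2
  + w * (g0 A ^+ 2 * h1 A ^+ 2 + g1 A ^+ 2 * h0 A ^+ 2 + g1 A ^+ 2 * h1 A ^+ 2)))).
  apply: le_Ex => // A.
  have E1 e : ev p (half e) (i |: A) = ev p (half (c0 e)) A
      + (1 - p) * (2^-1 * ev p (half (dcoef i e)) A).
    by rewrite evE setU11 (ind0 _ _).1 (ind1 _ _).1 mulr1n.
  have E2 e : ev p (half e) (A :\ i) = ev p (half (c0 e)) A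
      - p * (2^-1 * ev p (half (dcoef i e)) A).
    by rewrite evE setD11 (ind0 _ _).2 (ind1 _ _).2 sub0r mulNr.
  rewrite !E1 !E2 -/(g0 A) -/(g1 A) -/(h0 A) -/(h1 A) /w.
  exact: two_point_ineq.
rewrite ExD ExZ !ExD.
have I1 := IH _ _ _ cD' (s0 _ h) (s0 _ h').
have I2 := IH _ _ _ cD' (s0 _ h) (s1 _ h').
have I3 := IH _ _ _ cD' (s1 _ h) (s0 _ h').
have I4 := IH _ _ _ cD' (s1 _ h) (s1 _ h').
apply: le_trans (lerD I1 (ler_wpM2l w_ge0 (lerD (lerD I2 I3) I4))) _.
rewrite !(big_set_split i) /= -!big_split /= big_distrr -big_split /=.
apply: ler_sum => S iS.
have V0 e : weight p (c0 e) (i |: S) = 0.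
  rewrite /weight big1 // => U /subsetP SU.
  by rewrite /c0 SU ?setU11 // expr0n mul0r.
rewrite !V0 !weight_dcoef (negPf iS) !mul0r !mulr0 !addr0.
rewrite (weight_decomp c iS) (weight_decomp c' iS) !weight_dcoef (negPf iS).
rewrite -subr_ge0.
set a0 := weight p (fun _ => _) S; set a1 := weight p c _.
set b0 := weight p (fun _ => _) S; set b1 := weight p c' _.
(* The term [a1 * b1] on the left is matched by the summand of [i |: S] on the right; what is left
   over is the cross term of the product of the two decompositions. *)
set X := (X in 0 <= X); suff -> : X = w ^+ #|S| * (w ^+ 2 * (a1 * b1)).
  by rewrite mulr_ge0 ?exprn_ge0 // mulr_ge0 ?exprn_ge0 // mulr_ge0 ?weight_ge0.
by rewrite /X cardsU1 iS add1n exprS; ring.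
Qed.


(** The derivative along [i |: S] is a difference of two derivatives along [S], and by monotonicity
    each is bounded through the oscillation of [f] over the larger box. This doubles the constant
    once for every coordinate after the first. *)
Lemma ev_derivative_bound c f : (forall A, f A = ev p c A) ->
  (forall A B, A \subset B -> f A <= f B) ->
  forall n S, #|S| = n.+1 -> exists2 e : {set T} -> R,
    (forall U, e U = if [disjoint U & S] then c (U :|: S) else 0) &
    forall A, `|ev p e A| <= 2 ^+ n * (f (A :|: S) - f (A :\: S)).
Proof.
move=> fE fmono; elim=> [|n IH] S cS.
  move/eqP/cards1P: cS => [i ->]; exists (dcoef i c) => [U|A].
    by rewrite /dcoef disjoint_sym disjoints1 setUC; case: (i \in U).
  rewrite ev_dcoef -!fE [A :|: _]setUC expr0 mul1r ger0_norm // subr_ge0 fmono //.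
  by apply: (subset_trans (subsetDl _ _)); exact: subsetUr.
have [i iS] : exists i, i \in S by apply/card_gt0P; rewrite cS.
have cS' : #|S :\ i| = n.+1 by move: cS; rewrite (cardsD1 i) iS add1n => -[].
have [e eE he] := IH _ cS'; exists (dcoef i e) => [U|A].
  rewrite /dcoef eE !disjoints_subset; case: ifP => iU.
    by case: ifP => // /subsetP/(_ i iU); rewrite inE iS.
  rewrite subUset sub1set !inE eqxx /= (_ : (U \subset _) = (U \subset ~: S)).
    by case: ifP => // _; rewrite -[S in RHS](setD1K iS) setUCA setUA.
  apply/subsetP/subsetP => h j jU; have := h j jU; rewrite !inE.
    by case: eqP jU iU => // -> ->.
  by move=> /negPf ->; rewrite andbF.
rewrite ev_dcoef; apply: le_trans (ler_normB _ _) _.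
have h1 := he (i |: A); have h2 := he (A :\ i).
apply: le_trans (lerD h1 h2) _; rewrite exprS -mulrA mulrCA -mulrDr.
rewrite ler_wpM2l ?exprn_ge0 //.
have m1 : f ((i |: A) :|: S :\ i) <= f (A :|: S).
  by apply: fmono; rewrite -setUA setUCA setD1K.
have m2 : f (A :\: S) <= f ((i |: A) :\: (S :\ i)).
  apply: fmono; apply/subsetP => j; rewrite !inE => /andP[jS jA].
  by rewrite jA (negPf jS) andbF orbT.
have m3 : f (A :\ i :|: S :\ i) <= f (A :|: S).
  by apply: fmono; rewrite setUSS ?subsetDl.
have m4 : f (A :\: S) <= f (A :\ i :\: (S :\ i)).
  by apply: fmono; rewrite setDDl setD1K.
lra.
Qed.

(** Parseval for the iterated derivative. Its oscillation bound lies between 0 and 1 up to a power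
    of 2, so squaring costs only the constant. *)
Lemma weight_bound c f : (forall A, f A = ev p c A) ->
  (forall A B, A \subset B -> f A <= f B) -> (forall A, 0 <= f A <= 1) ->
  forall S, S != set0 ->
  weight p c S <= 4 ^+ #|S| * (Ex p (fun A => f (A :|: S)) - Ex p (fun A => f (A :\: S))).
Proof.
move=> fE fmono f01 S; rewrite -card_gt0.
case cS : #|S| => [//|n] _; have [e eE he] := ev_derivative_bound fE fmono cS.
have -> : weight p c S = Ex p (fun A => ev p e A * ev p e A).
  rewrite Ex_ev2 /weight (reindex_onto (fun U => U :|: S) (fun U => U :\: S)) /=.
    rewrite big_mkcond /=; apply: eq_bigr => U _; rewrite eE subsetUr /=.
    have -> : ((U :|: S) :\: S == U) = [disjoint U & S].
      by rewrite setDUl setDv setU0; apply/eqP/idP => [/setDidPl//|/setDidPl].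
    case: ifP => [dUS|]; last by rewrite !mul0r.
    rewrite setDUl setDv setU0 (_ : U :\: S = U) ?expr2 //.
    by apply/setDidPl.
  by move=> U SU; rewrite setUC -{1}(setIidPr SU) setID.
rewrite -ExB -ExZ; apply: le_Ex => // A.
have := he A; have /andP[] := f01 (A :|: S); have /andP[] := f01 (A :\: S).
set x := f _; set y := f _ => x0 x1 y0 y1 h.
have xy : 0 <= y - x by rewrite subr_ge0 fmono // (subset_trans (subsetDl _ _)) ?subsetUl.
rewrite -expr2 -real_normK ?num_real //.
apply: (@le_trans _ _ ((2 ^+ n * (y - x)) ^+ 2)).
  by rewrite lerXn2r ?nnegrE ?normr_ge0 // mulr_ge0 ?exprn_ge0.
rewrite exprMn -exprM mulnC exprM (_ : 2 ^+ 2 = 4 :> R); last by rewrite -natrX.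
rewrite (exprS 4); set u := 4 ^+ n; have u0 : 0 <= u by rewrite exprn_ge0.
apply: (@le_trans _ _ (u * (y - x))); first by rewrite ler_wpM2l //; nra.
by rewrite -mulrA ler_peMl ?mulr_ge0 // ler1n.
Qed.



(** [c2] undoes the noise in advance. In degree below [n] this multiplies each weight by at most
    [4 ^+ n], and the weights occur squared. *)
Lemma Ex_pow4 c (n : nat) : (forall S, (n <= #|S|)%N -> c S = 0) ->
  Ex p (fun A => ev p c A ^+ 4) <=
  16 ^+ n * \sum_(S : {set T}) w ^+ #|S| * weight p c S ^+ 2.
Proof.
move=> cn; pose c2 S : R := 2 ^+ #|S| * c S.
have hE A : ev p c A = ev p (half c2) A.
  apply: eq_bigr => S _; congr (_ * _).
  by rewrite /half /c2 mulrA -exprMn mulVf ?pnatr_eq0 // expr1n mul1r.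
rewrite (eq_Ex _ (psi := fun A => ev p (half c2) A ^+ 2 * ev p (half c2) A ^+ 2)); last first.
  by move=> A; rewrite hE -exprD.
apply: le_trans (hypercontractive_ev _ _) _.
rewrite big_distrr /=; apply: ler_sum => S _.
rewrite [leRHS]mulrCA ler_wpM2l ?exprn_ge0 // -expr2.
rewrite (_ : 16 = 4 ^+ 2 :> R) 1?exprAC; last by rewrite -natrX.
rewrite -exprMn lerXn2r ?nnegrE ?mulr_ge0 ?weight_ge0 ?exprn_ge0 //.
rewrite /weight big_distrr /=; apply: ler_sum => U _; rewrite mulrA.
rewrite ler_wpM2r ?exprn_ge0 // /c2; have [nU|Un] := leqP n #|U|.
  by rewrite cn // !mulr0 expr0n mulr0.
rewrite exprMn ler_wpM2r ?sqr_ge0 // exprAC (_ : 2 ^+ 2 = 4 :> R); last by rewrite -natrX.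
by rewrite ler_weXn2l ?ler1n // ltnW.
Qed.

(** After exchanging the sums, the coefficient of [U] is counted once for each subset of [U]. *)
Lemma sum_weight c (n : nat) : (forall S, (n <= #|S|)%N -> c S = 0) ->
  \sum_(S : {set T}) w ^+ #|S| * weight p c S <= 2 ^+ n * \sum_(S : {set T}) c S ^+ 2 * w ^+ #|S|.
Proof.
move=> cn; rewrite /weight; under eq_bigr do rewrite big_distrr /=.
rewrite (exchange_big_dep predT) //= big_distrr /=; apply: ler_sum => U _.
rewrite (eq_bigr (fun=> c U ^+ 2 * w ^+ #|U|)); last first.
  move=> S SU; rewrite mulrCA -exprD; congr (_ * _ ^+ _).
  by rewrite cardsD (setIidPr SU) subnKC // subset_leq_card.
rewrite (eq_bigl (fun S => S \in powerset U)); last by move=> S; rewrite powersetE.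
rewrite sumr_const card_powerset -(mulr_natl _ (2 ^ _)) natrX.
have [nU|Un] := leqP n #|U|.
  by rewrite cn // expr0n mul0r !mulr0.
by rewrite ler_wpM2r ?(mulr_ge0 (sqr_ge0 _)) ?exprn_ge0 // ler_weXn2l ?ler1n // ltnW.
Qed.


(* Apply hypercontractivity to the discrete derivatives [D_i f], which are
   indicator functions: with [g] the low-degree part of [h = D_i f],
   [(E g^2)^4 = (E h g)^4 <= (E h)^3 E g^4]. *)
Lemma low_degree_derivative c f (d : nat) (theta : R) i :
  (forall A, f A = ev p c A) ->
  (forall A B, A \subset B -> f A <= f B) -> (forall A, f A = 0 \/ f A = 1) ->
  0 <= theta ->
  (forall S, (0 < #|S| <= d)%N ->
    Ex p (fun A => f (A :|: S)) - Ex p (fun A => f (A :\: S)) <= theta ^+ 4 / 128 ^+ d) ->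
  \sum_(S : {set T} | (#|S| < d)%N) dcoef i c S ^+ 2 * w ^+ #|S| <=
  theta * Ex p (fun A => f (i |: A) - f (A :\ i)).
Proof.
move=> fE fmono f01 th0 hb; set h := fun A => f (i |: A) - f (A :\ i).
have f01' A : 0 <= f A <= 1 by case: (f01 A) => ->; rewrite ?lexx ?ler01.
have hh A : h A ^+ 2 = h A.
  have : f (A :\ i) <= f (i |: A).
    by apply: fmono; apply: (subset_trans (subsetDl _ _)); exact: subsetUr.
  rewrite /h; case: (f01 (A :\ i)) (f01 (i |: A)) => -> [] ->; rewrite ?lexx; lra.
pose g S := if (#|S| < d)%N then dcoef i c S else 0.
have gn S : (d <= #|S|)%N -> g S = 0 by rewrite /g ltnNge => ->.
set E2 := \sum_(S | _) _.
have hE A : h A = ev p (dcoef i c) A by rewrite ev_dcoef -!fE.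
have E2E : E2 = Ex p (fun A => h A * ev p g A).
  rewrite (eq_Ex _ (psi := fun A => ev p (dcoef i c) A * ev p g A)); last first.
    by move=> A; rewrite -hE.
  rewrite Ex_ev2 /E2 big_mkcond /=; apply: eq_bigr => S _.
  by rewrite /g; case: ifP; rewrite ?mulr0 ?mul0r // expr2.
have E2E' : E2 = \sum_(S : {set T}) g S ^+ 2 * w ^+ #|S|.
  rewrite /E2 big_mkcond /=; apply: eq_bigr => S _.
  by rewrite /g; case: ifP; rewrite ?expr0n ?mul0r.
set Eh := Ex p h.
have CS (u v : {set T} -> R) :
    Ex p (fun A => u A * v A) ^+ 2 <= Ex p (fun A => u A ^+ 2) * Ex p (fun A => v A ^+ 2).
  set a := Ex p (fun A => u A ^+ 2); set b := Ex p (fun A => u A * v A).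
  set e := Ex p (fun A => v A ^+ 2).
  have H s t : 0 <= s ^+ 2 * a + 2 * s * t * b + t ^+ 2 * e.
    rewrite -!ExZ -!ExD; apply: Ex_ge0 => // A.
    by rewrite (_ : _ + _ = (s * u A + t * v A) ^+ 2) ?sqr_ge0 //; ring.
  have a0 : 0 <= a by apply: Ex_ge0 => // A; exact: sqr_ge0.
  have e0 : 0 <= e by apply: Ex_ge0 => // A; exact: sqr_ge0.
  have [e_gt0|e_le0] := ltP 0 e.
    by rewrite -(ler_pM2l e_gt0); have := H e (- b); lra.
  (* For [e = 0] the quadratic form at this point equals [- b ^+ 2], which forces [b = 0]. *)
  have := H b (- ((a + 1) / 2)); have -> : e = 0 by apply/eqP; rewrite eq_le e_le0 e0.
  by rewrite mulr0 => h1; lra.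
have Eh0 : 0 <= Eh by apply: Ex_ge0 => // A; rewrite -hh sqr_ge0.
have E20 : 0 <= E2.
  by apply: sumr_ge0 => S _; rewrite (mulr_ge0 (sqr_ge0 _)) ?exprn_ge0.
have [d0|d_gt0] := posnP d.
  by rewrite /E2 big1 ?mulr_ge0 // => S; rewrite d0.
have E4 : Ex p (fun A => ev p g A ^+ 4) <= theta ^+ 4 * E2.
  apply: le_trans (Ex_pow4 gn) _.
  pose dl := theta ^+ 4 / 128 ^+ d.
  have dl0 : 0 <= dl by rewrite divr_ge0 ?exprn_ge0.
  (* The origin of 128: a factor 16 from [Ex_pow4], 4 from [weight_bound] and 2 from [sum_weight],
     each to the power [d]. *)
  have -> : theta ^+ 4 = 16 ^+ d * (4 ^+ d * dl * 2 ^+ d).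
    rewrite /dl (_ : 128 = 16 * (4 * 2)) ?exprMn; last by rewrite -!natrM.
    by field; rewrite !expf_eq0 !pnatr_eq0 !andbF.
  rewrite -mulrA ler_wpM2l ?exprn_ge0 //.
  have := sum_weight gn; rewrite -E2E' => hs.
  rewrite -[leRHS]mulrA; apply: le_trans (ler_wpM2l (mulr_ge0 (exprn_ge0 d (ler0n R 4)) dl0) hs).
  rewrite big_distrr /=; apply: ler_sum => S _.
  rewrite expr2 [leRHS]mulrCA ler_wpM2l ?exprn_ge0 // ler_wpM2r ?weight_ge0 //.
  have dd0 : 0 <= 4 ^+ d * dl by rewrite (mulr_ge0 _ dl0) ?exprn_ge0.
  have gw : weight p g S <= weight p (dcoef i c) S.
    apply: ler_sum => U _; rewrite ler_wpM2r ?exprn_ge0 //.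
    by rewrite /g; case: ifP => //; rewrite expr0n sqr_ge0.
  have [dS|Sd] := leqP d #|S|.
    rewrite /weight big1 // => U SU.
    by rewrite gn ?expr0n ?mul0r // (leq_trans dS) // subset_leq_card.
  apply: le_trans gw _; rewrite weight_dcoef; case: ifP => // iS.
  have cS : #|i |: S| = #|S|.+1 by rewrite cardsU1 iS.
  have iS0 : i |: S != set0 by rewrite -card_gt0 cS.
  apply: le_trans (weight_bound fE fmono f01' iS0) _.
  rewrite ler_pM ?exprn_ge0 //; last by apply: hb; rewrite cS.
    rewrite subr_ge0; apply: le_Ex => // A; apply: fmono.
    by apply: (subset_trans (subsetDl _ _)); exact: subsetUl.
  by rewrite ler_weXn2l ?ler1n // cS.
have C1 : E2 ^+ 2 <= Eh * Ex p (fun A => h A * ev p g A ^+ 2).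
  have := CS h (fun A => h A * ev p g A).
  rewrite (eq_Ex _ (psi := fun A => h A * ev p g A)); last first.
    by move=> A; rewrite mulrA -expr2 hh.
  rewrite -E2E (eq_Ex _ hh) => /le_trans; apply.
  rewrite ler_wpM2l // le_eqVlt; apply/orP; left; apply/eqP/eq_Ex => A.
  by rewrite exprMn hh.
have C2 := CS h (fun A => ev p g A ^+ 2).
have {C2} : Ex p (fun A => h A * ev p g A ^+ 2) ^+ 2 <= Eh * (theta ^+ 4 * E2).
  apply: le_trans C2 _; rewrite (eq_Ex _ hh) ler_wpM2l //.
  by rewrite (eq_Ex _ (psi := fun A => ev p g A ^+ 4)) // => A; rewrite -exprM.
set G := Ex p _ => C2.
have G0 : 0 <= G by apply: Ex_ge0 => // A; rewrite -hh mulr_ge0 ?sqr_ge0.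
have C3 : E2 ^+ 4 <= Eh ^+ 3 * theta ^+ 4 * E2.
  rewrite (_ : E2 ^+ 4 = (E2 ^+ 2) ^+ 2); last by rewrite -exprM.
  apply: (@le_trans _ _ ((Eh * G) ^+ 2)).
    by rewrite lerXn2r ?nnegrE ?mulr_ge0 ?sqr_ge0.
  rewrite exprMn; apply: le_trans (ler_wpM2l (sqr_ge0 Eh) C2) _.
  by rewrite le_eqVlt; apply/orP; left; apply/eqP; ring.
(* Replacing the last factor [E2] of [C3] by [Eh] leaves fourth powers on both sides and avoids
   dividing by [E2], which may vanish. *)
have E2h : E2 <= Eh.
  rewrite /Eh -(eq_Ex _ hh) (eq_Ex _ (psi := fun A => ev p (dcoef i c) A * ev p (dcoef i c) A)).
    rewrite Ex_ev2 /E2 big_mkcond; apply: ler_sum => S _.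
    by case: ifP => _; rewrite -expr2 // (mulr_ge0 (sqr_ge0 _)) ?exprn_ge0.
  by move=> A; rewrite expr2 -hE.
rewrite -(@ler_pXn2r _ 4) ?nnegrE ?mulr_ge0 // exprMn.
apply: le_trans C3 _; rewrite -mulrA mulrCA ler_wpM2l ?exprn_ge0 //.
by rewrite (exprSr Eh 3) ler_wpM2l ?exprn_ge0.
Qed.

(** Each [S] is counted once for every [i \in S]. Removing [i] lowers the degree by one, hence the
    predecessor on the right. *)
Lemma total_influence c f (P : pred nat) : (forall A, f A = ev p c A) ->
  \sum_i \sum_(S : {set T} | P #|S|) dcoef i c S ^+ 2 * w ^+ #|S|.+1 =
  \sum_(S : {set T} | P #|S|.-1) #|S|%:R * (c S ^+ 2 * w ^+ #|S|).
Proof.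
move=> fE.
transitivity (\sum_i \sum_(S : {set T} | P #|S|.-1 && (i \in S)) c S ^+ 2 * w ^+ #|S|).
  apply: eq_bigr => i _; rewrite [RHS]big_mkcond [LHS]big_mkcond /= !(big_set_split i).
  apply: eq_bigr => S iS; rewrite (negPf iS) andbF add0r setU11 andbT.
  rewrite /dcoef (negPf iS) setU11 expr0n mul0r if_same addr0.
  by rewrite cardsU1 iS.
rewrite (exchange_big_dep (fun S : {set T} => P #|S|.-1)) /=; last by move=> i S _ /andP[].
apply: eq_bigr => S PS; rewrite (eq_bigl (fun i => i \in S)).
  by rewrite sumr_const mulr_natl.
by move=> i; rewrite PS.
Qed.

(** Degrees above [d] carry at most a fraction [1 / d] of the total influence as variance; degrees
    up to [d] are controlled by [low_degree_derivative]. So without a booster the influence is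
    large. *)
Lemma variance_le_influence f (d : nat) (theta : R) :
  (forall A B, A \subset B -> f A <= f B) -> (forall A, f A = 0 \/ f A = 1) ->
  0 <= theta ->
  (forall S, (0 < #|S| <= d)%N ->
    Ex p (fun A => f (A :|: S)) - Ex p (fun A => f (A :\: S)) <= theta ^+ 4 / 128 ^+ d) ->
  Ex p f * (1 - Ex p f) * d%:R <=
  (theta * d%:R + 1) * (w * \sum_i Ex p (fun A => f (i |: A) - f (A :\ i))).
Proof.
move=> fmono f01 th0 hb; have [c fE] := ev_exists p f.
set h := fun i A => f (i |: A) - f (A :\ i).
have hh i A : h i A ^+ 2 = h i A.
  have : f (A :\ i) <= f (i |: A).
    by apply: fmono; apply: (subset_trans (subsetDl _ _)); exact: subsetUr.
  rewrite /h; case: (f01 (A :\ i)) (f01 (i |: A)) => -> [] ->; rewrite ?lexx; lra.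
set I := w * _.
pose t S := c S ^+ 2 * w ^+ #|S|.
have t0 S : 0 <= t S by rewrite /t (mulr_ge0 (sqr_ge0 _)) ?exprn_ge0.
have IE : I = \sum_(S : {set T}) #|S|%:R * t S.
  rewrite -(total_influence (fun=> true) fE) /I big_distrr /=; apply: eq_bigr => i _.
  rewrite -(eq_Ex _ (hh i)) (eq_Ex _ (psi := fun A => ev p (dcoef i c) A * ev p (dcoef i c) A)).
    by rewrite Ex_ev2 big_distrr /=; apply: eq_bigr => S _; rewrite (exprS w) -expr2 mulrCA.
  by move=> A; rewrite ev_dcoef -!fE -expr2.
have VE : Ex p f * (1 - Ex p f) = \sum_(S : {set T} | S != set0) t S.
  have h1 : Ex p f = \sum_(S : {set T}) t S.
    rewrite (eq_Ex _ (psi := fun A => ev p c A * ev p c A)).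
      by rewrite Ex_ev2; apply: eq_bigr => S _; rewrite -expr2.
    by move=> A; rewrite -fE; case: (f01 A) => ->; rewrite ?mulr0 ?mulr1.
  have h2 : Ex p f = c set0.
    rewrite (eq_Ex _ fE) Ex_ev (bigD1 set0) //= cards0 expr0 mulr1 big1 ?addr0 // => S S0.
    by rewrite subrr expr0n cards_eq0 (negPf S0) mulr0.
  have h3 : Ex p f = Ex p f ^+ 2 + \sum_(S : {set T} | S != set0) t S.
    by rewrite [LHS]h1 (bigD1 set0) //= {1}/t cards0 expr0 mulr1 -h2.
  by rewrite mulrBr mulr1 -expr2 {1}h3 addrC addKr.
have low : \sum_(S : {set T} | (#|S| <= d)%N) #|S|%:R * t S <= theta * I.
  have -> : \sum_(S : {set T} | (#|S| <= d)%N) #|S|%:R * t S =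
     \sum_(S : {set T} | (#|S|.-1 < d)%N) #|S|%:R * t S.
    rewrite big_mkcond [RHS]big_mkcond; apply: eq_bigr => S _.
    by case: #|S| => [|m] //=; rewrite mul0r !if_same.
  rewrite -(total_influence (fun m => (m < d)%N) fE) /I mulrCA !big_distrr /=.
  apply: ler_sum => i _; have := low_degree_derivative i fE fmono f01 th0 hb.
  move=> /(ler_wpM2l w_ge0); apply: le_trans.
  by rewrite big_distrr /=; apply: ler_sum => S _; rewrite (exprS w) mulrCA.
rewrite VE mulrDl mul1r -mulrA [d%:R * I]mulrC mulrA.
apply: (@le_trans _ _ (\sum_(S : {set T} | (#|S| <= d)%N) #|S|%:R * t S * d%:R + I)); last first.
  by rewrite lerD2r -big_distrl /= ler_wpM2r.
rewrite IE big_distrl /= big_mkcond [X in _ <= X + _]big_mkcond -big_split /=.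
apply: ler_sum => S _; case: eqP => [->|/eqP S0].
  by rewrite cards0 leq0n !mul0r addr0.
have S1 : 1 <= #|S|%:R :> R by rewrite ler1n card_gt0.
have := t0 S; case: leqP => [Sd|dS] tS.
  have d0 : 0 <= d%:R * t S by rewrite mulr_ge0.
  have : 0 <= #|S|%:R * t S by rewrite mulr_ge0.
  by have := ler_wpM2r d0 S1; rewrite /=; lra.
have : d%:R <= #|S|%:R :> R by rewrite ler_nat ltnW.
by move/(ler_wpM2r tS); rewrite add0r /= mulrC.
Qed.

End Hypercontractivity.

(** * Replacing linked constraints by free ones *)

Section Coupling.
Variables (R : realFieldType) (T : finType).
Implicit Types (p q r : R) (A B C S : {set T}) (phi : {set T} -> R).

Lemma Ex_exchange p q (psi : {set T} -> {set T} -> R) :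
  Ex p (fun A => Ex q (psi A)) = Ex q (fun B => Ex p (psi^~ B)).
Proof.
rewrite /Ex; under eq_bigr do rewrite big_distrr /=.
rewrite exchange_big; apply: eq_bigr => B _ /=; rewrite big_distrr /=.
by apply: eq_bigr => A _; rewrite mulrCA.
Qed.

(** Sprinkling: a set of density [r] is the union of independent sets of densities [p] and
    [q = (r - p) / (1 - p)]; the case [p = 1] is apart because of the division. *)
Lemma Ex_mono p r phi : 0 <= p -> p <= r -> r <= 1 ->
  (forall A B, A \subset B -> phi A <= phi B) -> Ex p phi <= Ex r phi.
Proof.
move=> p0 pr r1 mono; have [p1|p1] := leP 1 p.
  by have -> : r = p by apply/eqP; rewrite eq_le pr andbT (le_trans r1).
have p1' : 0 < 1 - p by rewrite subr_gt0.
pose q := (r - p) / (1 - p).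
have q0 : 0 <= q by rewrite divr_ge0 ?subr_ge0 // ltW.
have q1 : q <= 1 by rewrite ler_pdivrMr // mul1r lerD2r.
have -> : r = p + q - p * q.
  have : q * (1 - p) = r - p by rewrite divfK ?gt_eqF.
  by lra.
rewrite -Ex_union; apply: le_Ex; first by rewrite p0 ltW.
move=> A; rewrite -{1}(ExC T q (phi A)).
by apply: le_Ex => [|B]; [rewrite q0 | apply: mono; exact: subsetUl].
Qed.

Lemma Ex_union_le p q phi : 0 <= p -> 0 <= q -> p + q <= 1 ->
  (forall A B, A \subset B -> phi A <= phi B) ->
  Ex p (fun A => Ex q (fun B => phi (A :|: B))) <= Ex (p + q) phi.
Proof.
move=> p0 q0 pq mono; rewrite Ex_union.
have pq0 : 0 <= p * q by rewrite mulr_ge0.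
have p1 : p <= 1 by lra.
have := ler_wpM2r q0 p1 => h.
by apply: Ex_mono => //; lra.
Qed.

Lemma Ex_mem p i : Ex p (fun A => (i \in A)%:R) = p.
Proof.
rewrite -[RHS]expr1 -(cards1 i) -Ex_sub; apply: eq_Ex => A.
by rewrite sub1set.
Qed.

Lemma Ex_cardI p C : Ex p (fun A => #|A :&: C|%:R) = p * #|C|%:R.
Proof.
rewrite (eq_Ex _ (psi := fun A => \sum_(i in C) (i \in A)%:R)).
  rewrite Ex_sum (eq_bigr (fun=> p)) => [|i _]; last exact: Ex_mem.
  by rewrite sumr_const mulr_natr.
move=> A; rewrite -sum1_card natr_sum big_mkcond [RHS]big_mkcond /=.
by apply: eq_bigr => i _; rewrite inE andbC; case: (i \in C); case: (i \in A).
Qed.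

Lemma Ex_meet_le p C : 0 <= p <= 1 ->
  Ex p (fun A => (A :&: C != set0)%:R) <= p * #|C|%:R.
Proof.
move=> hp; rewrite -Ex_cardI; apply: le_Ex => // A.
by rewrite -card_gt0 ler_nat; case: #|_|.
Qed.

Lemma Ex_card_gt_le p C (m : nat) : 0 <= p <= 1 ->
  Ex p (fun A => (m < #|A :&: C|)%N%:R) <= p * #|C|%:R / m.+1%:R.
Proof.
move=> hp; rewrite ler_pdivlMr // mulrC -ExZ -Ex_cardI; apply: le_Ex => // A.
by case: ltnP => h; rewrite ?mulr0 // mulr1 ler_nat.
Qed.

Lemma sum_expr_card p C : \sum_(A : {set T} | A \subset C) p ^+ #|A| = (p + 1) ^+ #|C|.
Proof.
rewrite -(prodr_const (mem C) (p + 1)) [RHS]big_mkcond /=.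
rewrite (eq_bigr (fun i => (if i \in C then p else 0) + 1)); last first.
  by move=> i _; case: ifP; rewrite ?add0r.
rewrite bigA_distr big_mkcond /=; apply: eq_bigr => A _.
have [/subsetP AC|/subsetPn[i iA iC]] := boolP (A \subset C).
  rewrite -(prodr_const (mem A) p) big_mkcond /=; apply: eq_bigr => i _.
  by case: ifP => // /AC ->.
by rewrite (bigD1 i) //= iA (negPf iC) mul0r.
Qed.

End Coupling.

(** * Covering by linked elements against covering by fresh free elements *)

Section Replacement.
Variables (R : realFieldType) (T Omega : finType) (cov : T -> {set Omega}).
Implicit Types (p q r : R) (A B C S : {set T}) (X Y Z : {set Omega}).

Definition covered A X := X \subset \bigcup_(e in A) cov e.

Lemma covered0 A : covered A set0.
Proof. exact: sub0set. Qed.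

Lemma coveredU A B X : covered (A :|: B) X = covered B (X :\: \bigcup_(e in A) cov e).
Proof. by rewrite /covered bigcup_setU subDset. Qed.

Lemma covered_mono A B X : A \subset B -> covered A X -> covered B X.
Proof.
move=> AB /subset_trans; apply; apply/bigcupsP => e eA.
by apply: bigcup_sup; apply: (subsetP AB).
Qed.

Variables (p q eps kappa : R) (C0 C1 : {set T}) (Z : {set Omega}).
Hypotheses (hp : 0 <= p <= 1) (hq : 0 <= q <= 1) (heps : 0 <= eps) (hkappa : 0 <= kappa).

Definition killers Y := [set e in C1 | Y \subset cov e].

Hypothesis heavy : forall Y, Y \subset Z -> eps < p * #|killers Y|%:R ->
  Ex q (fun B => (~~ covered (B :&: C0) Y)%:R) <= kappa.

Definition few_cover j X A :=
  [exists A' : {set T}, [&& A' \subset A :&: C1, #|A'| <= j & covered A' X]]%N.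

Definition uncov A X := X :\: \bigcup_(e in A) cov e.

(** The bad event: a chosen element finishes the cover of a remainder whose expected number of
    killers is at most [eps]. Since [e \notin A'], the presence of [e] is independent of that of
    [A']. *)
Definition light_kill X A :=
  [exists A' : {set T}, [exists e, [&& A' \subset C1, e \notin A', e |: A' \subset A,
    p * #|killers (uncov A' X)|%:R <= eps & e \in killers (uncov A' X)]]].

(* Union bound over the pairs [(A', e)], using that [e |: A'] is contained in the
   random set with probability [p ^+ #|A'|.+1]. *)
Lemma Ex_light_kill X : Ex p (fun A => (light_kill X A)%:R) <= eps * (p + 1) ^+ #|C1|.
Proof.
have p0 : 0 <= p by case/andP: hp.
pose ok A' e := [&& e \notin A', p * #|killers (uncov A' X)|%:R <= eps
                  & e \in killers (uncov A' X)].
apply: (@le_trans _ _ (Ex p (fun A => \sum_(A' : {set T} | A' \subset C1)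
     \sum_(e | ok A' e) (e |: A' \subset A)%:R))).
  apply: le_Ex => // A; case: (boolP (light_kill X A)) => [/existsP[A' /existsP[e /and5P[h1 h2 h3 h4 h5]]]|_].
    rewrite (bigD1 A') //= (bigD1 e) /ok ?h2 ?h4 //= h3 -addrA lerDl.
    by rewrite addr_ge0 ?sumr_ge0 // => B _; rewrite sumr_ge0.
  by rewrite sumr_ge0 // => B _; rewrite sumr_ge0.
rewrite Ex_sum -sum_expr_card big_distrr /=; apply: ler_sum => A' A'C.
rewrite Ex_sum (eq_bigr (fun=> p ^+ #|A'|.+1)); last first.
  by move=> e /and3P[eA' _ _]; rewrite Ex_sub cardsU1 eA'.
rewrite sumr_const -(mulr_natl (p ^+ _)) exprS mulrA.
apply: ler_wpM2r; first by rewrite exprn_ge0.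
have [h|h] := boolP (p * #|killers (uncov A' X)|%:R <= eps); last first.
  rewrite eq_card0 ?mul0r ?mulr_ge0 ?exprn_ge0 // => e; apply/negP => /and3P[_ h' _].
  by move/negP: h; apply.
apply: le_trans h; rewrite mulrC ler_wpM2l // ler_nat subset_leq_card //.
by apply/subsetP => e /and3P[].
Qed.

(* Drop one constraint from a cover of [X]: what it alone covered has many
   killers unless [light_kill] occurs, so it is covered by a fresh random set. *)
Lemma few_cover_step j X A : X \subset Z ->
  (few_cover j.+1 X A)%:R <=
  Ex q (fun B => (few_cover j (uncov (B :&: C0) X) A)%:R) + (light_kill X A)%:R + kappa.
Proof.
move=> XZ; have Q0 : 0 <= Ex q (fun B => (few_cover j (uncov (B :&: C0) X) A)%:R) by exact: Ex_ge0.
have [->|X0] := eqVneq X set0.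
  rewrite (eq_Ex _ (psi := fun=> 1)) ?ExC => [|B].
    by rewrite -addrA (le_trans (_ : _ <= 1)) ?lerDl ?addr_ge0 //; case: few_cover.
  rewrite (_ : few_cover _ _ _ = true) //; apply/existsP; exists set0.
  by rewrite sub0set cards0 /uncov set0D covered0.
case: (boolP (few_cover j.+1 X A)) => [/existsP[A' /and3P[A'A A'j A'X]]|_]; last by rewrite !addr_ge0.
have [e eA'] : exists e, e \in A'.
  apply/set0Pn; apply: contraNneq X0 => A'0; move: A'X.
  by rewrite /covered A'0 big_set0 subset0.
have [_|nb] := boolP (light_kill X A); first by rewrite -addrA addrCA lerDl !addr_ge0.
rewrite addr0; pose Y := uncov (A' :\ e) X.
have eY : e \in killers Y.
  rewrite inE (subsetP (subset_trans A'A (subsetIr _ _))) //=.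
  by move: A'X; rewrite -{1}(setD1K eA') setUC coveredU /covered big_set1.
have hY : eps < p * #|killers Y|%:R.
  rewrite ltNge; apply: contra nb => hl; apply/existsP; exists (A' :\ e).
  apply/existsP; exists e; rewrite setD11 setD1K // hl eY.
  by rewrite (subset_trans (subsetDl _ _)) ?(subset_trans A'A) ?subsetIl ?subsetIr.
have /heavy/(_ hY) h : Y \subset Z by rewrite (subset_trans _ XZ) ?subsetDl.
rewrite -lerBlDr; apply: (@le_trans _ _ (1 - Ex q (fun B => (~~ covered (B :&: C0) Y)%:R))).
  by rewrite lerD2l lerN2.
rewrite -{1}(ExC T q 1) -ExB; apply: le_Ex => // B.
have [hB|_] := boolP (covered _ _); last by rewrite subrr.
rewrite subr0 (_ : few_cover _ _ _ = true) //; apply/existsP; exists (A' :\ e).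
rewrite (subset_trans (subsetDl _ _)) //=; apply/andP; split.
  by move: A'j; rewrite (cardsD1 e) eA'.
by rewrite /uncov -coveredU setUC coveredU.
Qed.

(* The density of a union of [j] independent sets of density [q]. *)
Definition multi (j : nat) : R := 1 - (1 - q) ^+ j.

Lemma Ex_few_cover j X : X \subset Z ->
  Ex p (fun A => (few_cover j X A)%:R) <=
  Ex (multi j) (fun B => (covered (B :&: C0) X)%:R)
  + j%:R * (eps * (p + 1) ^+ #|C1| + kappa).
Proof.
have q01 : 0 <= 1 - q <= 1 by case/andP: hq => ? ?; lra.
have m01 i : 0 <= multi i <= 1.
  have [h1 h2] := andP q01.
  by rewrite /multi subr_ge0 gerBl exprn_ge0 // exprn_ile1.
elim: j X => [|j IH] X XZ.
  rewrite mul0r addr0; have [X0|X0] := eqVneq X set0.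
    rewrite X0 [leRHS](eq_Ex _ (psi := fun=> 1)) => [|B]; last by rewrite covered0.
    apply: (@le_trans _ _ (Ex p (fun=> 1 : R))); last by rewrite !ExC.
    by apply: le_Ex => // A; case: few_cover.
  rewrite (eq_Ex _ (psi := fun=> 0)) ?ExC ?Ex_ge0 // => A.
  case: (boolP (few_cover 0 X A)) => // /existsP[A' /and3P[_]]; rewrite leqn0 cards_eq0 => /eqP ->.
  by rewrite /covered big_set0 subset0 (negPf X0).
apply: le_trans (le_Ex hp (fun A => few_cover_step j A XZ)) _.
(* The fresh set [B] is fixed first, so that the induction hypothesis applies to the smaller target
   [uncov (B :&: C0) X] with [A] still random. *)
rewrite !ExD ExC Ex_exchange.
apply: (@le_trans _ _ (Ex q (fun B => Ex (multi j) (fun B' =>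
   (covered (B' :&: C0) (uncov (B :&: C0) X))%:R) + j%:R * (eps * (p + 1) ^+ #|C1| + kappa))
   + eps * (p + 1) ^+ #|C1| + kappa)).
  rewrite lerD2r lerD ?Ex_light_kill //; apply: le_Ex => // B; apply: IH.
  by rewrite (subset_trans _ XZ) ?subsetDl.
rewrite ExD ExC -!addrA lerD //; last by rewrite -natr1; lra.
under eq_Ex => B do under eq_Ex => B' do rewrite -coveredU -setIUl.
rewrite (Ex_union q (multi j) (fun B => (covered (B :&: C0) X)%:R)).
by rewrite /multi exprS (_ : _ - _ = 1 - (1 - q) * (1 - q) ^+ j) //; ring.
Qed.

Hypothesis C01 : [disjoint C0 & C1].

(** The part of the random set in [C0] is fixed; at most [M] elements of [C1] are then exchanged in
    [M] rounds of density [q], and Markov's inequality handles larger numbers. By Bernoulli's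
    inequality the fresh rounds together have density at most [M%:R * q]. *)
Lemma replacement (M : nat) : p + M%:R * q <= 1 ->
  Ex p (fun A => (covered (A :&: (C0 :|: C1)) Z)%:R) <=
  Ex (p + M%:R * q) (fun A => (covered (A :&: C0) Z)%:R)
  + M%:R * (eps * (p + 1) ^+ #|C1| + kappa) + p * #|C1|%:R / M.+1%:R.
Proof.
move=> pM; have [p0 p1] := andP hp; have [q0 q1] := andP hq.
have Mq : multi M <= M%:R * q.
  rewrite /multi lerBlDr -lerBlDl; elim: (M) => [|j IH]; first by rewrite mul0r subr0.
  have h : 0 <= 1 - q by rewrite subr_ge0.
  have j0 : 0 <= j%:R * q * q by rewrite !mulr_ge0.
  by rewrite exprS; have := ler_wpM2l h IH; rewrite -natr1; lra.
have M0 : 0 <= multi M.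
  by rewrite subr_ge0 exprn_ile1 ?subr_ge0 // gerBl.
rewrite -(Ex_split p C0).
apply: (@le_trans _ _ (Ex p (fun A => Ex (multi M) (fun B =>
    (covered (B :&: C0) (uncov (A :&: C0) Z))%:R)
   + (M%:R * (eps * (p + 1) ^+ #|C1| + kappa) + p * #|C1|%:R / M.+1%:R)))).
  apply: le_Ex => // A.
  apply: (@le_trans _ _ (Ex p (fun B => (few_cover M (uncov (A :&: C0) Z) B)%:R
      + (M < #|B :&: C1|)%N%:R))).
    apply: le_Ex => // B.
    have -> : (A :&: C0 :|: B :\: C0) :&: (C0 :|: C1) = A :&: C0 :|: B :&: C1.
      apply/setP => e; rewrite !inE.
      have := disjointFr C01 (x := e); case: (e \in C0) => [-> //|_];
      by case: (e \in A); case: (e \in B); case: (e \in C1).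
    rewrite coveredU; case: (boolP (covered _ _)) => // hc; last by rewrite addr_ge0.
    have [|hM] := ltnP; first by rewrite lerDr.
    rewrite addr0 (_ : few_cover _ _ _ = true) //; apply/existsP; exists (B :&: C1).
    by rewrite subxx hM.
  by rewrite ExD addrA lerD ?Ex_card_gt_le ?Ex_few_cover ?subsetDl.
rewrite ExD ExC addrA !lerD //.
under eq_Ex => B do under eq_Ex => B' do rewrite -coveredU -setIUl.
have mono A B : A \subset B -> (covered (A :&: C0) Z)%:R <= (covered (B :&: C0) Z)%:R :> R.
  move=> AB; rewrite ler_nat; case: (boolP (covered (A :&: C0) Z)) => // h.
  by rewrite (covered_mono _ h) // setSI.
have pMM : p + multi M <= p + M%:R * q by rewrite lerD2l.
apply: le_trans (Ex_union_le p0 M0 (le_trans pMM pM) mono) _.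
by apply: Ex_mono => //; rewrite addr_ge0.
Qed.

End Replacement.

(** * Constraints seen from a frozen set of coordinates *)

Section Cylinders.
Variables (Sigma : finType) (k : nat) (PP : {set {set k.-tuple Sigma}}) (n : nat).
Hypothesis PPperm : forall (s : 'S_k) P, P \in PP -> permute_coords s @: P \in PP.
Let T := ({set 'I_n} * {set k.-tuple Sigma})%type.
Let Om := constraints PP n.
Implicit Types (x y sigma : {ffun 'I_n -> Sigma}) (U : {set 'I_n}) (e : T) (A : {set T}).

Definition cyl e : {set {ffun 'I_n -> Sigma}} := cylinder e.1 e.2.

Lemma cylinder_eq j U (Q : {set j.-tuple Sigma}) x y :
  {in U, x =1 y} -> (x \in cylinder U Q) = (y \in cylinder U Q).
Proof.
move=> xy; rewrite !inE; apply: eq_existsb => w; congr (_ && (_ == _)).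
by apply/eq_in_map => i; rewrite mem_enum => /xy.
Qed.

Lemma coversE A : (A :&: Om \in covers PP n) = covered cyl (A :&: Om) [set: _].
Proof. by rewrite inE powersetE subsetIr /= /covered subTset. Qed.

Lemma card_constraint e : e \in Om -> #|e.1| = k.
Proof. by case: e => U P; rewrite in_setX inE => /andP[/eqP]. Qed.

Lemma permute_coords_inj (s : 'S_k) : injective (@permute_coords Sigma k s).
Proof.
move=> u v uv; apply: eq_from_tnth => i.
have := congr1 (fun t => tnth t ((s^-1)%g i)) uv.
by rewrite /= !tnth_mktuple permKV.
Qed.

(** Derivatives freeze the first coordinate, but a linked constraint may meet [S0] at any position.
    Closure of the family under permutations then moves that position to the front. *)
Lemma rotate_to_front U i : i \in U -> #|U| = k -> exists s : 'S_k,
  forall x (w : k.-tuple Sigma), tval w = [seq x j | j <- enum U] ->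
    tval (permute_coords s w) = x i :: [seq x j | j <- enum (U :\ i)].
Proof.
move=> iU cU.
have sE : size (enum U) == k by rewrite -cardE cU.
have sF : size (i :: enum (U :\ i)) == k.
  by rewrite /= -cardE -cU [X in _ == X](cardsD1 i) iU.
have : perm_eq (Tuple sF) (Tuple sE).
  apply: uniq_perm => [/=||j /=]; rewrite ?enum_uniq ?mem_enum ?setD11 //.
  by rewrite in_cons !mem_enum in_setD1; case: eqP => // ->.
move/tuple_permP => [s hs]; exists s => x w hw.
have -> : w = map_tuple x (Tuple sE) by apply: val_inj.
rewrite -[RHS]/(map x (i :: enum (U :\ i))) (_ : i :: _ = Tuple sF) // hs.
by rewrite /permute_coords -map_comp /=; apply: eq_map => j; rewrite /= tnth_map.
Qed.

Variables (S0 : {set 'I_n}) (sigma : {ffun 'I_n -> Sigma}).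

Definition frozen := [set x : {ffun 'I_n -> Sigma} | [forall i in S0, x i == sigma i]].
Definition free_constraints := [set e in Om | #|e.1 :&: S0| == 0]%N.
Definition linked_constraints := [set e in Om | #|e.1 :&: S0| == 1]%N.
Definition tied_constraints := [set e in Om | 1 < #|e.1 :&: S0|]%N.

Definition derivative_killers (Y : {set {ffun 'I_n -> Sigma}}) :=
  [set c in finset.setX (ksets n k.-1) (derivatives PP) |
      Y \subset cylinder c.1 (derivative c.2.1 c.2.2)].

Lemma card_killers (Y : {set {ffun 'I_n -> Sigma}}) : Y != finset.set0 -> Y \subset frozen ->
  (#|killers cyl linked_constraints Y| <= #|S0| * #|derivative_killers Y|)%N.
Proof.
move=> /set0Pn[y0 y0Y] YZ.
(* The permutation is chosen as a function of [(i, U)] alone; otherwise the pattern could not be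
   recovered from its permuted image and [phi] might fail to be injective. *)
have /choice[s hs] : forall iU : 'I_n * {set 'I_n}, exists s : 'S_k,
    iU.1 \in iU.2 -> #|iU.2| = k ->
    forall x (w : k.-tuple Sigma), tval w = [seq x j | j <- enum iU.2] ->
    tval (permute_coords s w) = x iU.1 :: [seq x j | j <- enum (iU.2 :\ iU.1)].
  move=> [i U] /=; case: (boolP (i \in U)) => iU; last by exists 1%g.
  case: (eqVneq #|U| k) => [cU|/eqP cU]; last by exists 1%g.
  by have [s hs] := rotate_to_front iU cU; exists s.
have [->|[e0 e0K]] := set_0Vmem (killers cyl linked_constraints Y); first by rewrite cards0.
have [i0 _] : exists i0 : 'I_n, true.
  by move: e0K; rewrite !inE -andbA => /andP[_ /andP[/cards1P[i _] _]]; exists i.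
pose pt e := odflt i0 [pick i in e.1 :&: S0].
pose phi e := (pt e, (e.1 :\ pt e, (sigma (pt e), permute_coords (s (pt e, e.1)) @: e.2))).
have ptP e : e \in linked_constraints -> pt e \in e.1 /\ pt e \in S0.
  rewrite inE => /andP[_ /cards1P[i ei]]; rewrite /pt; case: pickP => [j|/(_ i)].
    by rewrite !inE => /andP[].
  by rewrite ei set11.
rewrite -cardsX -(card_in_imset (f := phi)); last first.
  have kC e : e \in killers cyl linked_constraints Y -> e \in linked_constraints.
    by rewrite inE => /andP[].
  move=> e e' /kC eC /kC eC' [h1 h2 _ h3].
  have [p1 p2] := ptP _ eC; have [p1' p2'] := ptP _ eC'.
  have h4 : e.1 = e'.1 by rewrite -(setD1K p1) h2 h1 setD1K.
  move: h3; rewrite h1 h4 => /(imset_inj (@permute_coords_inj _)) h5.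
  by case: (e) (e') h4 h5 => [? ?] [? ?] /= -> ->.
apply: subset_leq_card; apply/subsetP => _ /imsetP[e eK ->].
have [eC YE] : e \in linked_constraints /\ Y \subset cyl e.
  by move: eK; rewrite !inE => /andP[].
have [p1 p2] := ptP _ eC.
have eO : e \in Om by move: eC; rewrite inE => /andP[].
have key y : y \in Y -> exists2 w, w \in permute_coords (s (pt e, e.1)) @: e.2 &
    tval w = sigma (pt e) :: [seq y j | j <- enum (e.1 :\ pt e)].
  move=> yY; have := subsetP YE _ yY; rewrite inE => /existsP[w /andP[we /eqP hw]].
  exists (permute_coords (s (pt e, e.1)) w); first exact: imset_f.
  rewrite (hs (pt e, e.1) p1 (card_constraint eO) _ _ hw) /=; congr (_ :: _).
  by have := subsetP YZ _ yY; rewrite inE => /forall_inP/(_ _ p2)/eqP.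
have cD : #|e.1 :\ pt e| = k.-1.
  by move/(congr1 predn): (card_constraint eO); rewrite (cardsD1 (pt e)) p1.
have cyl_key y : y \in Y -> exists2 z : k.-1.-tuple Sigma,
    z \in derivative (sigma (pt e)) (permute_coords (s (pt e, e.1)) @: e.2) &
    tval z = [seq y j | j <- enum (e.1 :\ pt e)].
  move=> yY; have [w wP hw] := key y yY.
  have sz : size [seq y j | j <- enum (e.1 :\ pt e)] == k.-1 by rewrite size_map -cardE cD.
  by exists (Tuple sz) => //; rewrite inE; apply/existsP; exists w; rewrite wP hw /=.
rewrite in_setX p2 /= inE in_setX /= !inE cD eqxx /= -andbA; apply/and3P; split => /=.
- by apply: PPperm; move: eO; rewrite /Om; case: (e) => ? ?; rewrite in_setX => /andP[].
- by apply/set0Pn; have [z zD _] := cyl_key _ y0Y; exists z.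
apply/subsetP => y yY; have [z zD hz] := cyl_key _ yY.
by rewrite inE; apply/existsP; exists z; rewrite zD hz /=.
Qed.


(** Free constraints do not read [S0], so any assignment may be overwritten by [sigma] there without
    changing which of them cover it. *)
Lemma covered_free A : covered cyl (A :&: free_constraints) frozen ->
  covered cyl (A :&: Om) [set: _].
Proof.
move=> /subsetP h; apply/subsetP => x _.
pose y : {ffun 'I_n -> Sigma} := [ffun i => if i \in S0 then sigma i else x i].
have /h/bigcupP[e] : y \in frozen.
  by rewrite inE; apply/forall_inP => i iS; rewrite ffunE iS.
rewrite inE => /andP[eA]; rewrite inE cards_eq0 => /andP[eO /eqP e0] ye.
apply/bigcupP; exists e; first by rewrite inE eA.
rewrite /cyl (cylinder_eq _ (y := y)) // => i ie; rewrite ffunE ifN //.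
by apply/negP => iS; move/setP/(_ i): e0; rewrite !inE ie iS.
Qed.

(** The constraints in [B] read only [S0] and miss [sigma], hence cover no frozen assignment; these
    are left to [A]. *)
Lemma covered_split A (B : {set T}) : (forall e, e \in B -> e.1 \subset S0 /\ sigma \notin cyl e) ->
  covered cyl ((A :|: B) :&: Om) [set: _] ->
  A :&: tied_constraints != finset.set0 \/
  covered cyl (A :&: (free_constraints :|: linked_constraints)) frozen.
Proof.
move=> hB /subsetP h; have [A2|] := eqVneq (A :&: tied_constraints) finset.set0; last by left.
right; apply/subsetP => x; rewrite inE => /forall_inP xZ.
have /bigcupP[e] := h x (in_setT x); rewrite in_setI in_setU => /andP[/orP[eA|eB] eO] xe.
  apply/bigcupP; exists e => //.
  have : e \notin A :&: tied_constraints by rewrite A2 in_set0.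
  rewrite !in_setI in_setU [_ \in tied_constraints]in_set.
  rewrite [_ \in free_constraints]in_set [_ \in linked_constraints]in_set eA eO /=.
  by case: #|_| => [|[]].
have [eS] := hB e eB; rewrite /cyl -(cylinder_eq _ (x := x)) ?xe //.
by move=> i /(subsetP eS)/xZ/eqP.
Qed.

Section Probability.
Variable (R : realType).
Implicit Types (p q eps kappa : R).

Lemma Ex_disjoint p (G : {set T}) : Ex p (fun A => [disjoint A & G]%:R) = (1 - p) ^+ #|G|.
Proof.
have -> : 1 - p = -1 * (p - 1) by ring.
rewrite exprMn -Ex_chi -ExZ; apply: eq_Ex => A.
rewrite /chi -(prodr_const (mem G)) -big_split /=.
have [dAG|] := boolP [disjoint A & G].
  rewrite big1 // => i iG; case: (boolP (i \in A)) => iA; last by rewrite /=; ring.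
  by move: (disjointFr dAG iA); rewrite iG.
rewrite disjoint_sym disjoints_subset => /subsetPn[i iG]; rewrite inE negbK => iA.
by rewrite (bigD1 i) //= iA subrr mulr0 mul0r.
Qed.

Lemma expr_le_inv q (g : nat) : 0 <= q <= 1 -> (1 - q) ^+ g * (g%:R * q) <= 1.
Proof.
move=> /andP[q0 q1]; suff : (1 - q) ^+ g * (1 + g%:R * q) <= 1.
  have : 0 <= (1 - q) ^+ g by rewrite exprn_ge0 // subr_ge0.
  lra.
elim: g => [|g IH]; first by rewrite mul1r mul0r addr0.
have h0 : 0 <= (1 - q) ^+ g by rewrite exprn_ge0 // subr_ge0.
apply: le_trans IH; rewrite exprS [(1 - q) * _]mulrC -mulrA ler_wpM2l // -natr1.
have : 0 <= q * q * (g%:R + 1) by rewrite !mulr_ge0 ?addr_ge0.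
lra.
Qed.

Definition covers_ind A : R := (A :&: Om \in covers PP n)%:R.

Lemma covers_ind_mono A (B : {set T}) : A \subset B -> covers_ind A <= covers_ind B.
Proof.
move=> AB; rewrite /covers_ind !coversE ler_nat.
case: (boolP (covered cyl (A :&: Om) _)) => // h.
by rewrite (covered_mono _ h) // setSI.
Qed.

(** A single free killer covers all of [Y]. The probability of drawing none of [g] killers is at
    most [1 / (g * q)]; this weak bound is enough since all losses are polynomial. *)
Lemma free_cover_prob q kappa (Y : {set {ffun 'I_n -> Sigma}}) :
  0 <= q <= 1 -> 0 < kappa ->
  1 <= kappa * (q * #|killers cyl free_constraints Y|%:R) ->
  Ex q (fun B => (~~ covered cyl (B :&: free_constraints) Y)%:R) <= kappa.
Proof.
move=> hq k0 h; set G := killers _ _ _ in h.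
apply: (@le_trans _ _ (Ex q (fun B => [disjoint B & G]%:R))).
  apply: le_Ex => // B; rewrite ler_nat; case: (boolP [disjoint B & G]) => [_|]; first exact: leq_b1.
  rewrite disjoints_subset => /subsetPn[e eB]; rewrite in_setC negbK in_set => /andP[eC Ye].
  rewrite (_ : covered _ _ _ = true) //; apply/(subset_trans Ye)/bigcup_sup.
  by rewrite in_setI eB.
rewrite Ex_disjoint; have := expr_le_inv #|G| hq.
have q0 : 0 <= (1 - q) ^+ #|G| by rewrite exprn_ge0 // subr_ge0; case/andP: hq.
set u := _ ^+ _ in q0 *; move: h; rewrite [q * _]mulrC; set v := _ * q => h1 h2.
have : u <= u * (kappa * v) by rewrite ler_peMr.
have := ler_wpM2l (ltW k0) h2; lra.
Qed.

Lemma covers_boost_le p q eps kappa (M : nat) (B : {set T}) :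
  (forall e, e \in B -> e.1 \subset S0 /\ sigma \notin cyl e) ->
  0 <= p <= 1 -> 0 <= q <= 1 -> 0 <= eps -> 0 < kappa -> p + M%:R * q <= 1 ->
  (forall Y : {set {ffun 'I_n -> Sigma}}, Y != finset.set0 -> Y \subset frozen ->
    eps < p * #|killers cyl linked_constraints Y|%:R ->
    1 <= kappa * (q * #|killers cyl free_constraints Y|%:R)) ->
  Ex p (fun A => covers_ind (A :|: B)) <=
  Ex (p + M%:R * q) covers_ind + p * #|tied_constraints|%:R
  + M%:R * (eps * (p + 1) ^+ #|linked_constraints| + kappa)
  + p * #|linked_constraints|%:R / M.+1%:R.
Proof.
move=> hB hp hq e0 k0 pM hk.
have C01 : [disjoint free_constraints & linked_constraints].
  rewrite disjoints_subset; apply/subsetP => e; rewrite !inE => /andP[-> /eqP ->].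
  by [].
have heavy (Y : {set {ffun 'I_n -> Sigma}}) : Y \subset frozen -> eps < p * #|killers cyl linked_constraints Y|%:R ->
    Ex q (fun B => (~~ covered cyl (B :&: free_constraints) Y)%:R) <= kappa.
  (* The counting hypothesis is stated for nonempty [Y]; the empty set is always covered. *)
  move=> YZ hY; have [->|Y0] := eqVneq Y finset.set0.
    rewrite (eq_Ex _ (psi := fun=> 0)) ?ExC ?(ltW k0) // => A.
    by rewrite covered0.
  by apply: free_cover_prob => //; apply: hk.
have := replacement hp hq e0 (ltW k0) heavy C01 pM => hr.
apply: (@le_trans _ _ (Ex p (fun A => (A :&: tied_constraints != finset.set0)%:R +
   (covered cyl (A :&: (free_constraints :|: linked_constraints)) frozen)%:R))).
  apply: le_Ex => // A; rewrite /covers_ind coversE.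
  case: (boolP (covered _ _ [set: _])) => [/(covered_split hB)[->|->]|_].
  - by rewrite lerDl.
  - by rewrite lerDr.
  - by rewrite addr_ge0.
rewrite ExD; have h1 := Ex_meet_le tied_constraints hp.
have h2 : Ex (p + M%:R * q) (fun A => (covered cyl (A :&: free_constraints) frozen)%:R)
    <= Ex (p + M%:R * q) covers_ind.
  apply: le_Ex => [|A].
    by rewrite pM; case/andP: hp hq => ? ? /andP[? ?]; rewrite addr_ge0 ?mulr_ge0.
  rewrite /covers_ind coversE ler_nat; case: (boolP (covered _ _ frozen)) => // h.
  by rewrite (covered_free h).
apply: le_trans (lerD h1 hr) _.
by rewrite addrC -!addrA lerD // [leRHS]addrC -addrA.
Qed.

End Probability.

Lemma card_bigcup_le (I T' : finType) (P : {set I}) (F : I -> {set T'}) :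
  (#|\bigcup_(i in P) F i| <= \sum_(i in P) #|F i|)%N.
Proof.
elim/big_rec2: _ => [|i m X _ h]; first by rewrite cards0.
by apply: leq_trans (leq_card_setU _ _) _; rewrite leq_add2l.
Qed.

Definition touching i := [set e in Om | i \in e.1].

Lemma card_ksets j : #|ksets n j| = 'C(n, j).
Proof. by rewrite /ksets -[X in 'C(X, _)]card_ord -cardsT -cards_draws; apply: eq_card => U; rewrite !inE subsetT. Qed.

Lemma card_touching i : (#|touching i| <= 'C(n, k.-1) * #|PP|)%N.
Proof.
rewrite -card_ksets -cardsX -(card_in_imset (f := fun e : T => (e.1 :\ i, e.2))); last first.
  move=> [U P] [V Q]; rewrite !in_set /= => /andP[_ iU] /andP[_ iV] [UV ->].
  by rewrite -(setD1K iU) UV setD1K.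
apply/subset_leq_card/subsetP => _ /imsetP[[U P] UP ->].
rewrite in_set in_setX in_set /= in UP; case/andP: UP => /andP[/eqP cU PQ] iU; rewrite in_setX /= PQ in_set andbT.
by rewrite -cU [#|U|](cardsD1 i) iU.
Qed.

Lemma card_touching2 i j : i != j ->
  (#|touching i :&: touching j| <= 'C(n, k.-2) * #|PP|)%N.
Proof.
move=> ij; rewrite -card_ksets -cardsX.
rewrite -(card_in_imset (f := fun e : T => (e.1 :\ i :\ j, e.2))); last first.
  move=> [U P] [V Q]; rewrite !in_setI !in_set /=.
  move=> /andP[/andP[_ iU] /andP[_ jU]] /andP[/andP[_ iV] /andP[_ jV]] [UV ->].
  have jU' : j \in U :\ i by rewrite in_setD1 eq_sym ij.
  have jV' : j \in V :\ i by rewrite in_setD1 eq_sym ij.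
  by rewrite -(setD1K iU) -(setD1K jU') UV !setD1K.
apply/subset_leq_card/subsetP => _ /imsetP[[U P] UP ->].
rewrite in_setI [_ \in touching i]in_set [_ \in touching j]in_set in_setX in_set /= in UP.
case/andP: UP => /andP[/andP[/eqP cU PQ] iU] /andP[_ jU]; rewrite in_setX /= PQ in_set andbT.
by rewrite -cU [#|U|](cardsD1 i) iU (cardsD1 j (U :\ i)) in_setD1 [j == i]eq_sym ij jU.
Qed.

Lemma card_not_free : (#|Om :\: free_constraints| <= #|S0| * ('C(n, k.-1) * #|PP|))%N.
Proof.
apply: (@leq_trans (\sum_(i in S0) #|touching i|)); last first.
  by rewrite -sum_nat_const leq_sum // => i _; exact: card_touching.
apply: leq_trans (card_bigcup_le _ _); apply/subset_leq_card/subsetP => e.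
rewrite in_setD => /andP[eF eO]; move: eF; rewrite in_set eO /= cards_eq0 => /set0Pn[i].
by rewrite in_setI => /andP[ie iS]; apply/bigcupP; exists i; rewrite // in_set eO.
Qed.

Lemma card_linked : (#|linked_constraints| <= #|S0| * ('C(n, k.-1) * #|PP|))%N.
Proof.
apply: leq_trans card_not_free; apply/subset_leq_card/subsetP => e.
rewrite in_set in_setD => /andP[eO /eqP h]; rewrite eO andbT.
by rewrite in_set h andbF.
Qed.

Lemma card_tied : (#|tied_constraints| <= #|S0| ^ 2 * ('C(n, k.-2) * #|PP|))%N.
Proof.
rewrite -mulnn.
apply: (@leq_trans (\sum_(ij in finset.setX S0 S0 :\: [set ij | ij.1 == ij.2])
     #|touching ij.1 :&: touching ij.2|)).
  apply: leq_trans (card_bigcup_le _ _); apply/subset_leq_card/subsetP => e.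
  rewrite in_set => /andP[eO /card_gt1P[i [j [iS jS ij]]]].
  move: iS jS; rewrite !in_setI => /andP[ie iS] /andP[je jS].
  apply/bigcupP; exists (i, j); first by rewrite in_setD in_set in_setX /= iS jS ij.
  by rewrite in_setI [_ \in touching i]in_set [_ \in touching j]in_set eO ie je.
apply: (@leq_trans (\sum_(ij in finset.setX S0 S0 :\: [set ij | ij.1 == ij.2])
     ('C(n, k.-2) * #|PP|))).
  by apply: leq_sum => [[i j]]; rewrite in_setD in_set => /andP[ij _]; exact: card_touching2.
rewrite sum_nat_const leq_mul2r -cardsX; apply/orP; right.
by apply: subset_leq_card; exact: subsetDl.
Qed.

End Cylinders.

(** * Russo's formula and quiet points of the window *)

Section Russo.
Variables (R : realType) (T : finType).
Implicit Types (p q r : R) (A B S : {set T}) (phi : {set T} -> R).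

(** The expectation selects elements from the whole type; those outside [Om] are discarded by the
    intersection, so their weights sum to one. *)
Lemma product_measureE (Om : {set T}) (F : {set {set T}}) p :
  product_measure Om F p = Ex p (fun A => (A :&: Om \in F)%:R).
Proof.
rewrite (eq_Ex _ (psi := fun A => \sum_(B in powerset Om | B \in F) (A :&: Om == B)%:R)).
  rewrite Ex_sum /product_measure; apply: eq_bigr => B /andP[/[!powersetE] BO _].
  transitivity (Ex p (fun A => \prod_i (if i \in A then (if i \in Om :\: B then 0 else 1)
                                        else (if i \in B then 0 else 1)))); last first.
    apply: eq_Ex => A; case: eqP => [<-|AB].
      rewrite big1 // => i _; rewrite !inE.
      by case: (i \in A) => //=; case: (i \in Om).
    apply/eqP; apply/contraT => h; exfalso; apply: AB; apply/setP => i; apply/idP/idP.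
      rewrite inE => /andP[iA iO]; apply: contraNT h => iB.
      by rewrite (bigD1 i) //= iA !inE iB iO mul0r.
    move=> iB; rewrite inE (subsetP BO) // andbT; apply: contraNT h => iA.
    by rewrite (bigD1 i) //= (negPf iA) iB mul0r.
  rewrite Ex_prod -(prodr_const (mem B)) -(prodr_const (mem (Om :\: B))).
  rewrite [X in X * _]big_mkcond [X in _ * X]big_mkcond -big_split /=.
  apply: eq_bigr => i _; rewrite !inE; case: (boolP (i \in B)) => iB /=; first by ring.
  by case: (i \in Om); rewrite /=; ring.
move=> A; case: (boolP (_ \in F)) => AF.
  rewrite (bigD1 (A :&: Om)) ?AF ?powersetE ?subsetIr //= eqxx big1 ?addr0 // => B.
  by move=> /andP[_ /negPf]; rewrite eq_sym => ->.
rewrite big1 // => B /andP[_ BF]; case: eqP => // AB.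
by move: AF; rewrite AB BF.
Qed.

Definition influence p phi : R := \sum_i Ex p (fun A => phi (i |: A) - phi (A :\ i)).

(** Russo's formula. Expanded at base point [p], the expectation at bias [x] is a polynomial in
    [x - p]; its derivative at [p] sees only the coefficients of singletons, which are the mean
    discrete derivatives. *)
Lemma Ex_poly phi : exists2 P : {poly R}, (forall p, Ex p phi = P.[p]) &
  forall p, P^`().[p] = influence p phi.
Proof.
have E r c p : (forall A, phi A = ev r c A) ->
    Ex p phi = (\sum_S c S *: ('X - r%:P) ^+ #|S|).[p].
  move=> h; rewrite (eq_Ex _ h) Ex_ev horner_sum; apply: eq_bigr => S _.
  by rewrite !hornerE.
have [c0 h0] := ev_exists 0 phi.
exists (\sum_S c0 S *: ('X - 0%:P) ^+ #|S|) => p; first exact: E.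
have [c hc] := ev_exists p phi.
rewrite derivE (_ : horner _ = horner (\sum_S c S *: ('X - p%:P) ^+ #|S|)); last first.
  by apply/funext => x; rewrite -!E.
rewrite -derivE raddf_sum horner_sum /=.
transitivity (\sum_(S : {set T} | #|S| == 1%N) c S).
  rewrite [RHS]big_mkcond; apply: eq_bigr => S _.
  rewrite derivZ deriv_exp derivXsubC mul1r !hornerE hornerMn !hornerE subrr.
  case: #|S| => [|[|j]]; rewrite ?mulr0n ?mulr0 //= ?expr0 ?mulr1 //.
  by rewrite expr0n mul0rn mulr0.
rewrite big_cards1; apply: eq_bigr => i _.
rewrite (eq_Ex _ (psi := ev p (dcoef i c))) => [|A]; last by rewrite ev_dcoef -!hc.
rewrite Ex_ev (bigD1 set0) //= big1 => [|S S0].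
  by rewrite /dcoef in_set0 setU0 cards0 expr0 mulr1 addr0.
by rewrite subrr expr0n cards_eq0 (negPf S0) mulr0.
Qed.

Lemma Ex_MVT phi (a b : R) : a < b ->
  exists p, a < p < b /\ Ex b phi - Ex a phi = influence p phi * (b - a).
Proof.
have [P hP hP'] := Ex_poly phi => ab.
have dP (x : R) : is_derive x 1 (horner P : R -> R) (P^`().[x]).
  by rewrite derivE derive1E; apply: DeriveDef => //; exact: derivable_horner.
have [|p] := MVT (f := horner P) ab (fun x _ => dP x).
  by apply: derivable_within_continuous => x _; exact: derivable_horner.
by rewrite in_itv /= => hp h; exists p; rewrite !hP h hP'.
Qed.

Lemma Ex_continuous phi : continuous (fun p : R => Ex p phi).
Proof.
have [P hP _] := Ex_poly phi.
have -> : (fun p : R => Ex p phi) = horner P by apply/funext.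
by move=> x; apply: differentiable_continuous; apply/derivable1_diffP; exact: derivable_horner.
Qed.

Lemma pigeonhole_increment (H : R -> R) (a h : R) (M : nat) :
  (0 < M)%N -> exists2 j, (j < M)%N &
    M%:R * (H (a + j.+1%:R * h) - H (a + j%:R * h)) <= H (a + M%:R * h) - H a.
Proof.
move=> M0; apply: contrapT => hn.
have hj (j : 'I_M) : H (a + M%:R * h) - H a < M%:R * (H (a + j.+1%:R * h) - H (a + j%:R * h)).
  by rewrite ltNge; apply/negP => hle; apply: hn; exists j.
have := telescope_sumr (fun j => H (a + j%:R * h)) (leq0n M).
rewrite big_mkord mul0r addr0 => tel.
have : \sum_(j < M) (H (a + M%:R * h) - H a) <
    \sum_(j < M) M%:R * (H (a + j.+1%:R * h) - H (a + j%:R * h)).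
  by apply: ltr_sum => [|j _]; [apply/hasP; exists (Ordinal M0); rewrite ?mem_index_enum|exact: hj].
rewrite -big_distrr /= tel sumr_const card_ord.
by rewrite [X in _ < X]mulr_natl ltxx.
Qed.

Lemma quiet_point (phi psi : {set T} -> R) (a b D : R) :
  0 <= a -> a < b -> b <= 1 -> 0 < D -> 4 * D <= b - a ->
  (forall A B, A \subset B -> phi A <= phi B) -> (forall A, 0 <= phi A <= 1) ->
  (forall A B, A \subset B -> psi A <= psi B) -> (forall A, 0 <= psi A <= 1) ->
  exists p, [/\ a < p, p + D <= b, influence p phi * (b - a) <= 8 &
    (Ex (p + D) psi - Ex p psi) * (b - a) <= 8 * D].
Proof.
move=> a0 ab b1 D0 Dab mphi phi01 mpsi psi01.
pose M := Num.truncn ((b - a) / (2 * D)).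
have D20 : 0 < 2 * D by rewrite mulr_gt0.
have q0 : 0 <= (b - a) / (2 * D) by apply: divr_ge0; rewrite ?subr_ge0 ltW.
have [M1 M2] : M%:R <= (b - a) / (2 * D) /\ (b - a) / (2 * D) < M%:R + 1.
  by rewrite natr1; have /andP[] := Num.Theory.truncn_itv q0.
rewrite ler_pdivlMr // in M1; rewrite ltr_pdivrMr // in M2.
have M0 : (0 < M)%N.
  rewrite lt0n; apply: contraTneq M2 => ->; rewrite add0r mul1r -leNgt; lra.
have MR : 1 <= M%:R :> R by rewrite ler1n.
have MD : b - a <= 4 * M%:R * D by nra.
pose H p := Ex p phi + Ex p psi.
have [j jM hj] := pigeonhole_increment H a (2 * D) M0.
set x := a + j%:R * (2 * D) in hj.
have xS : a + j.+1%:R * (2 * D) = x + 2 * D by rewrite /x -natr1; ring.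
rewrite xS in hj.
have jM' : j%:R + 1 <= M%:R :> R by rewrite natr1 ler_nat.
have x2 : x + 2 * D <= b by rewrite /x; nra.
have ax : a <= x by rewrite /x lerDl mulr_ge0 // ltW.
have bnd phi' (r : R) : 0 <= r <= 1 -> (forall A, 0 <= phi' A <= 1) -> 0 <= Ex r phi' <= 1.
  move=> hr h; rewrite Ex_ge0 //=; last by move=> A; case/andP: (h A).
  by rewrite -[leRHS](ExC T r); apply: le_Ex => // A; case/andP: (h A).
have Hle : H (a + M%:R * (2 * D)) - H a <= 2.
  have r1 : 0 <= a + M%:R * (2 * D) <= 1.
    by apply/andP; split; nra.
  have r2 : 0 <= a <= 1 by rewrite a0 (le_trans (ltW ab)).
  have := bnd _ _ r1 phi01; have := bnd _ _ r1 psi01.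
  have := bnd _ _ r2 phi01; have := bnd _ _ r2 psi01.
  rewrite /H; lra.
have {}Hle : (H (x + 2 * D) - H x) * (b - a) <= 8 * D.
  have i0 : 0 <= H (x + 2 * D) - H x.
    by rewrite subr_ge0 /H lerD //; apply: Ex_mono => //; lra.
  nra.
have [p [/andP[xp px] hp]] := Ex_MVT phi (a := x) (b := x + D) ltac:(lra).
have m1 : Ex x phi <= Ex p phi by apply: Ex_mono => //; lra.
have m2 : Ex p phi <= Ex (x + D) phi by apply: Ex_mono => //; lra.
have m3 : Ex (x + D) phi <= Ex (x + 2 * D) phi by apply: Ex_mono => //; lra.
have m4 : Ex x psi <= Ex p psi by apply: Ex_mono => //; lra.
have m5 : Ex p psi <= Ex (p + D) psi by apply: Ex_mono => //; lra.
have m6 : Ex (p + D) psi <= Ex (x + 2 * D) psi by apply: Ex_mono => //; lra.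
exists p; split; [lra|lra| |].
  rewrite -(ler_pM2r D0) mulrAC.
  have -> : influence p phi * D = Ex (x + D) phi - Ex x phi by rewrite hp; ring.
  rewrite /H in Hle; nra.
rewrite /H in Hle; nra.
Qed.

End Russo.

(** * Large minimal covers *)

Section LargeCovers.
Variables (R : realType) (Sigma : finType) (k : nat).
Variables (PP : {set {set k.-tuple Sigma}}) (n : nat) (s : R).
Let T := ({set 'I_n} * {set k.-tuple Sigma})%type.
Let Om := constraints PP n.
Let f := @covers_ind Sigma k PP n R.
Implicit Types (A B S D : {set T}) (p : R).

Definition has_large_cover A := [exists B : {set T},
  [&& B \subset A :&: Om, minset (fun D => D \in covers PP n) B & s < #|B|%:R]].
Definition large_ind A : R := (has_large_cover A)%:R.
Definition small_ind A : R := (A :&: Om \in small PP n s)%:R.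

Lemma large_ind_mono A B : A \subset B -> large_ind A <= large_ind B.
Proof.
move=> AB; rewrite ler_nat; case: (boolP (has_large_cover A)) => // /existsP[D /and3P[h1 h2 h3]].
rewrite (_ : has_large_cover B = true) //; apply/existsP; exists D.
by rewrite h2 h3 andbT (subset_trans h1) // setSI.
Qed.

Lemma large_ind01 A : large_ind A = 0 \/ large_ind A = 1.
Proof. by rewrite /large_ind; case: has_large_cover; [right|left]. Qed.

Lemma covers_superset A D : D \subset A :&: Om -> D \in covers PP n -> A :&: Om \in covers PP n.
Proof.
move=> DA DC; have DO : D = D :&: Om by apply/esym/setIidPl/(subset_trans DA)/subsetIr.
have := @covers_ind_mono Sigma k PP n R _ _ (subset_trans DA (subsetIl _ _)).
by rewrite /covers_ind -DO DC; case: (_ \in _); rewrite ?ler10.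
Qed.

Lemma large_le_covers A : large_ind A <= f A.
Proof.
rewrite ler_nat; case: (boolP (has_large_cover A)) => // /existsP[D /and3P[h1 /minsetp h2 h3]].
by rewrite (covers_superset h1 h2).
Qed.

Lemma covers_le_large A : f A <= large_ind A + small_ind A.
Proof.
rewrite /f /covers_ind; case: (boolP (_ \in covers _ _)) => [h|_]; last by rewrite addr_ge0.
have [D Dm DA] := minset_exists (P := fun D => D \in covers PP n) h.
have [sD|Ds] := ltP s #|D|%:R.
  rewrite /large_ind (_ : has_large_cover A = true) ?lerDl //; apply/existsP; exists D.
  by rewrite DA Dm.
rewrite /small_ind (_ : _ \in small _ _ _ = true) ?lerDr // inE powersetE subsetIr /=.
by apply/existsP; exists D; rewrite DA Dm Ds.
Qed.

(* A minimal cover [B] with more than [#|S|] elements is not contained in [S], so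
   [B :&: S] is satisfiable; average over the [2 ^ #|S|] subsets of [S]. *)
Lemma satisfiable_booster p (S : {set T}) (delta : R) :
  0 <= p <= 1 -> #|S|%:R <= s ->
  0 <= delta - Ex p small_ind - p * #|S|%:R ->
  delta < Ex p (fun A => large_ind (A :|: S)) - Ex p (fun A => large_ind (A :\: S)) ->
  exists D : {set T}, [/\ D \subset S, D \subset Om, D \notin covers PP n &
    delta - Ex p small_ind - p * #|S|%:R <=
    2 ^+ #|S| * (Ex p (fun A => f (A :|: D)) - Ex p f)].
Proof.
move=> hp Ss g0 hdelta.
pose sub := [set D : {set T} | [&& D \subset S, D \subset Om & D \notin covers PP n]].
(* Deleting [S] matters only if the random set meets [S], which has probability at most
   [p * #|S|%:R]. *)
have h1 : Ex p large_ind - p * #|S|%:R <= Ex p (fun A => large_ind (A :\: S)).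
  rewrite lerBlDr; apply: (@le_trans _ _ (Ex p (fun A => large_ind (A :\: S)
     + (A :&: S != finset.set0)%:R))); last by rewrite ExD lerD2l Ex_meet_le.
  apply: le_Ex => // A; have [AS|_] := eqVneq (A :&: S) finset.set0.
    by rewrite addr0 (setDidPl _) // -setI_eq0 AS.
  by rewrite (le_trans (_ : _ <= 1)) ?lerDr //; case: (large_ind01 A) => ->.
have h2 : Ex p f <= Ex p large_ind + Ex p small_ind.
  by rewrite -ExD; apply: le_Ex => // A; exact: covers_le_large.
have h3 : Ex p (fun A => large_ind (A :|: S)) - Ex p f <=
    \sum_(D in sub) (Ex p (fun A => f (A :|: D)) - Ex p f).
  rewrite -ExB; under eq_bigr do rewrite -ExB; rewrite -Ex_sum; apply: le_Ex => // A.
  have ge0 D : 0 <= f (A :|: D) - f A by rewrite subr_ge0 covers_ind_mono // subsetUl.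
  rewrite /large_ind; case: (boolP (has_large_cover _)) => [|_]; last first.
    apply: (@le_trans _ _ 0); last by apply: sumr_ge0.
    by rewrite /= add0r oppr_le0.
  case/existsP => B /and3P[BA Bm Bs].
  have [fA|fA] : f A = 1 \/ f A = 0 by rewrite /f /covers_ind; case: (_ \in _); [left|right].
    by rewrite fA subrr sumr_ge0 // => D _; rewrite -fA.
  have BO : B \subset Om by rewrite (subset_trans BA) ?subsetIr.
  have DS : B :&: S \in sub.
    rewrite inE subsetIr (subset_trans (subsetIl _ _) BO) /=.
    apply/negP => h; have := minsetinf Bm h (subsetIl _ _) => BSB.
    have : (#|B| <= #|S|)%N by rewrite subset_leq_card // -BSB subsetIr.
    by rewrite -(ler_nat R) => h'; have := lt_le_trans Bs (le_trans h' Ss); rewrite ltxx.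
  rewrite (bigD1 (B :&: S)) //= -[leLHS]addr0 lerD ?sumr_ge0 //.
  rewrite fA !subr0 /f /covers_ind (covers_superset (D := B)) //; last exact: (minsetp Bm).
  rewrite subsetI BO andbT; apply/subsetP => e eB.
  have := subsetP BA _ eB; rewrite in_setI in_setU => /andP[/orP[eA|eS] _].
    by rewrite in_setU eA.
  by rewrite in_setU in_setI eB eS orbT.
have [D Dsub hD] : exists2 D, D \in sub &
    delta - Ex p small_ind - p * #|S|%:R <= 2 ^+ #|S| * (Ex p (fun A => f (A :|: D)) - Ex p f).
  apply: contrapT => hn; set g := delta - _ - _ in hn.
  have gD D : D \in sub -> 2 ^+ #|S| * (Ex p (fun A => f (A :|: D)) - Ex p f) <= g.
    by move=> hD; rewrite leNgt; apply/negP => h; apply: hn; exists D => //; exact: ltW.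
  have p2 : 0 < 2 ^+ #|S| :> R by rewrite exprn_gt0.
  have : 2 ^+ #|S| * \sum_(D in sub) (Ex p (fun A => f (A :|: D)) - Ex p f) <= 2 ^+ #|S| * g.
    rewrite big_distrr /=; apply: (@le_trans _ _ (\sum_(D in sub) g)); first exact: ler_sum.
    rewrite sumr_const -(mulr_natl g) ler_wpM2r // -natrX ler_nat -card_powerset.
    by apply/subset_leq_card/subsetP => D; rewrite inE powersetE => /and3P[].
  rewrite ler_pM2l // leNgt => /negP; apply; apply: lt_le_trans h3; rewrite /g.
  move: hdelta h1 h2; clear.
  move: (Ex p large_ind) (Ex p small_ind) (Ex p f) (Ex p (fun A => large_ind (A :|: S))).
  by move: (Ex p (fun A => large_ind (A :\: S))) (p * #|S|%:R) => *; lra.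
move: Dsub; rewrite inE => /and3P[? ? ?]; by exists D.
Qed.

End LargeCovers.

(** * The key estimate *)

(** With [theta = v / (4 * K)] the absence of a booster would give [v * d%:R <= v * d%:R / 4 + K],
    while [K <= v * d%:R / 4]. *)
Lemma exists_booster (R : realType) (T : finType) (f : {set T} -> R) (p K v : R) (d : nat) :
  0 <= p <= 1 -> (forall A B : {set T}, A \subset B -> f A <= f B) ->
  (forall A, f A = 0 \/ f A = 1) -> 0 < v -> 0 < K ->
  v <= Ex p f * (1 - Ex p f) -> p * (1 - p) * influence p f <= K -> 4 * K <= v * d%:R ->
  exists2 S : {set T}, (0 < #|S| <= d)%N &
    (v / (4 * K)) ^+ 4 / 128 ^+ d < Ex p (fun A => f (A :|: S)) - Ex p (fun A => f (A :\: S)).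
Proof.
move=> hp mono f01 v0 K0 hv hI hd; apply: contrapT => hn.
have K4 : 0 < 4 * K by rewrite mulr_gt0.
have th0 : 0 <= v / (4 * K) by rewrite divr_ge0 // ltW.
have hb (S : {set T}) : (0 < #|S| <= d)%N -> Ex p (fun A => f (A :|: S)) - Ex p (fun A => f (A :\: S))
    <= (v / (4 * K)) ^+ 4 / 128 ^+ d.
  by move=> hS; rewrite leNgt; apply/negP => h; apply: hn; exists S.
have := variance_le_influence hp mono f01 th0 hb.
rewrite -/(influence p f); set I := _ * influence p f in hI *.
set V := _ * (1 - _) in hv *; set th := _ / _ in th0 *.
have thd : th * d%:R * K = v * d%:R / 4 by rewrite /th; field; rewrite gt_eqF.
have d0 : 0 <= d%:R :> R by [].
have h1 : (th * d%:R + 1) * I <= (th * d%:R + 1) * K.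
  by rewrite ler_wpM2l // addr_ge0 // mulr_ge0.
have h2 := ler_wpM2r d0 hv.
have h3 : 0 < v * d%:R by apply: lt_le_trans hd.
move=> h; have := le_trans h2 (le_trans h h1); rewrite mulrDl thd mul1r.
by move: (v * d%:R) hd h3 => x *; lra.
Qed.

(** * Numbers of constraints near a frozen set *)

Section Binomials.
Variable R : realType.

Lemma bin_pred_le (n k : nat) : (0 < k)%N -> (2 * k <= n)%N ->
  'C(n, k.-1)%:R <= 2 * k%:R / n%:R * 'C(n, k)%:R :> R.
Proof.
case: k => // k _ kn /=; have n0 : 0 < n%:R :> R by rewrite ltr0n (leq_trans _ kn) // mulnS.
rewrite mulrAC ler_pdivlMr // -!natrM ler_nat -mulnA mul_bin_left.
rewrite mulnA [leqLHS]mulnC leq_mul2r; apply/orP; right; lia.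
Qed.

End Binomials.

Section Counting.
Variables (R : realType) (Sigma : finType) (k : nat) (PP : {set {set k.-tuple Sigma}}) (n : nat).
Hypotheses (k2 : (2 <= k)%N) (kn : (2 * k <= n)%N).
Hypothesis PPperm : forall (s : 'S_k) P, P \in PP -> permute_coords s @: P \in PP.
Hypothesis PP0 : PP != finset.set0.
Let N : R := (num_constraints PP n)%:R.
Let B1 : R := ('C(n, k.-1) * #|PP|)%N%:R.
Let B2 : R := ('C(n, k.-2) * #|PP|)%N%:R.
Implicit Types (p C : R).

Lemma n_gt0 : 0 < n%:R :> R.
Proof. by rewrite ltr0n (leq_trans _ kn) // muln_gt0 (leq_trans _ k2). Qed.

Lemma card_constraints : #|constraints PP n| = num_constraints PP n.
Proof. by rewrite /constraints cardsX card_ksets mulnC. Qed.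

Lemma bin1_le : B1 <= 2 * k%:R / n%:R * N.
Proof.
rewrite /B1 /N /num_constraints mulnC !natrM mulrCA ler_wpM2l //.
by apply: bin_pred_le => //; lia.
Qed.

Lemma bin2_le : B2 <= 2 * k%:R / n%:R * B1.
Proof.
rewrite /B1 /B2 !natrM mulrA ler_wpM2r //.
apply: (@le_trans _ _ (2 * k.-1%:R / n%:R * 'C(n, k.-1)%:R)).
  by apply: bin_pred_le; lia.
rewrite ler_wpM2r // ler_wpM2r ?invr_ge0 // ler_wpM2l // ler_nat; lia.
Qed.

Lemma bin2_ge1 : 1 <= B2.
Proof. by rewrite ler1n muln_gt0 bin_gt0 card_gt0 PP0 andbT; lia. Qed.

Lemma window_bin1 p C : 0 <= p -> p * N <= C * n%:R -> p * B1 <= 2 * k%:R * C.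
Proof.
move=> p0 h; have n0 := n_gt0; apply: le_trans (ler_wpM2l p0 bin1_le) _.
have kp : 0 <= 2 * k%:R / n%:R :> R by rewrite divr_ge0 // mulr_ge0.
rewrite mulrCA; apply: le_trans (ler_wpM2l kp h) _.
by rewrite [C * _]mulrC mulrA divfK // gt_eqF.
Qed.

Lemma window_bin2 p C : 0 <= p -> p * N <= C * n%:R -> p * B2 <= 4 * k%:R ^+ 2 * C / n%:R.
Proof.
move=> p0 h; have n0 := n_gt0; apply: le_trans (ler_wpM2l p0 bin2_le) _.
have kp : 0 <= 2 * k%:R / n%:R :> R by rewrite divr_ge0 // mulr_ge0.
rewrite mulrCA; apply: le_trans (ler_wpM2l kp (window_bin1 p0 h)) _.
by rewrite le_eqVlt; apply/orP; left; apply/eqP; field; rewrite gt_eqF.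
Qed.

(** A crude bound through [1 <= B2]; it has the right order only for [k = 2], but a factor [1 / n]
    is all that is used. *)
Lemma window_p_le p C : 0 <= p -> p * N <= C * n%:R -> p <= 4 * k%:R ^+ 2 * C / n%:R.
Proof.
move=> p0 h; apply: le_trans (window_bin2 p0 h).
by rewrite ler_peMr // bin2_ge1.
Qed.

Variables (cs Cs b gamma : R).
Hypothesis hpower : forall (S : {set {ffun 'I_n -> Sigma}}) (eps : R), (1 <= n)%N ->
  eps <= rho_derivative R PP S -> Cs * n%:R `^ (- b) <= eps ->
  cs * eps `^ gamma <= rho R PP S.

(** [2 * k%:R * C * #|Sigma|%:R] bounds [p] times the number of derivative constraints, so the
    assumption forces derivative density at least [e], and (ii) applies. The killers that (ii)
    provides may touch [S0]; the subtracted term accounts for these. *)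
Lemma many_free_killers (S0 : {set 'I_n}) (sigma : {ffun 'I_n -> Sigma}) p C (r e : R)
    (Y : {set {ffun 'I_n -> Sigma}}) :
  0 <= p -> p * N <= C * n%:R -> 0 < C -> #|S0|%:R <= r -> 0 < r ->
  Y != finset.set0 -> Y \subset frozen S0 sigma -> 0 < e -> 
  Cs * n%:R `^ (- b) <= e ->
  e * (2 * k%:R * C * #|Sigma|%:R * r) < p * #|killers (@cyl Sigma k n) (linked_constraints PP S0) Y|%:R ->
  N * (cs * e `^ gamma - r * (2 * k%:R / n%:R)) <=
    #|killers (@cyl Sigma k n) (free_constraints PP S0) Y|%:R.
Proof.
move=> p0 pN C0 S0r r0 Y0 YZ e0 he hk; have n0 := n_gt0.
have ck := card_killers PPperm Y0 YZ; set dk := #|derivative_killers _ _| in ck.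
have hrd : e <= rho_derivative R PP Y.
  rewrite /rho_derivative -/(derivative_killers PP Y) -/dk.
  set Dn := #|finset.setX _ _|.
  have dkD : (dk <= Dn)%N.
    by apply/subset_leq_card/subsetP => c; rewrite inE => /andP[].
  have DnB : Dn%:R <= #|Sigma|%:R * B1.
    rewrite /B1 -natrM ler_nat /Dn cardsX card_ksets mulnCA leq_mul2l -cardsT -cardsX.
    apply/orP; right; apply/subset_leq_card/subsetP => -[a P].
    by rewrite in_setX in_setT inE => /andP[].
  have kdk : p * #|killers (@cyl Sigma k n) (linked_constraints PP S0) Y|%:R <= p * (r * dk%:R).
    rewrite ler_wpM2l //; apply: (@le_trans _ _ (#|S0| * dk)%N%:R); first by rewrite ler_nat.
    by rewrite natrM ler_wpM2r.
  have h1 := lt_le_trans hk kdk.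
  have hK0 : 0 <= e * (2 * k%:R * C * #|Sigma|%:R * r) by rewrite !mulr_ge0 // ltW.
  have Dn0 : 0 < Dn%:R :> R.
    rewrite ltr0n lt0n; apply/eqP => D0; move: dkD; rewrite D0 leqn0 => /eqP dk0.
    by move: h1; rewrite dk0 !mulr0 ltNge hK0.
  rewrite ler_pdivlMr // -(ler_pM2r r0); apply: ltW.
  have w1 := window_bin1 p0 pN.
  have p_gt0 : 0 < p.
    rewrite lt_def p0 andbT; apply: contraTneq h1 => ->.
    by rewrite mul0r -leNgt.
  rewrite -(ltr_pM2l p_gt0) [dk%:R * r]mulrC; apply: le_lt_trans h1.
  apply: (@le_trans _ _ (p * (e * (#|Sigma|%:R * B1) * r))).
    by rewrite ler_wpM2l // ler_wpM2r ?(ltW r0) // ler_wpM2l // ltW.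
  have -> : p * (e * (#|Sigma|%:R * B1) * r) = e * #|Sigma|%:R * r * (p * B1) by ring.
  apply: (@le_trans _ _ (e * #|Sigma|%:R * r * (2 * k%:R * C))).
    by rewrite ler_wpM2l // !mulr_ge0 // ltW.
  by rewrite le_eqVlt; apply/orP; left; apply/eqP; ring.
have n1 : (1 <= n)%N by rewrite -(ltr0n R).
have := hpower n1 hrd he; rewrite /rho -/(constraints PP n) card_constraints -/N.
have N0 : 0 < N.
  by rewrite /N ltr0n muln_gt0 card_gt0 PP0 bin_gt0 (leq_trans _ kn) // leq_pmull.
rewrite ler_pdivlMr // => h.
rewrite mulrBr lerBlDr mulrC; apply: le_trans h _.
apply: (@le_trans _ _ (#|killers (@cyl Sigma k n) (free_constraints PP S0) Y|
   + #|constraints PP n :\: free_constraints PP S0|)%N%:R).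
  rewrite ler_nat; apply: leq_trans (leq_card_setU _ _).
  apply/subset_leq_card/subsetP => c; rewrite inE => /andP[cO Yc].
  rewrite in_setU in_setD cO andbT; case: (boolP (c \in free_constraints PP S0)) => hc; rewrite ?orbT //.
  by rewrite inE hc Yc.
rewrite natrD lerD2l; apply: (@le_trans _ _ (#|S0| * ('C(n, k.-1) * #|PP|))%N%:R).
  by rewrite ler_nat card_not_free.
rewrite natrM mulrCA; apply: (@le_trans _ _ (r * B1)); first by rewrite ler_wpM2r.
by rewrite ler_wpM2l ?(ltW r0) // [N * _]mulrC bin1_le.
Qed.

End Counting.

Lemma exponent_bounds (a b c : nat) : let m := (4 * b + 10 + c + a)%N in
  [/\ a + 2 <= m, c.+2 <= m, b + 3 <= m & 4 * b + 8 + c <= m]%N.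
Proof. by move=> m; split; rewrite /m; lia. Qed.

Lemma exponent_bound0 (a b c d : nat) : (a + 2 <= 4 * (a + b) + 10 + c + d)%N.
Proof. by lia. Qed.

Lemma exponent_splits (b c d : nat) :
  [/\ 4 * b + 7 + c = (2 * b + 3) + (2 * b + 4) + c, (4 * b + 7 + c).+1 = 4 * b + 8 + c,
     2 * b + 3 + d = (b + 2) + d + b.+1, 2 * b + 3 = (b + 2) + b.+1
   & 2 * b + 4 = (b + 2) + 1 + b.+1]%N.
Proof. by split; lia. Qed.

(* All losses are measured in powers of [z = exp (- K)], with [n^-1 <= z ^+ m]:
   the boost is of order [z ^+ E1], every error term of order [z ^+ E1.+1]. *)
Section KeyEstimate.
Variables (R : realType) (Sigma : finType) (k : nat) (PP : {set {set k.-tuple Sigma}}) (n : nat).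
Hypotheses (k2 : (2 <= k)%N) (kn : (2 * k <= n)%N).
Hypothesis PPperm : forall (s : 'S_k) P, P \in PP -> permute_coords s @: P \in PP.
Hypothesis PP0 : PP != finset.set0.
Let T := ({set 'I_n} * {set k.-tuple Sigma})%type.
Let f := @covers_ind Sigma k PP n R.
Let large := @large_ind R Sigma k PP n.
Let small := @small_ind R Sigma k PP n.
Let N : R := (num_constraints PP n)%:R.
Variables (eta C K z : R) (D : nat).
Hypotheses (eta0 : 0 < eta) (C0 : 0 < C) (K1 : 1 <= K) (z0 : 0 < z) (Kz : expR K * z = 1).
Hypothesis D_large : 8 / eta ^+ 2 + 1 <= D%:R.

Let K0 : 0 < K. Proof. exact: lt_le_trans K1. Qed.

Lemma Kz_le1 : K * z <= 1.
Proof.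
rewrite -Kz ler_wpM2r ?(ltW z0) //; apply: le_trans (expR_ge1Dx _); lra.
Qed.

Lemma z_le1 : z <= 1.
Proof. by apply: le_trans Kz_le1; rewrite ler_peMl // ltW. Qed.

Lemma zX_le i j : (j <= i)%N -> z ^+ i <= z ^+ j.
Proof. by move=> ji; rewrite ler_wiXn2l ?z_le1 // ltW. Qed.

Lemma expz (i : nat) : expR (i%:R * K) * z ^+ i = 1.
Proof. by rewrite expRM_natl -exprMn Kz expr1n. Qed.

Lemma exp2_le (d : nat) : d%:R <= D%:R * K -> 2 ^+ d * z ^+ D <= 1.
Proof.
move=> dD; rewrite -[leRHS](expz D) ler_wpM2r ?exprn_ge0 ?(ltW z0) //.
apply: (@le_trans _ _ (expR d%:R)); last by rewrite ler_expR.
rewrite -[d%:R]mulr1 expRM_natl.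
rewrite lerXn2r ?nnegrE ?expR_ge0 //.
by apply: le_trans (expR_ge1Dx _); lra.
Qed.

(** [v0] bounds the variance of the large-cover event from below: its probability lies between
    [eta / 2] and [1 - eta]. The booster gains [(v0 / (4 * K)) ^+ 4 / 128 ^+ d] with
    [d%:R <= D%:R * K]. Since [K * z <= 1], [2 ^+ d * z ^+ D <= 1] and [128 = 2 ^ 7], this is at
    least [boost_const * z ^+ E0]. [C8] bounds the cost of the booster meeting the random set. *)
Let v0 := eta ^+ 2 / 2.
Definition boost_const := (v0 / 4) ^+ 4.
Let c0 := boost_const.
Let E0 := (4 + 7 * D)%N.
Let C8 := 4 * k%:R ^+ 2 * C * D%:R.

Hypotheses (z_eta : z <= eta / 2) (z_c0 : (1 + C8) * z <= c0 / 2).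
Hypothesis n_large : n%:R^-1 <= z ^+ (E0 + 2).

Lemma satisfiable_boost p : 0 <= p <= 1 -> p * N <= C * n%:R ->
  eta <= Ex p f <= 1 - eta -> p * influence p (large (D%:R * K)) <= K ->
  Ex p (small (D%:R * K)) <= z ^+ E0.+1 ->
  exists B : {set T}, [/\ B \subset constraints PP n, B \notin covers PP n,
    #|B|%:R <= D%:R * K & c0 / 2 * z ^+ (E0 + D) <= Ex p (fun A => f (A :|: B)) - Ex p f].
Proof.
move=> hp pN /andP[f1 f2] hI hsmall; have [p0 p1] := andP hp.
pose g := large (D%:R * K).
pose d := (Num.truncn (4 * K / v0)).+1.
have v00 : 0 < v0 by rewrite divr_gt0 // exprn_gt0.
have q0 : 0 <= 4 * K / v0 by rewrite divr_ge0 ?mulr_ge0 // ltW.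
have /andP[t1 t2] := Num.Theory.truncn_itv q0.
have hd : 4 * K <= v0 * d%:R by rewrite [leRHS]mulrC -ler_pdivrMr // ltW.
have dD : d%:R <= D%:R * K.
  rewrite /d -natr1; apply: (@le_trans _ _ (4 * K / v0 + 1)); first by rewrite lerD2r.
  apply: (@le_trans _ _ ((8 / eta ^+ 2 + 1) * K)); last by rewrite ler_wpM2r // ltW.
  rewrite [leRHS]mulrDl mul1r; apply: lerD => //; rewrite le_eqVlt; apply/orP; left; apply/eqP.
  by rewrite /v0; field; rewrite gt_eqF.
have zE : z ^+ E0.+1 <= eta / 2.
  by apply: le_trans z_eta; rewrite -[leRHS]expr1 zX_le.
have hcl : Ex p f <= Ex p g + Ex p (small (D%:R * K)).
  by rewrite -ExD; apply: le_Ex => // A; exact: covers_le_large.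
have hlc : Ex p g <= Ex p f by apply: le_Ex => // A; exact: large_le_covers.
have hv : v0 <= Ex p g * (1 - Ex p g).
  have h1 : eta / 2 <= Ex p g by lra.
  have h2 : eta <= 1 - Ex p g by lra.
  have -> : v0 = eta / 2 * eta by rewrite /v0; ring.
  by apply: ler_pM => //; rewrite ?divr_ge0 // ltW.
have i0 : 0 <= influence p g.
  apply: sumr_ge0 => i _; apply: Ex_ge0 => // A; rewrite subr_ge0 large_ind_mono //.
  by rewrite (subset_trans (subsetDl _ _)) ?subsetUr.
have hI' : p * (1 - p) * influence p g <= K.
  apply: le_trans hI; rewrite ler_wpM2r // ler_piMr // gerBl //.
have [S /andP[S0 Sd] hS] := exists_booster hp (@large_ind_mono R Sigma k PP n _)
   (@large_ind01 R Sigma k PP n _) v00 K0 hv hI' hd.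
have Sd' : #|S|%:R <= d%:R :> R by rewrite ler_nat.
have SD : #|S|%:R <= D%:R * K by exact: le_trans dD.
set delta := _ / _ in hS.
have zn i : 0 <= z ^+ i by rewrite exprn_ge0 // ltW.
have deltaE : c0 * z ^+ E0 <= delta.
  rewrite /delta ler_pdivlMr ?exprn_gt0 // /E0 exprD.
  have -> : c0 * (z ^+ 4 * z ^+ (7 * D)) * 128 ^+ d = c0 * z ^+ 4 * (z ^+ (7 * D) * 128 ^+ d).
    by rewrite !mulrA.
  have h2 := exp2_le dD.
  have h128 : z ^+ (7 * D) * 128 ^+ d <= 1.
    have -> : 128 = 2 ^+ 7 :> R by ring.
    rewrite exprAC mulnC exprM -exprMn; apply: exprn_ile1; last by rewrite mulrC.
    by rewrite mulr_ge0 ?exprn_ge0 // ltW.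
  apply: (@le_trans _ _ (c0 * z ^+ 4 * 1)).
    by rewrite ler_wpM2l // mulr_ge0 // exprn_ge0 // divr_ge0 // ltW.
  have K4 : 0 < 4 * K by rewrite mulr_gt0.
  rewrite mulr1 -exprMn; apply: lerXn2r; rewrite ?nnegrE.
  - by rewrite mulr_ge0 ?(ltW z0) // divr_ge0 // ltW.
  - by rewrite divr_ge0 // ltW.
  rewrite ler_pdivlMr // (_ : v0 / 4 * z * (4 * K) = v0 * (K * z)); last by field.
  by rewrite ler_piMr ?(ltW v00) // Kz_le1.
have n0 := n_gt0 R k2 kn.
have hpS : p * #|S|%:R <= C8 * z ^+ E0.+1.
  have hp1 := window_p_le k2 kn PP0 p0 pN.
  apply: (@le_trans _ _ (4 * k%:R ^+ 2 * C / n%:R * (D%:R * K))); first exact: ler_pM.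
  have -> : 4 * k%:R ^+ 2 * C / n%:R * (D%:R * K) = C8 * (n%:R^-1 * K) by rewrite /C8; ring.
  rewrite ler_wpM2l ?mulr_ge0 ?exprn_ge0 ?(ltW C0) //.
  apply: (@le_trans _ _ (z ^+ (E0 + 2) * K)); first by rewrite ler_wpM2r // ltW.
  rewrite addn2 exprSr -mulrA ler_piMr // mulrC; exact: Kz_le1.
have hnum : c0 / 2 * z ^+ E0 <= delta - Ex p (small (D%:R * K)) - p * #|S|%:R.
  have h1 := ler_wpM2r (zn E0) z_c0.
  have h2 : z ^+ E0.+1 = z * z ^+ E0 by rewrite exprS.
  rewrite h2 in hpS hsmall.
  move: h1 hpS hsmall deltaE.
  by move: (z ^+ E0) (p * #|S|%:R) (Ex p _) => *; lra.
have num0 : 0 <= delta - Ex p (small (D%:R * K)) - p * #|S|%:R.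
  apply: le_trans hnum; rewrite mulr_ge0 // divr_ge0 // exprn_ge0 // divr_ge0 // ltW //.
have [B [BS BO Bnc hB]] := satisfiable_booster hp SD num0 hS.
exists B; split => //.
  by apply: le_trans SD; rewrite ler_nat subset_leq_card.
have hX : 0 <= Ex p (fun A => f (A :|: B)) - Ex p f.
  by rewrite subr_ge0; apply: le_Ex => // A; apply: covers_ind_mono; exact: subsetUl.
have h2 := exp2_le SD.
(* The averaging over subsets of [S] costs [2 ^+ #|S|]; the additional exponent [D] pays for it. *)
apply: (@le_trans _ _ (2 ^+ #|S| * z ^+ D * (Ex p (fun A => f (A :|: B)) - Ex p f))).
  have := ler_wpM2l (zn D) (le_trans hnum hB).
  rewrite (_ : z ^+ D * (c0 / 2 * z ^+ E0) = c0 / 2 * z ^+ (E0 + D)); last first.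
    by rewrite exprD mulrC mulrA.
  by move/le_trans; apply; rewrite mulrCA mulrA.
by rewrite ler_piMl.
Qed.


Variables (cs Cs b gamma : R) (C3 G : nat).
Hypotheses (cs0 : 0 < cs) (gammaG : gamma <= G%:R).
Hypothesis hpower : forall (S : {set {ffun 'I_n -> Sigma}}) (eps : R), (1 <= n)%N ->
  eps <= rho_derivative R PP S -> Cs * n%:R `^ (- b) <= eps ->
  cs * eps `^ gamma <= rho R PP S.
Hypothesis C3_large : 2 * k%:R ^+ 2 * D%:R * C <= C3%:R.

(** [E1] is the exponent of the boost. About [z ^- (E1 + 2)] rounds, times [(1 + p) ^+ #|linked|],
    which is at most [expR (C3%:R * K)], must be beaten by [eps = z ^+ E4] with [z ^+ E1.+1] to
    spare; this gives [E4]. Then (ii) is used at density [c6 * z ^+ (E4 + 1)], and the power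
    [gamma <= G%:R] gives [E7]. *)
Let E1 := (E0 + D)%N.
Let E4 := (2 * E1 + 3 + C3)%N.
Let E7 := (G * (E4 + 1))%N.
(** The inverse of the factor in [many_free_killers] for [r = k%:R * D%:R * K], apart from [K],
    which one factor [z] absorbs. The [+ 1] keeps the denominator positive. *)
Definition power_const := (2 * k%:R ^+ 2 * C * D%:R * (#|Sigma|%:R + 1))^-1 : R.
Let c6 := power_const.
Let c7 := cs * c6 ^+ G.
Let C5 := 4 * k%:R ^+ 4 * C * D%:R ^+ 2.
Let m := (4 * E1 + 10 + E7 + E4)%N.

Hypotheses (z_Cs : Cs * z <= c6) (z_c6 : c6 * z <= 1).
Hypotheses (z_c7 : 2 * k%:R ^+ 2 * D%:R * z <= c7 / 2) (z_c7' : 2 * z <= C * c7).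
Hypotheses (n_large' : n%:R^-1 <= z ^+ m) (n_large_b : n%:R `^ (- b) <= z ^+ m).

Let zn i : 0 <= z ^+ i. Proof. by rewrite exprn_ge0 // ltW. Qed.
Let n0 : 0 < n%:R :> R. Proof. exact: n_gt0 k2 kn. Qed.
Let k0 : 0 < k%:R :> R. Proof. by rewrite ltr0n; apply: leq_trans k2. Qed.
Let D0 : 0 < D%:R :> R.
Proof. by apply: lt_le_trans D_large; rewrite ltr_wpDl // divr_ge0 // sqr_ge0. Qed.
Let c60 : 0 < c6.
Proof. by rewrite invr_gt0 !mulr_gt0 ?exprn_gt0 // ltr_wpDl. Qed.
Let c70 : 0 < c7. Proof. by rewrite mulr_gt0 ?exprn_gt0. Qed.

Lemma nz_ge1 j : (j <= m)%N -> 1 <= n%:R * z ^+ j.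
Proof.
move=> jm; rewrite mulrC -ler_pdivrMr // mul1r; apply: le_trans n_large' _.
exact: zX_le.
Qed.

Lemma n_inv_le j : (j <= m)%N -> n%:R^-1 <= z ^+ j.
Proof. by move=> jm; apply: le_trans n_large' (zX_le jm). Qed.

Lemma card_support (B : {set T}) : B \subset constraints PP n -> #|B|%:R <= D%:R * K ->
  #|\bigcup_(e in B) e.1|%:R <= k%:R * D%:R * K.
Proof.
move=> BO hB; apply: (@le_trans _ _ (k * #|B|)%N%:R); last first.
  by rewrite natrM -mulrA ler_wpM2l.
rewrite ler_nat; apply: leq_trans (card_bigcup_le _ _) _.
rewrite mulnC -sum_nat_const; apply: leq_sum => e eB.
by rewrite (card_constraint (subsetP BO _ eB)).
Qed.

(** [M] is the integer part of [z ^- (E1 + 2)], up to ties. [C5] bounds the tied constraints, 2 the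
    light kills and the failures [kappa], and [C3] the event of more than [M] linked constraints,
    where the spare factor [z] absorbs [K]. *)
Lemma boost_upper p q (M : nat) (B : {set T}) :
  0 <= p <= 1 -> 0 <= q <= 1 -> p + M%:R * q <= 1 -> p * N <= C * n%:R ->
  B \subset constraints PP n -> B \notin covers PP n -> #|B|%:R <= D%:R * K ->
  M%:R * z ^+ (E1 + 2) <= 1 -> 1 <= M.+1%:R * z ^+ (E1 + 2) ->
  C * n%:R * z ^+ (2 * E1 + 4) <= q * N ->
  Ex p (fun A => f (A :|: B)) <= Ex (p + M%:R * q) f + (C5 + 2 + C3%:R) * z ^+ E1.+1.
Proof.
move=> hp hq pM pN BO Bnc hB M1 M2 qN; have [p0 p1] := andP hp; have [q0 q1] := andP hq.
have [sigma hsigma] : exists sigma, forall e, e \in B -> sigma \notin cyl e.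
  have : ~~ covered (@cyl Sigma k n) B [set: _].
    have BE : B = B :&: constraints PP n by apply/esym/setIidPl.
    by rewrite [B]BE -coversE -BE.
  move/subsetPn => [sigma _ hs]; exists sigma => e eB.
  by apply: contra hs => h; apply/bigcupP; exists e.
pose S0 := \bigcup_(e in B) e.1.
have hS0 : forall e, e \in B -> e.1 \subset S0 /\ sigma \notin cyl e.
  by move=> e eB; split; [exact: bigcup_sup|exact: hsigma].
have S0r := card_support BO hB; rewrite -/S0 in S0r.
set r := k%:R * D%:R * K in S0r.
have r0 : 0 < r by rewrite !mulr_gt0.
pose eps := z ^+ E4; pose kappa := z ^+ (2 * E1 + 3).
have kappa0 : 0 < kappa by rewrite exprn_gt0.
have hk (Y : {set {ffun 'I_n -> Sigma}}) : Y != finset.set0 -> Y \subset frozen S0 sigma ->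
    eps < p * #|killers (@cyl Sigma k n) (linked_constraints PP S0) Y|%:R ->
    1 <= kappa * (q * #|killers (@cyl Sigma k n) (free_constraints PP S0) Y|%:R).
  move=> Y0 YZ hY; pose e := c6 * z ^+ (E4 + 1).
  have e0 : 0 < e by rewrite mulr_gt0 // exprn_gt0.
  (* Because [e <= 1], raising the exponent from [gamma] to the integer [G] only lowers the
     power. *)
  have he1 : e <= 1.
    apply: le_trans z_c6; rewrite ler_wpM2l ?(ltW c60) // -[leRHS]expr1 zX_le // addn1 //.
  have heC : Cs * n%:R `^ (- b) <= e.
    have [Cs0|Cs0] := leP Cs 0; first by rewrite (le_trans _ (ltW e0)) // mulr_le0_ge0 // powR_ge0.
    apply: (@le_trans _ _ (Cs * z ^+ (E4 + 2))).
      by rewrite ler_wpM2l ?(ltW Cs0) //; apply: le_trans n_large_b (zX_le _); have [] := exponent_bounds E4 E1 E7.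
    by rewrite /e (addnS E4) exprS mulrA ler_wpM2r.
  have hS : e * (2 * k%:R * C * #|Sigma|%:R * r) <
      p * #|killers (@cyl Sigma k n) (linked_constraints PP S0) Y|%:R.
    apply: le_lt_trans hY; rewrite /eps.
    have Sp : 0 < #|Sigma|%:R + 1 :> R by rewrite ltr_wpDl.
    have -> : e * (2 * k%:R * C * #|Sigma|%:R * r) =
        (#|Sigma|%:R / (#|Sigma|%:R + 1)) * (K * z) * z ^+ E4.
      rewrite /e /c6 /power_const /r addn1 (exprS z).
      by field; rewrite !gt_eqF.
    rewrite ler_piMl // mulr_ile1 ?Kz_le1 ?mulr_ge0 ?invr_ge0 ?(ltW K0) ?(ltW z0) ?(ltW Sp) //.
    by rewrite ler_pdivrMr // mul1r lerDl.
  have := many_free_killers k2 kn PPperm PP0 hpower p0 pN C0 S0r r0 Y0 YZ e0 heC hS.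
  rewrite -/N; set F := #|_|%:R => hF.
  have he : c6 ^+ G * z ^+ E7 <= e `^ gamma.
    have -> : c6 ^+ G * z ^+ E7 = e `^ G%:R.
      by rewrite powR_mulrn ?(ltW e0) // /e exprMn /E7 mulnC exprM.
    by rewrite ger_powR // e0.
  have hr : r * (2 * k%:R / n%:R) <= c7 / 2 * z ^+ E7.
    have -> : r * (2 * k%:R / n%:R) = 2 * k%:R ^+ 2 * D%:R * (K * n%:R^-1) by rewrite /r; ring.
    apply: (@le_trans _ _ (2 * k%:R ^+ 2 * D%:R * (z * z ^+ E7))); last by rewrite mulrA ler_wpM2r.
    rewrite ler_wpM2l ?mulr_ge0 ?exprn_ge0 //.
    apply: (@le_trans _ _ (K * z ^+ E7.+2)).
      by rewrite ler_wpM2l ?(ltW K0) // n_inv_le //; have [] := exponent_bounds E4 E1 E7.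
    by rewrite exprS mulrA -exprS ler_piMl ?Kz_le1.
  have N0 : 0 <= N by [].
  have hF2 : N * (c7 / 2 * z ^+ E7) <= F.
    apply: le_trans hF; rewrite ler_wpM2l //.
    have := ler_wpM2l (ltW cs0) he; rewrite mulrA -/c7 => h.
    by move: (z ^+ E7) (e `^ gamma) (r * _) h hr => *; lra.
  have nz : 1 <= n%:R * z ^+ (4 * E1 + 8 + E7) by apply: nz_ge1; have [] := exponent_bounds E4 E1 E7.
  have nF : C * n%:R * z ^+ (2 * E1 + 4) * (c7 / 2 * z ^+ E7) <= q * F.
    apply: (@le_trans _ _ (q * N * (c7 / 2 * z ^+ E7))).
      by rewrite ler_wpM2r // mulr_ge0 // divr_ge0 // ltW.
    by rewrite -mulrA ler_wpM2l.
  apply: le_trans (ler_wpM2l (ltW kappa0) nF).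
  have -> : kappa * (C * n%:R * z ^+ (2 * E1 + 4) * (c7 / 2 * z ^+ E7)) =
     (C * c7 / 2) * (n%:R * z ^+ (4 * E1 + 7 + E7)).
    have [-> _ _ _ _] := exponent_splits E1 E7 0.
    by rewrite /kappa !exprD; ring.
  have cz : z <= C * c7 / 2 by rewrite ler_pdivlMr // mulrC.
  have nz0 : 0 <= n%:R * z ^+ (4 * E1 + 7 + E7) by rewrite mulr_ge0.
  apply: le_trans (ler_wpM2r nz0 cz); rewrite mulrCA -exprS.
  by have [_ -> _ _ _] := exponent_splits E1 E7 0.
have := covers_boost_le hS0 hp hq (zn _) kappa0 pM hk.
move/le_trans; apply; rewrite -!addrA lerD2l.
have hw1 := window_bin1 k2 kn PP0 p0 pN; have hw2 := window_bin2 k2 kn PP0 p0 pN.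
set B1 := (_ * _)%N%:R in hw1; set B2 := (_ * _)%N%:R in hw2.
have plink : p * #|linked_constraints PP S0|%:R <= C3%:R * K.
  apply: (@le_trans _ _ (p * (r * B1))).
    rewrite ler_wpM2l //; apply: (@le_trans _ _ (#|S0| * ('C(n, k.-1) * #|PP|))%N%:R).
      by rewrite ler_nat card_linked.
    by rewrite natrM ler_wpM2r.
  apply: (@le_trans _ _ (r * (2 * k%:R * C))); first by rewrite mulrCA ler_wpM2l // ltW.
  apply: (@le_trans _ _ (2 * k%:R ^+ 2 * D%:R * C * K)); last by rewrite ler_wpM2r // ltW.
  by rewrite le_eqVlt /r; apply/orP; left; apply/eqP; ring.
have KzE i : K * z ^+ i.+1 <= z ^+ i.
  by rewrite exprS mulrA ler_piMl ?Kz_le1.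
have t2 : p * #|tied_constraints PP S0|%:R <= C5 * z ^+ E1.+1.
  apply: (@le_trans _ _ (p * (r ^+ 2 * B2))).
    rewrite ler_wpM2l //; apply: (@le_trans _ _ (#|S0| ^ 2 * ('C(n, k.-2) * #|PP|))%N%:R).
      by rewrite ler_nat card_tied.
    rewrite natrM ler_wpM2r // natrX lerXn2r ?nnegrE // ltW //.
  rewrite mulrCA; apply: (@le_trans _ _ (r ^+ 2 * (4 * k%:R ^+ 2 * C / n%:R))).
    by rewrite ler_wpM2l // sqr_ge0.
  have -> : r ^+ 2 * (4 * k%:R ^+ 2 * C / n%:R) = C5 * (K ^+ 2 * n%:R^-1) by rewrite /r /C5; ring.
  have C50 : 0 <= C5 by rewrite !mulr_ge0 ?exprn_ge0 // ltW.
  rewrite ler_wpM2l //; apply: (@le_trans _ _ (K ^+ 2 * z ^+ (E1 + 3))).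
    by rewrite ler_wpM2l ?sqr_ge0 // n_inv_le //; have [] := exponent_bounds E4 E1 E7.
  rewrite !addnS addn0 expr2 -mulrA; apply: le_trans (KzE _).
  by rewrite ler_wpM2l ?(ltW K0) ?KzE.
have t3 : M%:R * (eps * (p + 1) ^+ #|linked_constraints PP S0|) <= z ^+ E1.+1.
  (* The expected number of linked constraints is at most [C3%:R * K], and [1 + p <= expR p]. *)
  have : (p + 1) ^+ #|linked_constraints PP S0| * z ^+ C3 <= 1.
    rewrite -[leRHS](expz C3) ler_wpM2r //.
    apply: (@le_trans _ _ (expR (p * #|linked_constraints PP S0|%:R))); last by rewrite ler_expR.
    by rewrite mulrC expRM_natl lerXn2r ?nnegrE ?expR_ge0 ?addr_ge0 // addrC expR_ge1Dx.
  set u := _ ^+ _ => hu.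
  have -> : M%:R * (eps * u) = M%:R * z ^+ (E1 + 2) * (u * z ^+ C3) * z ^+ E1.+1.
    have [_ _ e4 _ _] := exponent_splits E1 E7 C3.
    by rewrite /eps /E4 e4 !exprD; ring.
  rewrite ler_piMl // mulr_ile1 // mulr_ge0 // exprn_ge0 // addr_ge0 //.
have t4 : M%:R * kappa <= z ^+ E1.+1.
  have [_ _ _ e4 _] := exponent_splits E1 E7 C3.
  by rewrite /kappa e4 exprD mulrA ler_piMl.
have t5 : p * #|linked_constraints PP S0|%:R / M.+1%:R <= C3%:R * z ^+ E1.+1.
  rewrite ler_pdivrMr //; apply: le_trans plink _.
  rewrite -mulrA ler_wpM2l //; apply: (@le_trans _ _ (K * (M.+1%:R * z ^+ (E1 + 2)))).
    by rewrite ler_peMr // ltW.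
  by rewrite mulrCA [leRHS]mulrC ler_wpM2l // addn2 KzE.
move: t2 t3 t4 t5; rewrite -/eps [M%:R * (_ + kappa)]mulrDr.
by move: (p * _) (M%:R * (_ * _)) (M%:R * kappa) (_ / _) (z ^+ E1.+1) => *; lra.
Qed.


Hypothesis z_total : (C5 + 3 + C3%:R) * z < c0 / 2.

Lemma no_wide_window (a a' : R) : 0 <= a -> a < a' -> a' <= 1 ->
  (forall p, a <= p <= a' -> [/\ eta <= Ex p f <= 1 - eta, p * N <= C * n%:R
     & Ex p (small (D%:R * K)) <= z ^+ E0.+1]) ->
  8 * C * n%:R / K <= N * (a' - a) -> False.
Proof.
move=> a0 aa' a1 hwin hW; pose L := a' - a; have L0 : 0 < L by rewrite subr_gt0.
(* Chosen so that the increment bound [8 * Dl / L] of [quiet_point] is [z ^+ E1.+1], one factor [z]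
   below the boost. *)
pose Dl := L * z ^+ E1.+1 / 8.
have Dl0 : 0 < Dl by rewrite divr_gt0 // mulr_gt0 // exprn_gt0.
have z1 : z ^+ E1.+1 <= 1 by rewrite -[leRHS](expr0 z) zX_le.
have Lz : L * z ^+ E1.+1 <= L by rewrite ler_piMr // ltW.
have D4 : 4 * Dl <= a' - a.
  by rewrite -/L /Dl; move: (L * z ^+ E1.+1) Lz L0 => u *; lra.
have f01 A : 0 <= f A <= 1 by rewrite /f /covers_ind; case: (_ \in _); rewrite ?ler01 ?lexx.
have l01 A : 0 <= large (D%:R * K) A <= 1.
  by case: (large_ind01 PP (D%:R * K) A) => h; rewrite /large h ?ler01 ?lexx.
have [p [ap pD hI hinc]] := quiet_point a0 aa' a1 Dl0 D4
   (@large_ind_mono R Sigma k PP n (D%:R * K)) l01 (@covers_ind_mono Sigma k PP n R) f01.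
have p0 : 0 < p by exact: le_lt_trans ap.
have pa' : p <= a' by apply: le_trans pD; rewrite lerDl ltW.
have p01 : 0 <= p <= 1 by rewrite ltW //= (le_trans pa').
have [hf pN hs] : [/\ eta <= Ex p f <= 1 - eta, p * N <= C * n%:R
     & Ex p (small (D%:R * K)) <= z ^+ E0.+1] by apply: hwin; rewrite ltW.
have NL : 0 < N * L by apply: lt_le_trans hW; rewrite divr_gt0 // !mulr_gt0.
have N0 : 0 < N by move: NL; rewrite pmulr_lgt0.
have hW' : 8 * (C * n%:R) <= K * (N * L).
  by move: hW; rewrite ler_pdivrMr // -mulrA [leRHS]mulrC.
(* Here the assumed width enters: [p * N <= C * n%:R] and influence at most [8 / L], where
   [8 * C * n%:R <= K * N * L]. *)
have hI' : p * influence p (large (D%:R * K)) <= K.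
  rewrite -(ler_pM2r NL); apply: le_trans hW'.
  have -> : p * influence p (large (D%:R * K)) * (N * L) =
     p * N * (influence p (large (D%:R * K)) * L) by ring.
  apply: (@le_trans _ _ (p * N * 8)); first by rewrite ler_wpM2l // mulr_ge0 // ltW.
  by rewrite mulrC ler_wpM2l.
have [B [BO Bnc hB hboost]] := satisfiable_boost p01 pN hf hI' hs.
(* The increment [Dl] is shared equally among [M] rounds of density [q], with [M] the integer part
   of [Y]; [q * N] remains [n] times a fixed power of [z]. *)
pose Y := expR K ^+ (E1 + 2).
have YE : Y * z ^+ (E1 + 2) = 1 by rewrite /Y -exprMn Kz expr1n.
have Y1 : 1 <= Y by rewrite exprn_ege1 // -expR0 ler_expR ltW.
have /andP[M1 M2] := Num.Theory.truncn_itv (le_trans ler01 Y1).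
set M := Num.truncn Y in M1 M2.
have M0 : 0 < M%:R :> R by rewrite ltr0n Num.Theory.truncn_gt0.
have Mz1 : M%:R * z ^+ (E1 + 2) <= 1 by rewrite -[leRHS]YE ler_wpM2r.
have Mz2 : 1 <= M.+1%:R * z ^+ (E1 + 2) by rewrite -[leLHS]YE ler_wpM2r // ltW.
pose q := Dl / M%:R.
have Mq : M%:R * q = Dl by rewrite mulrC divfK // gt_eqF.
have q0 : 0 <= q by rewrite divr_ge0 // ltW.
have q1 : q <= 1.
  apply: (@le_trans _ _ (M%:R * q)); last by rewrite Mq (le_trans _ (le_trans pD a1)) // lerDr ltW.
  by rewrite ler_peMl // ler1n -(ltr0n R).
have q01 : 0 <= q <= 1 by rewrite q0 q1.
have pM : p + M%:R * q <= 1 by rewrite Mq (le_trans pD).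
have qN : C * n%:R * z ^+ (2 * E1 + 4) <= q * N.
  rewrite /q [leRHS]mulrAC ler_pdivlMr //.
  apply: (@le_trans _ _ (C * n%:R * z ^+ (2 * E1 + 4) * Y)).
    apply: ler_wpM2l => //; exact: mulr_ge0 (mulr_ge0 (ltW C0) (ltW n0)) (zn _).
  have -> : C * n%:R * z ^+ (2 * E1 + 4) * Y = C * n%:R * z * z ^+ E1.+1.
    have [_ _ _ _ ->] := exponent_splits E1 E7 0.
    rewrite exprD (exprD z (E1 + 2)) expr1.
    have -> : C * n%:R * (z ^+ (E1 + 2) * z * z ^+ E1.+1) * Y =
      C * n%:R * z * z ^+ E1.+1 * (Y * z ^+ (E1 + 2)) by ring.
    by rewrite YE mulr1.
  have -> : Dl * N = N * L / 8 * z ^+ E1.+1 by rewrite /Dl; ring.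
  rewrite ler_wpM2r // ler_pdivlMr //.
  have -> : C * n%:R * z * 8 = 8 * (C * n%:R) * z by ring.
  apply: le_trans (ler_wpM2r (ltW z0) hW') _.
  by rewrite mulrAC ler_piMl ?Kz_le1 // ltW.
have := boost_upper p01 q01 pM pN BO Bnc hB Mz1 Mz2 qN; rewrite Mq => hup.
have hinc' : Ex (p + Dl) f - Ex p f <= z ^+ E1.+1.
  rewrite -(ler_pM2r L0); apply: le_trans hinc _.
  by rewrite le_eqVlt /Dl; apply/orP; left; apply/eqP; field.
have zE : z ^+ E1.+1 = z * z ^+ E1 by rewrite exprS.
have zE0 : 0 < z ^+ E1 by rewrite exprn_gt0.
have := z_total; rewrite -(ltr_pM2r zE0).
rewrite zE in hup hinc'; move: hup hinc' hboost; rewrite -/E1.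
move: (Ex p (fun A => f (A :|: B))) (Ex (p + Dl) f) (Ex p f) (z ^+ E1) => *; lra.
Qed.

End KeyEstimate.

(** * Thresholds *)

Section Thresholds.
Variables (R : realType) (Sigma : finType) (k : nat) (PP : {set {set k.-tuple Sigma}}) (n : nat).
Let T := ({set 'I_n} * {set k.-tuple Sigma})%type.
Let f := @covers_ind Sigma k PP n R.
Hypothesis covers_nonempty : covers PP n != finset.set0.
Hypothesis covers_proper : covers PP n != powerset (constraints PP n).

Lemma muE (p : R) : mu PP (covers PP n) p = Ex p f.
Proof. exact: product_measureE. Qed.

Lemma Ex_covers01 (p : R) : 0 <= p <= 1 -> 0 <= Ex p f <= 1.
Proof.
move=> hp; rewrite Ex_ge0 //= -[leRHS](ExC T p); apply: le_Ex => // A.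
by rewrite /f /covers_ind; case: (_ \in _).
Qed.

Lemma Ex_covers_mono (p q : R) : 0 <= p -> p <= q -> q <= 1 -> Ex p f <= Ex q f.
Proof. by move=> *; apply: Ex_mono => //; exact: covers_ind_mono. Qed.

Lemma Ex1_covers : Ex 1 f = 1.
Proof.
apply/eqP; rewrite eq_le; have /andP[_ ->] := Ex_covers01 (p := 1) ltac:(by rewrite ler01 lexx).
have /set0Pn[B BC] := covers_nonempty; rewrite -[leLHS](expr1n R #|[set: T]|) -Ex_sub.
apply: le_Ex; first by rewrite ler01 lexx.
move=> A; rewrite ler_nat; case: (boolP (_ \subset _)) => // TA.
have BO : B \subset constraints PP n by move: BC; rewrite inE powersetE => /andP[].
rewrite (covers_superset R (D := B)) // subsetI BO andbT.
exact: subset_trans (subsetT _) TA.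
Qed.

Lemma Ex0_covers : Ex 0 f = 0.
Proof.
apply/eqP; rewrite eq_le; have /andP[-> _] := Ex_covers01 (p := 0) ltac:(by rewrite lexx ler01).
rewrite andbT; have := Ex_disjoint (0 : R) [set: T]; rewrite subr0 expr1n => h.
apply: (@le_trans _ _ (1 - Ex 0 (fun A : {set T} => [disjoint A & [set: T]]%:R))); last by rewrite h subrr.
rewrite -[X in X - _](ExC T 0) -ExB; apply: le_Ex; first by rewrite lexx ler01.
move=> A; case: (boolP [disjoint _ & _]) => [|_]; last first.
  by rewrite subr0 /f /covers_ind; case: (_ \in _).
rewrite disjoints_subset setCT subset0 => /eqP ->; rewrite subrr /f /covers_ind set0I.
rewrite (_ : _ \in _ = false) //; apply: contraNF covers_proper => h0.
rewrite eqEsubset; apply/andP; split; apply/subsetP => B; first by rewrite inE => /andP[].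
rewrite powersetE => /setIidPl BO; rewrite -BO.
by apply: (covers_superset R (sub0set _) h0).
Qed.

(** Nontriviality makes the covering probability run from 0 to 1. The intermediate value theorem
    bounds its value at the infimum from above; a value below [alpha] would persist on a
    neighbourhood by continuity. *)
Lemma threshold_spec (alpha : R) : 0 < alpha < 1 ->
  0 <= p_thr PP n alpha <= 1 /\ Ex (p_thr PP n alpha) f = alpha.
Proof.
move=> /andP[al0 al1]; rewrite /p_thr /product_threshold; set E : set R := [set p | _]%classic.
have EE p : E p <-> 0 <= p <= 1 /\ alpha <= Ex p f.
  by rewrite /E /= -[product_measure _ _ _]/(mu PP _ _) muE.
have E1 : E 1 by apply/EE; rewrite Ex1_covers (ltW al1) ler01 lexx.
have E0 : lbound E 0 by move=> p /EE[/andP[]].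
have hinf : has_inf E by split; [exists 1 | exists 0].
have t0 : 0 <= inf E by apply: lb_le_inf => //; exists 1.
have t1 : inf E <= 1 by apply: ge_inf => //; exists 0.
rewrite t0 t1; split => //; apply/eqP; rewrite eq_le; apply/andP; split.
  have [||p] := @IVT R (fun p => Ex p f) 0 1 alpha ler01.
  - by apply: continuous_subspaceT => x; exact: Ex_continuous.
  - by rewrite Ex0_covers Ex1_covers min_l ?max_r ?ler01 // !ltW.
  rewrite in_itv /= => /andP[p0 p1] hp; rewrite -[leRHS]hp; apply: Ex_covers_mono => //.
  by apply: ge_inf; [exists 0 | apply/EE; rewrite p0 p1 hp].
rewrite leNgt; apply/negP => lt.
have hnear : \forall t \near inf E, Ex t f < alpha.
  exact: cvgr_lt (@Ex_continuous R T f (inf E)) _ lt.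
have [e /= e0 he] := (nbhs_ballP (inf E) (fun t => Ex t f < alpha)).1 hnear.
suff : inf E + e <= inf E by rewrite gerDl leNgt e0.
apply: lb_le_inf; first by exists 1.
move=> p Ep; rewrite leNgt; apply/negP => pe.
have tp : inf E <= p by apply: ge_inf => //; exists 0.
have : Ex p f < alpha.
  by apply: he; rewrite /ball /= distrC ger0_norm ?subr_ge0 // ltrBlDl.
by move/EE: Ep => [_]; rewrite leNgt => /negP.
Qed.

Lemma threshold_mono (al be : R) : 0 < al -> al <= be -> be < 1 ->
  p_thr PP n al <= p_thr PP n be.
Proof.
move=> al0 albe be1; have [h1 h2] := threshold_spec (alpha := be) ltac:(by rewrite (lt_le_trans al0)).
apply: ge_inf; first by exists 0 => p [/andP[]].
rewrite /= h1; split=> //.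
by rewrite -[product_measure _ _ _]/(mu PP _ _) muE h2.
Qed.

Lemma central_interval_spec (eta p : R) : 0 < eta < 1 / 2 -> central_interval PP n eta p ->
  0 <= p <= 1 /\ eta <= Ex p f <= 1 - eta.
Proof.
move=> /andP[e0 e1] /andP[h1 h2].
have [/andP[a0 a1] ha] := threshold_spec (alpha := eta) ltac:(apply/andP; split; lra).
have [/andP[b0 b1] hb] := threshold_spec (alpha := 1 - eta) ltac:(apply/andP; split; lra).
have p0 := le_trans a0 h1; have p1 := le_trans h2 b1; rewrite p0 p1; split => //.
rewrite -{1}ha -hb; apply/andP; split; exact: Ex_covers_mono.
Qed.

(** A real [sup] is an upper bound only for a set that is nonempty and bounded above; here 1 is a
    bound. *)
Lemma small_le_sup (eta s p : R) : 0 < eta < 1 / 2 -> central_interval PP n eta p ->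
  Ex p (@small_ind R Sigma k PP n s) <=
  sup [set mu PP (small PP n s) p | p in central_interval PP n eta]%classic.
Proof.
move=> he hp; have -> : Ex p (@small_ind R Sigma k PP n s) = mu PP (small PP n s) p.
  by rewrite /mu product_measureE.
apply: sup_upper_bound; last by exists p.
split; first by exists (mu PP (small PP n s) p), p.
exists 1 => _ [q /(central_interval_spec he)[q01 _] <-].
rewrite /mu product_measureE -[leRHS](ExC T q); apply: le_Ex => // A.
by case: (_ \in _).
Qed.

End Thresholds.

(** * Fixed-size and independent sampling *)

Section FixedSize.
Variables (R : realType) (T : finType) (Om : {set T}) (F : {set {set T}}).
Hypothesis Fup : forall A B : {set T}, A \in F -> A \subset B -> B \subset Om -> B \in F.
Let N := #|Om|.
Let a := @fixed_size_prob R T Om F.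
Implicit Types (p t : R) (j m : nat) (A B : {set T}).

Definition layer j := [set A : {set T} in powerset Om | (A \in F) && (#|A| == j)].

Lemma fixed_size_ge0 j : 0 <= a j.
Proof. by rewrite divr_ge0. Qed.

(** Double counting of pairs of a member of [F] of size [j] and a new element: adding the element
    stays in [F], and the enlarged set together with the element determines the pair. *)
Lemma layer_shadow j : (#|layer j| * (N - j) <= #|layer j.+1| * j.+1)%N.
Proof.
pose X := [set Ae : {set T} * T | (Ae.1 \in layer j) && (Ae.2 \in Om :\: Ae.1)].
pose Y := [set Be : {set T} * T | (Be.1 \in layer j.+1) && (Be.2 \in Be.1)].
have cX : #|X| = (#|layer j| * (N - j))%N.
  rewrite -sum1_card (eq_bigl (fun Ae : {set T} * T => (Ae.1 \in layer j) && (Ae.2 \in Om :\: Ae.1))); last first.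
    by move=> Ae; rewrite inE.
  rewrite -(pair_big_dep (fun A => A \in layer j) (fun A e => e \in Om :\: A) (fun _ _ => 1%N)) /=.
  rewrite -sum_nat_const; apply: eq_bigr => A; rewrite inE powersetE => /and3P[AO _ /eqP <-].
  by rewrite sum1_card cardsD (setIidPr AO).
have cY : #|Y| = (#|layer j.+1| * j.+1)%N.
  rewrite -sum1_card (eq_bigl (fun Ae : {set T} * T => (Ae.1 \in layer j.+1) && (Ae.2 \in Ae.1))); last first.
    by move=> Ae; rewrite inE.
  rewrite -(pair_big_dep (fun A => A \in layer j.+1) (fun A e => e \in A) (fun _ _ => 1%N)) /=.
  rewrite -sum_nat_const; apply: eq_bigr => A; rewrite inE powersetE => /and3P[AO _ /eqP cA].
  by rewrite sum1_card cA.
rewrite -cX -cY -(card_in_imset (f := fun Ae : {set T} * T => (Ae.2 |: Ae.1, Ae.2))); last first.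
  move=> [A e] [B e']; rewrite !in_set /= => /andP[_ /andP[eA _]] /andP[_ /andP[eB _]] [AB ee].
  by rewrite -ee in AB eB *; rewrite -(setU1K eA) AB setU1K.
apply/subset_leq_card/subsetP => _ /imsetP[[A e] AeX ->].
rewrite in_set /= [_ \in layer _]in_set powersetE in_setD in AeX.
case/andP: AeX => /and3P[AO AF /eqP cA] /andP[eA eO].
have eAO : e |: A \subset Om by rewrite subUset sub1set eO.
rewrite in_set /= setU11 andbT in_set powersetE eAO (Fup AF) ?subsetUr //=.
by rewrite cardsU1 eA cA.
Qed.

Lemma fixed_size_mono m m' : (m <= m' <= N)%N -> a m <= a m'.
Proof.
case/andP => /subnKC <-; elim: (m' - m)%N => [|d IH]; first by rewrite addn0.
rewrite addnS => h; apply: le_trans (IH (ltnW h)) _; rewrite /a /fixed_size_prob -!/(layer _).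
set j := (m + d)%N in h *.
have b1 : 0 < 'C(N, j)%:R :> R by rewrite ltr0n bin_gt0 ltnW.
have b2 : 0 < 'C(N, j.+1)%:R :> R by rewrite ltr0n bin_gt0.
rewrite ler_pdivrMr // mulrAC ler_pdivlMr //.
have Nj : 0 < (N - j)%N%:R :> R by rewrite ltr0n subn_gt0.
rewrite -(ler_pM2r Nj) -!natrM ler_nat mulnAC.
apply: leq_trans (leq_mul (layer_shadow j) (leqnn _)) _.
rewrite -mulnA mul_bin_left; lia.
Qed.

Lemma layer_prob p j : Ex p (fun A => ((A :&: Om \in F) && (#|A :&: Om| == j))%:R) =
  #|layer j|%:R * (p ^+ j * (1 - p) ^+ (N - j)).
Proof.
transitivity (product_measure Om (layer j) p).
  rewrite product_measureE; apply: eq_Ex => A.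
  by rewrite [in RHS]inE powersetE subsetIr.
rewrite /product_measure (eq_bigl (fun A => A \in layer j)); last first.
  by move=> A; rewrite [A \in layer _]in_set; case: (A \in powerset Om).
rewrite mulr_natl -sumr_const; apply: eq_bigr => A; rewrite inE powersetE.
by case/and3P => AO _ /eqP <-; rewrite cardsD (setIidPr AO).
Qed.

End FixedSize.

(** * The product measure as a binomial mixture of fixed-size models *)

Section Mixtures.
Variables (R : realType) (T : finType) (Om : {set T}) (F : {set {set T}}).
Hypothesis Fup : forall A B : {set T}, A \in F -> A \subset B -> B \subset Om -> B \in F.
Let N := #|Om|.
Let a := @fixed_size_prob R T Om F.
Implicit Types (p t : R) (j m : nat) (A B : {set T}).

Lemma size_prob p j :
  Ex p (fun A => (#|A :&: Om| == j)%:R) = 'C(N, j)%:R * (p ^+ j * (1 - p) ^+ (N - j)).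
Proof.
have := layer_prob Om (powerset Om) p j; rewrite (_ : layer Om (powerset Om) j = [set A : {set T} in powerset Om | #|A| == j]).
  move=> h; rewrite -cards_draws -(eq_card (A := [set A : {set T} in powerset Om | #|A| == j])) -?h.
    by apply: eq_Ex => A; rewrite powersetE subsetIr.
  by move=> A; rewrite !inE.
by apply/setP => A; rewrite !inE; case: (A \subset Om).
Qed.

Lemma layer_size_prob p j : (j <= N)%N ->
  Ex p (fun A => ((A :&: Om \in F) && (#|A :&: Om| == j))%:R) =
  a j * Ex p (fun A => (#|A :&: Om| == j)%:R).
Proof.
move=> jN; rewrite layer_prob size_prob /a /fixed_size_prob -/(layer _ _ _).
by rewrite [RHS]mulrA divfK // pnatr_eq0 -lt0n bin_gt0.
Qed.

Lemma Ex_le_fixed p m : 0 <= p <= 1 -> (m <= N)%N ->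
  Ex p (fun A => (A :&: Om \in F)%:R) <= a m + Ex p (fun A => (m < #|A :&: Om|)%N%:R).
Proof.
move=> hp mN.
apply: (@le_trans _ _ (Ex p (fun A => \sum_(j < m.+1) ((A :&: Om \in F) && (#|A :&: Om| == j))%:R
   + (m < #|A :&: Om|)%N%:R))).
  apply: le_Ex => // A; have [hm|hm] := ltnP; last first.
    case: (boolP (_ \in F)) => hF; last by rewrite addr_ge0 // sumr_ge0.
    by rewrite addr0 (bigD1 (Ordinal (hm : (_ < m.+1)%N))) //= eqxx lerDl sumr_ge0.
  by rewrite (le_trans (_ : _ <= 1)) ?lerDr ?sumr_ge0 //; case: (_ \in F).
rewrite ExD lerD2r Ex_sum.
apply: (@le_trans _ _ (\sum_(j < m.+1) a m * Ex p (fun A => (#|A :&: Om| == j)%:R))).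
  apply: ler_sum => j _; rewrite layer_size_prob; last by rewrite (leq_trans _ mN) // -ltnS.
  by rewrite ler_wpM2r ?Ex_ge0 // (fixed_size_mono R Fup) // mN andbT -ltnS.
rewrite -big_distrr /= ler_piMr ?fixed_size_ge0 // -Ex_sum -[leRHS](ExC T p).
apply: le_Ex => // A; case: (ltnP #|A :&: Om| m.+1) => h.
  rewrite (bigD1 (Ordinal h)) //= eqxx big1 ?addr0 // => i; rewrite -val_eqE /= eq_sym.
  by move=> /negPf ->.
by rewrite big1 // => i _; rewrite gtn_eqF // (leq_trans _ h).
Qed.

Lemma fixed_le_Ex p m : 0 <= p <= 1 -> (m <= N)%N ->
  a m * Ex p (fun A => (m <= #|A :&: Om|)%N%:R) <= Ex p (fun A => (A :&: Om \in F)%:R).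
Proof.
move=> hp mN.
have cN A : (#|A :&: Om| < N.+1)%N by rewrite ltnS subset_leq_card // subsetIr.
apply: (@le_trans _ _ (Ex p (fun A => \sum_(j < N.+1 | (m <= j)%N)
     ((A :&: Om \in F) && (#|A :&: Om| == j))%:R))); last first.
  apply: le_Ex => // A; rewrite big_mkcond (bigD1 (Ordinal (cN A))) //= big1 => [|i].
    by rewrite addr0 eqxx andbT; case: ifP.
  by rewrite -val_eqE /= eq_sym => /negPf ->; rewrite andbF if_same.
rewrite Ex_sum.
apply: (@le_trans _ _ (\sum_(j < N.+1 | (m <= j)%N) a m * Ex p (fun A => (#|A :&: Om| == j)%:R))).
  rewrite -big_distrr /= ler_wpM2l ?fixed_size_ge0 // -Ex_sum; apply: le_Ex => // A.
  case: leqP => h; last by rewrite sumr_ge0.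
  by rewrite (bigD1 (Ordinal (cN A))) //= eqxx lerDl sumr_ge0.
apply: ler_sum => j mj; rewrite layer_size_prob; last by rewrite -ltnS.
by rewrite ler_wpM2r ?Ex_ge0 // (fixed_size_mono R Fup) // mj -ltnS /=.
Qed.

(** The centred size is the sum of the singleton characters, which are orthogonal. *)
Lemma Ex_variance p : Ex p (fun A => (#|A :&: Om|%:R - p * N%:R) ^+ 2) = N%:R * (p * (1 - p)).
Proof.
transitivity (Ex p (fun A => \sum_(i in Om) \sum_(j in Om) chi p [set i] A * chi p [set j] A)).
  apply: eq_Ex => A; rewrite expr2.
  have -> : #|A :&: Om|%:R - p * N%:R = \sum_(i in Om) chi p [set i] A.
    under eq_bigr do rewrite /chi big_set1.
    rewrite big_split /= sumr_const -/N mulNrn mulr_natr; congr (_ - _).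
    rewrite -sum1_card natr_sum big_mkcond [RHS]big_mkcond /=; apply: eq_bigr => i _.
    by rewrite inE andbC; case: (i \in Om); case: (i \in A).
  by rewrite big_distrl /=; apply: eq_bigr => i _; rewrite big_distrr.
rewrite Ex_sum mulr_natl -sumr_const; apply: eq_bigr => i iO.
rewrite Ex_sum (bigD1 i) //= Ex_chi2 eqxx mul1r cards1 expr1 big1 ?addr0 // => j /andP[_ ji].
rewrite Ex_chi2 (_ : _ == _ = false) ?mul0r //.
by apply: contraNF ji => /eqP/set1_inj ->.
Qed.

Lemma chebyshev p t (E : {set T} -> bool) : 0 <= p <= 1 -> 0 < t ->
  (forall A, E A -> t <= `|#|A :&: Om|%:R - p * N%:R|) ->
  Ex p (fun A => (E A)%:R) <= p * N%:R / t ^+ 2.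
Proof.
move=> hp t0 h; rewrite ler_pdivlMr ?exprn_gt0 // mulrC -ExZ.
apply: (@le_trans _ _ (N%:R * (p * (1 - p)))); last first.
  by rewrite mulrC ler_wpM2r //; have /andP[p0 p1] := hp; rewrite ler_piMr // gerBl.
rewrite -Ex_variance; apply: le_Ex => // A; case: (boolP (E A)) => [/h hA|_].
  by rewrite mulr1 -[leRHS]real_normK ?num_real // lerXn2r ?nnegrE // ltW.
by rewrite mulr0 sqr_ge0.
Qed.

End Mixtures.

(** * Distinct elements of independent samples *)

Section IndependentSampling.
Variables (R : realType) (T : finType) (Om : {set T}) (F : {set {set T}}).
Hypothesis Fup : forall A B : {set T}, A \in F -> A \subset B -> B \subset Om -> B \in F.
Let N := #|Om|.
Let a := @fixed_size_prob R T Om F.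
Variable m : nat.
Implicit Types (j : nat) (A B : {set T}) (f : {ffun 'I_m -> T}).

Definition range_set f := f @: [set: 'I_m].
Definition samples_onto B := [set f : {ffun 'I_m -> T} | range_set f == B].

(** A bijection of [B] with [B'] transports the samples. So, given the number of distinct elements,
    their set is uniform, and independent sampling is a mixture of fixed-size models. *)
Lemma samples_onto_le B B' : #|B| = #|B'| -> (#|samples_onto B| <= #|samples_onto B'|)%N.
Proof.
move=> BB'; pose h x := nth x (enum B') (index x (enum B)).
have hidx x : x \in B -> (index x (enum B) < size (enum B'))%N.
  by move=> xB; rewrite -cardE -BB' cardE index_mem mem_enum.
have hB' x : x \in B -> h x \in B' by move=> /hidx xi; rewrite -mem_enum mem_nth.
have hinj : {in B &, injective h}.
  move=> x y xB yB; rewrite /h (set_nth_default x y) ?hidx // => /eqP.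
  rewrite nth_uniq ?enum_uniq ?hidx // => /eqP e.
  by rewrite -(nth_index x (s := enum B) (x := x)) ?mem_enum // e nth_index ?mem_enum.
have hB : h @: B = B'.
  apply/eqP; rewrite eqEcard card_in_imset // BB' leqnn andbT.
  by apply/subsetP => _ /imsetP[x xB ->]; exact: hB'.
have fB f i : f \in samples_onto B -> f i \in B.
  by rewrite inE => /eqP <-; rewrite imset_f // inE.
rewrite -(card_in_imset (f := fun f : {ffun 'I_m -> T} => [ffun i => h (f i)])); last first.
  move=> f g fS gS /ffunP e; apply/ffunP => i; have := e i; rewrite !ffunE.
  by apply: hinj; apply: fB.
apply/subset_leq_card/subsetP => _ /imsetP[f fS ->]; rewrite inE -hB.
have := fS; rewrite inE => /eqP <-; rewrite /range_set -imset_comp.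
by apply/eqP/eq_imset => i; rewrite ffunE.
Qed.

Lemma samples_onto_card B B' : #|B| = #|B'| -> #|samples_onto B| = #|samples_onto B'|.
Proof. by move=> h; apply/eqP; rewrite eqn_leq !samples_onto_le. Qed.

Lemma count_samples (H : {set {set T}}) : (forall A, A \in H -> A \subset Om) ->
  #|[set f in ffun_on Om | range_set f \in H]|%N = (\sum_(B in H) #|samples_onto B|)%N.
Proof.
move=> HO; rewrite -sum1_card (partition_big range_set (mem H)) /=; last first.
  by move=> f; rewrite inE => /andP[].
apply: eq_bigr => B BH; rewrite -sum1_card; apply: eq_bigl => f; rewrite !inE.
apply/andP/idP => [[]//|/eqP fB]; rewrite fB BH eqxx andbT; split => //.
apply/ffun_onP => i; apply: (subsetP (HO _ BH)).
by rewrite -fB imset_f // inE.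
Qed.

Lemma card_samples : #|[set f : {ffun 'I_m -> T} | f \in ffun_on Om]| = (N ^ m)%N.
Proof. by rewrite cardsE card_ffun_on card_ord. Qed.

Definition size_weight j : R :=
  #|[set f : {ffun 'I_m -> T} | (f \in ffun_on Om) && (#|range_set f| == j)]|%:R / (N ^ m)%:R.

Lemma range_sub f : f \in ffun_on Om -> range_set f \subset Om.
Proof. by move/ffun_onP => h; apply/subsetP => _ /imsetP[i _ ->]. Qed.

Lemma layer_size_weight j : (j <= N)%N ->
  #|[set f : {ffun 'I_m -> T} | (f \in ffun_on Om) && (range_set f \in layer Om F j)]|%:R / (N ^ m)%:R
  = a j * size_weight j.
Proof.
move=> jN; rewrite count_samples => [|A]; last by rewrite inE powersetE => /andP[].
have [B0 B0s] : exists B0 : {set T}, B0 \in [set A : {set T} | A \subset Om & #|A| == j].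
  by apply/set0Pn; rewrite -card_gt0 cards_draws bin_gt0.
have cB0 : #|B0| = j by move: B0s; rewrite inE => /andP[_ /eqP].
have -> : (\sum_(B in layer Om F j) #|samples_onto B| = #|layer Om F j| * #|samples_onto B0|)%N.
  rewrite -sum_nat_const; apply: eq_bigr => B; rewrite inE => /and3P[_ _ /eqP cB].
  by apply: samples_onto_card; rewrite cB cB0.
rewrite /size_weight (_ : [set f | _] = [set f in ffun_on Om |
   range_set f \in [set A : {set T} | A \subset Om & #|A| == j]]); last first.
  apply/setP => f; rewrite !in_set; case: (boolP (f \in ffun_on Om)) => //= fO.
  by rewrite range_sub.
rewrite count_samples => [|A]; last by rewrite inE => /andP[].
rewrite (eq_bigr (fun=> #|samples_onto B0|)); last first.
  by move=> B; rewrite inE => /andP[_ /eqP cB]; apply: samples_onto_card; rewrite cB cB0.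
rewrite sum_nat_const cards_draws !natrM /a /fixed_size_prob -/(layer _ _ _).
by rewrite mulrA mulrA divfK ?pnatr_eq0 -?lt0n ?bin_gt0.
Qed.

Lemma sum_size_weight : (0 < N)%N -> \sum_(j < N.+1) size_weight j = 1.
Proof.
move=> N0; rewrite -big_distrl /= -natr_sum.
have -> : (\sum_(j < N.+1) #|[set f : {ffun 'I_m -> T} | (f \in ffun_on Om) && (#|range_set f| == j)]|
   = N ^ m)%N.
  rewrite -card_samples -sum1_card.
  rewrite (partition_big (fun f => inord #|range_set f| : 'I_N.+1) predT) //=.
  apply: eq_bigr => j _; rewrite -sum1_card; apply: eq_bigl => f; rewrite !in_set.
  case: (boolP (f \in ffun_on Om)) => //= fO; rewrite -val_eqE /= inordK // ltnS.
  by rewrite subset_leq_card // range_sub.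
by rewrite divff // pnatr_eq0 -lt0n expn_gt0 N0.
Qed.

Lemma independent_mixture :
  independent_prob R Om F m = \sum_(j < N.+1) a j * size_weight j.
Proof.
rewrite /independent_prob -/N; under [RHS]eq_bigr => j _ do rewrite -layer_size_weight -1?ltnS //.
rewrite -big_distrl /= -natr_sum; congr (_%:R / _).
rewrite -sum1_card (partition_big (fun f => inord #|range_set f| : 'I_N.+1) predT) //=.
apply: eq_bigr => j _; rewrite -sum1_card; apply: eq_bigl => f; rewrite !in_set.
case: (boolP (f \in ffun_on Om)) => //= fO; rewrite range_sub //= -/(range_set f).
by rewrite -val_eqE /= inordK // ltnS subset_leq_card // range_sub.
Qed.

Lemma size_weight_ge0 j : 0 <= size_weight j.
Proof. by rewrite divr_ge0. Qed.

Lemma size_weight_gt j : (m < j)%N -> size_weight j = 0.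
Proof.
move=> mj; rewrite /size_weight eq_card0 ?mul0r // => f; rewrite inE.
apply/negP => /andP[_ /eqP h]; have := leq_imset_card f [set: 'I_m].
by rewrite -/(range_set f) h cardsT card_ord leqNgt mj.
Qed.

Lemma independent_le_fixed : (0 < N)%N -> (m <= N)%N -> independent_prob R Om F m <= a m.
Proof.
move=> N0 mN; rewrite independent_mixture -[leRHS]mulr1 -(sum_size_weight N0) big_distrr /=.
apply: ler_sum => j _; have [mj|jm] := ltnP m j; first by rewrite size_weight_gt // !mulr0.
by rewrite ler_wpM2r ?size_weight_ge0 // (fixed_size_mono R Fup) // jm.
Qed.

Lemma fixed_le_independent m0 : (0 < N)%N -> (m0 <= N)%N ->
  a m0 * (1 - \sum_(j < N.+1 | (j < m0)%N) size_weight j) <= independent_prob R Om F m.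
Proof.
move=> N0 mN; have := sum_size_weight N0; rewrite (bigID (fun j : 'I_N.+1 => (j < m0)%N)) /=.
move/esym/eqP; rewrite addrC -subr_eq => /eqP ->.
rewrite independent_mixture big_distrr /= big_mkcond; apply: ler_sum => j _; case: ltnP => mj /=.
  by rewrite mulr_ge0 ?size_weight_ge0 ?fixed_size_ge0.
by rewrite ler_wpM2r ?size_weight_ge0 // (fixed_size_mono R Fup) // mj -ltnS /=.
Qed.

(** Overwriting the value at [j] arbitrarily loses nothing, since the old value can still be read at
    [i]. *)
Lemma collision_count (i j : 'I_m) : i != j ->
  (N * #|[set f : {ffun 'I_m -> T} | (f \in ffun_on Om) && (f i == f j)]| <= N ^ m)%N.
Proof.
move=> ij; rewrite -card_samples mulnC -cardsX.
pose upd (fx : {ffun 'I_m -> T} * T) := [ffun l => if l == j then fx.2 else fx.1 l].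
rewrite -(card_in_imset (f := upd)) => [|[f x] [g y]].
  apply/subset_leq_card/subsetP => _ /imsetP[[f x] + ->].
  rewrite in_setX in_set /= => /andP[/andP[/ffun_onP fO _] xO].
  by rewrite in_set; apply/ffun_onP => l; rewrite ffunE /=; case: ifP.
rewrite !in_setX !in_set /= => /andP[/andP[_ /eqP fij] _] /andP[/andP[_ /eqP gij] _] /ffunP e.
have exy : x = y by have := e j; rewrite !ffunE eqxx.
rewrite exy; congr (_, _); apply/ffunP => l.
have hl l' : l' != j -> f l' = g l'.
  by move=> lj; have := e l'; rewrite !ffunE (negPf lj).
by have [->|/hl//] := eqVneq l j; rewrite -fij -gij hl.
Qed.

(** [J] collects the first occurrences of values; every other position collides with an earlier
    one. *)
Lemma range_defect f : (m - #|range_set f| <=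
  \sum_(ij : 'I_m * 'I_m | ij.1 != ij.2) (f ij.1 == f ij.2))%N.
Proof.
pose J := [set j : 'I_m | [forall i : 'I_m, (i < j)%N ==> (f i != f j)]].
have Jinj : {in J &, injective f}.
  move=> i j; rewrite !inE => /forallP hi /forallP hj e; apply: val_inj; apply/eqP.
  have := hi j; have := hj i; rewrite e eqxx !implybF -!leqNgt => h1 h2.
  by rewrite eqn_leq h1 h2.
have cJ : (#|J| <= #|range_set f|)%N.
  by rewrite -(card_in_imset Jinj) subset_leq_card // imsetS // subsetT.
apply: (@leq_trans #|~: J|).
  by rewrite -[X in (X - _)%N](card_ord m) -(cardsC J) leq_subLR leq_add2r.
rewrite -sum1_card; apply: (@leq_trans (\sum_(j in ~: J) \sum_(i : 'I_m | i != j) (f i == f j))).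
  apply: leq_sum => j; rewrite !inE negb_forall => /existsP[i].
  rewrite negb_imply negbK => /andP[ij /eqP fij].
  rewrite (bigD1 i) /=; last by apply: contraTneq ij => ->; rewrite ltnn.
  by rewrite fij eqxx.
apply: (@leq_trans (\sum_(j : 'I_m) \sum_(i : 'I_m | i != j) (f i == f j))).
  by rewrite [leqRHS](bigID (fun j : 'I_m => j \in ~: J)) /= leq_addr.
rewrite [leqRHS](eq_bigl (fun ij : 'I_m * 'I_m => true && (ij.2 != ij.1))); last first.
  by move=> ij; rewrite eq_sym.
rewrite -(pair_big_dep predT (fun i j : 'I_m => j != i) (fun i j : 'I_m => (f i == f j) : nat)) /=.
by apply: leq_sum => i _; apply: leq_sum => j _; rewrite eq_sym.
Qed.

Lemma sum_range_defect :
  (\sum_(f in ffun_on Om) (m - #|range_set f|) * N <= m ^ 2 * N ^ m)%N.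
Proof.
apply: (@leq_trans (\sum_(ij : 'I_m * 'I_m | ij.1 != ij.2)
    N * #|[set f : {ffun 'I_m -> T} | (f \in ffun_on Om) && (f ij.1 == f ij.2)]|)).
  rewrite -big_distrr /= -big_distrl /= mulnC leq_mul2l; apply/orP; right.
  apply: (@leq_trans (\sum_(f : {ffun 'I_m -> T} | f \in ffun_on Om)
     \sum_(ij : 'I_m * 'I_m | ij.1 != ij.2) (f ij.1 == f ij.2))).
    by apply: leq_sum => f _; exact: range_defect.
  rewrite exchange_big /=; apply: leq_sum => ij _.
  rewrite -sum1_card [leqRHS](eq_bigl (fun f : {ffun 'I_m -> T} => (f \in ffun_on Om) && (f ij.1 == f ij.2))).
    by rewrite [leqRHS]big_mkcondr.
  by move=> f; rewrite in_set.
apply: (@leq_trans (\sum_(ij : 'I_m * 'I_m | ij.1 != ij.2) N ^ m)).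
  by apply: leq_sum => ij; exact: collision_count.
rewrite sum_nat_const leq_mul2r; apply/orP; right.
by apply: leq_trans (max_card _) _; rewrite card_prod card_ord mulnn.
Qed.

(** Markov's inequality for the number of repeated draws: fewer than [m0] distinct values means at
    least [u.+1] repetitions. *)
Lemma small_range_weight (m0 u : nat) : (0 < N)%N -> (m0 + u <= m)%N ->
  (\sum_(j < N.+1 | (j < m0)%N) size_weight j) * (u.+1%:R * N%:R) <= m%:R ^+ 2.
Proof.
move=> N0 hm; have NR : 0 < (N ^ m)%:R :> R by rewrite ltr0n expn_gt0 N0.
rewrite -big_distrl /= -natr_sum mulrAC ler_pdivrMr // -!natrM -natrX -natrM ler_nat.
apply: leq_trans sum_range_defect; rewrite mulnA -big_distrl /= leq_mul2r; apply/orP; right.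
rewrite big_distrl /=.
rewrite [leqRHS](partition_big (fun f => inord #|range_set f| : 'I_N.+1) predT) //=.
rewrite [leqLHS]big_mkcond; apply: leq_sum => j _; case: ifP => // jm.
rewrite -sum_nat_const big_mkcond [leqRHS]big_mkcond /=; apply: leq_sum => f _.
rewrite in_set; case: (boolP (f \in ffun_on Om)) => //= fO.
rewrite -val_eqE /= inordK ?ltnS ?subset_leq_card ?range_sub //.
case: eqP => // ->; lia.
Qed.

End IndependentSampling.

Local Open Scope classical_set_scope.
Local Open Scope ring_scope.

(** * The window in the three models *)

Section WidthBound.
Variables (R : realType) (Sigma : finType) (k : nat) (PP : {set {set k.-tuple Sigma}}).
Variables (Gamma : {group {perm Sigma}}) (eta : R).
Hypotheses (heta : 0 < eta < 1 / 2) (hsys : symmetric_system PP Gamma).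
Hypotheses (hpower : power_replaceable R PP) (hlinear : linear_scale PP eta).
Hypothesis hsmall : few_small_covers PP eta.

Lemma near_ln_ge (c M : R) : 0 < c -> \forall n \near \oo, M <= c * ln n%:R.
Proof.
move=> c0; near=> n; have hn : expR (M / c) <= n%:R by near: n; exact: nbhs_infty_ger.
rewrite mulrC -ler_pdivrMr // -[leLHS]expRK ler_ln // ?posrE ?expR_gt0 //.
exact: lt_le_trans (expR_gt0 _) hn.
Unshelve. all: by end_near. Qed.

Lemma mul_expRN_le (A B K : R) : 0 < B -> 0 <= K -> A / B <= K -> A * expR (- K) <= B.
Proof.
move=> B0 K0 h; rewrite expRN ler_pdivrMr ?expR_gt0 //.
move: h; rewrite ler_pdivrMr // mulrC => /le_trans; apply.
rewrite ler_wpM2l ?(ltW B0) //; apply: le_trans (expR_ge1Dx K); lra.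
Qed.

Lemma width_bound : exists2 C : R, 0 < C &
  \forall n \near \oo, width PP eta n <= C * (n%:R / ln n%:R).
Proof.
have [eta0 eta1] := andP heta.
have he1 : 0 < eta < 1 by apply/andP; split; lra.
have he2 : 0 < 1 - eta < 1 by apply/andP; split; lra.
have [cl [C [cl0 C0 hlin]]] := hlinear.
have [cs [Cs [b [gamma [cs0 Cs0 b0 gamma1 hpow]]]]] := hpower.
have k2 := system_k hsys; have PP0 := system_family hsys.
pose D := (Num.truncn (8 / eta ^+ 2 + 1)).+1.
have D_large : 8 / eta ^+ 2 + 1 <= D%:R.
  by apply/ltW/(andP (Num.Theory.truncn_itv _)).2; rewrite addr_ge0 // divr_ge0 // sqr_ge0.
have D0 : 0 < D%:R :> R by rewrite ltr0n.
pose C3 := (Num.truncn (2 * k%:R ^+ 2 * D%:R * C)).+1.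
have C3_large : 2 * k%:R ^+ 2 * D%:R * C <= C3%:R.
  by apply/ltW/(andP (Num.Theory.truncn_itv _)).2; rewrite !mulr_ge0 ?exprn_ge0 // ltW.
have gamma0 : 0 < gamma by apply: lt_le_trans gamma1.
pose G := (Num.truncn gamma).+1.
have gammaG : gamma <= G%:R by apply/ltW/(andP (Num.Theory.truncn_itv (ltW gamma0))).2.
pose E0 := (4 + 7 * D)%N; pose E1 := (E0 + D)%N.
pose E4 := (2 * E1 + 3 + C3)%N; pose E7 := (G * (E4 + 1))%N.
pose m := (4 * E1 + 10 + E7 + E4)%N.
have m0 : 0 < m%:R :> R by rewrite ltr0n /m !addnS.
have A00 : 0 < E0.+1%:R :> R by rewrite ltr0n.
have [c1 c10 hsm] := hsmall A00 D0.
(* [m] was fixed through [D], [C3] and [G] before [c]. The bound [c1] makes (iv) applicable with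
   [A0 = E0.+1] and [B0 = D]; the other one makes both [n^-1] and [n^-b] at most [z ^+ m]. *)
pose c := Num.min c1 (Num.min 1 b / m%:R).
have c0 : 0 < c by rewrite lt_min c10 divr_gt0 // lt_min ltr01 b0.
have cm : m%:R * c <= Num.min 1 b.
  by rewrite mulrC -ler_pdivlMr // ge_min lexx orbT.
exists (8 * C / c); first by rewrite divr_gt0 // mulr_gt0.
pose c00 := boost_const eta.
have c000 : 0 < c00 / 2 by rewrite divr_gt0 // exprn_gt0 // divr_gt0 // divr_gt0 // exprn_gt0.
have [c40 c4] : 0 < c00 / 4 /\ c00 / 4 < c00 / 2 by split; lra.
pose c6 := power_const Sigma k C D.
have c60 : 0 < c6.
  have k0 : 0 < k%:R :> R by rewrite ltr0n (leq_trans _ k2).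
  have S0 : 0 < #|Sigma|%:R + 1 :> R by rewrite ltr_wpDl.
  by rewrite invr_gt0 !mulr_gt0 ?exprn_gt0.
pose c7 := cs * c6 ^+ G.
have c70 : 0 < c7 by rewrite mulr_gt0 // exprn_gt0.
have near_z (A B : R) : 0 < B -> \forall n \near \oo, A * expR (- (c * ln n%:R)) <= B.
  move=> B0; near=> n; apply: mul_expRN_le => //.
    by near: n; exact: near_ln_ge.
  by near: n; exact: near_ln_ge.
near=> n.
rewrite leNgt; apply/negP => hW.
pose K := c * ln n%:R; pose z := expR (- K).
have n0 : (1 < n)%N by near: n; exact: nbhs_infty_gt.
have n0R : 0 < n%:R :> R by rewrite ltr0n ltnW.
have kn : (2 * k <= n)%N by near: n; exact: nbhs_infty_ge.
have K1 : 1 <= K by rewrite /K; near: n; exact: near_ln_ge.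
have ln0 : 0 < ln n%:R :> R by rewrite ln_gt0 // ltr1n.
have z0 : 0 < z := expR_gt0 _.
have Kz : expR K * z = 1 by rewrite -expRD subrr expR0.
have zX j : z ^+ j = expR (- (j%:R * K)) by rewrite /z -expRM_natl mulrN.
have nm (e : R) : Num.min 1 b <= e -> n%:R `^ (- e) <= z ^+ m.
  move=> he; rewrite /powR gt_eqF // zX ler_expR mulNr lerN2 /K mulrA.
  by rewrite ler_wpM2r ?(ltW ln0) // (le_trans cm).
have n_large' : n%:R^-1 <= z ^+ m.
  by rewrite -powR_inv1 ?nm ?ge_min ?lexx //.
have n_large_b : n%:R `^ (- b) <= z ^+ m by rewrite nm // ge_min lexx orbT.
have [cne cnp] : covers PP n != finset.set0 /\ covers PP n != powerset (constraints PP n).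
  by near: n; exact: (system_nontrivial hsys).
have z1 : z <= 1 by rewrite -expR0 ler_expR oppr_le0 (le_trans ler01).
have n_large : n%:R^-1 <= z ^+ (E0 + 2).
  by apply: le_trans n_large' _; rewrite ler_wiXn2l ?(ltW z0) // exponent_bound0.
have z_le (A B : R) : A * expR (- (c * ln n%:R)) <= B -> A * z <= B by [].
have z_eta : z <= eta / 2.
  by rewrite -[z]mul1r; apply: z_le; near: n; apply: near_z; rewrite divr_gt0.
have z_c0 : (1 + 4 * k%:R ^+ 2 * C * D%:R) * z <= c00 / 2.
  by apply: z_le; near: n; exact: near_z.
have z_Cs : Cs * z <= c6 by apply: z_le; near: n; exact: near_z.
have z_c6 : c6 * z <= 1 by apply: z_le; near: n; exact: near_z.
have z_c7 : 2 * k%:R ^+ 2 * D%:R * z <= c7 / 2.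
  by apply: z_le; near: n; apply: near_z; rewrite divr_gt0.
have z_c7' : 2 * z <= C * c7 by apply: z_le; near: n; apply: near_z; rewrite mulr_gt0.
have z_total : (4 * k%:R ^+ 4 * C * D%:R ^+ 2 + 3 + C3%:R) * z < c00 / 2.
  apply: (@le_lt_trans _ _ (c00 / 4)).
    by apply: z_le; near: n; exact: near_z.
  exact: c4.
have hpow' (S : {set {ffun 'I_n -> Sigma}}) (e : R) : (1 <= n)%N ->
    e <= rho_derivative R PP S -> Cs * n%:R `^ (- b) <= e -> cs * e `^ gamma <= rho R PP S.
  by move=> h1 h2 h3; apply: hpow.
have [/andP[a0 a1] _] := threshold_spec cne cnp he1.
have [/andP[a0' a1'] _] := threshold_spec cne cnp he2.
have N0 : 0 < (num_constraints PP n)%:R :> R.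
  by rewrite ltr0n muln_gt0 card_gt0 PP0 bin_gt0 (leq_trans _ kn) // leq_pmull.
have W0 : 0 <= 8 * C / c * (n%:R / ln n%:R).
  by rewrite mulr_ge0 // divr_ge0 // ?mulr_ge0 // ltW.
have hwindow p : p_thr PP n eta <= p <= p_thr PP n (1 - eta) ->
    [/\ eta <= Ex p (@covers_ind Sigma k PP n R) <= 1 - eta,
      p * (num_constraints PP n)%:R <= C * n%:R
    & Ex p (@small_ind R Sigma k PP n (D%:R * K)) <= z ^+ E0.+1].
  move=> hp; have hp' : central_interval PP n eta p by [].
  have [_ h1] := central_interval_spec cne cnp heta hp'; split => //.
    have : forall p, central_interval PP n eta p ->
      cl * n%:R <= p * (num_constraints PP n)%:R <= C * n%:R by near: n.
    by move=> /(_ p hp')/andP[].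
  apply: le_trans (small_le_sup cne cnp _ heta hp') _; rewrite zX; apply: hsm.
  by rewrite K1 /K ler_wpM2r ?(ltW ln0) // ge_min lexx.
apply: (no_wide_window k2 kn (system_permute hsys) PP0 eta0 C0 K1 z0 Kz D_large
  z_eta z_c0 n_large cs0 gammaG hpow' C3_large z_Cs z_c6 z_c7 z_c7' n_large' n_large_b z_total
  a0 _ a1' hwindow).
  by have := le_lt_trans W0 hW; rewrite /width pmulr_rgt0 // subr_gt0.
apply: ltW; apply: le_lt_trans hW; rewrite le_eqVlt /K; apply/orP; left; apply/eqP.
by field; rewrite !gt_eqF.
Unshelve. all: by end_near. Qed.

End WidthBound.

Lemma nat_minP (P : pred nat) m : P m -> P (nat_min P) /\ (nat_min P <= m)%N.
Proof.
move=> Pm; rewrite /nat_min; case: pselect => [ex|[]]; last by exists m.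
by case: ex_minnP => i Pi h; split => //; apply: h.
Qed.

(** * Transfer of the thresholds to the two sampling models *)

Section SamplingThresholds.
Variables (R : realType) (Sigma : finType) (k : nat) (PP : {set {set k.-tuple Sigma}}) (n : nat).
Let Om := constraints PP n.
Let F := covers PP n.
Let N : R := (num_constraints PP n)%:R.
Hypothesis covers_nonempty : covers PP n != finset.set0.
Hypothesis covers_proper : covers PP n != powerset (constraints PP n).
Variables (eta t : R) (u : nat).
Hypotheses (heta : 0 < eta < 1 / 2) (t0 : 0 < t).
Let p0 := p_thr PP n (eta / 4).
Let p1 := p_thr PP n (1 - eta / 4).
Hypothesis ht : p1 * N / t ^+ 2 <= eta / 4.
Hypothesis hN : N * p1 + t + 1 <= N.
Let a := @fixed_size_prob R _ Om F.
Let ai := @independent_prob R _ Om F.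
Let M := (Num.truncn (N * p1 + t)).+1.

Let Fup (A B : {set {set 'I_n} * {set k.-tuple Sigma}}) :
  A \in F -> A \subset B -> B \subset Om -> B \in F.
Proof.
move=> AF AB BO; have BE : B = B :&: Om by apply/esym/setIidPl.
by rewrite BE; apply: (covers_superset R (D := A)) => //; rewrite -BE.
Qed.

Let cO : #|Om| = num_constraints PP n.
Proof. exact: card_constraints. Qed.

Let he : [/\ 0 < eta / 4, eta / 4 < 1 & 0 < 1 - eta / 4 < 1].
Proof. by case/andP: heta => *; split; rewrite ?(andP _); lra. Qed.

Let spec0 : 0 <= p0 <= 1 /\ Ex p0 (@covers_ind Sigma k PP n R) = eta / 4.
Proof. by case: he => h1 h2 _; apply: threshold_spec => //; rewrite h1. Qed.

Let spec1 : 0 <= p1 <= 1 /\ Ex p1 (@covers_ind Sigma k PP n R) = 1 - eta / 4.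
Proof. by case: he => _ _ h; apply: threshold_spec. Qed.

Let p01 : p0 <= p1.
Proof.
case/andP: heta => h1 h2; apply: threshold_mono => //; lra.
Qed.

Let N0 : 0 <= N. Proof. by []. Qed.

Let q0 : 0 <= N * p1 + t.
Proof. by case: spec1 => /andP[h _] _; rewrite addr_ge0 ?mulr_ge0 // ltW. Qed.

Let M_lb : N * p1 + t < M%:R.
Proof. by case/andP: (Num.Theory.truncn_itv q0). Qed.

Let M_ub : M%:R <= N * p1 + t + 1.
Proof. by rewrite /M -natr1 lerD2r; case/andP: (Num.Theory.truncn_itv q0). Qed.

Let MN : (M <= #|Om|)%N.
Proof. by rewrite cO -(ler_nat R); apply: le_trans hN. Qed.

Lemma fixed_upper : 1 - eta / 2 <= a M.
Proof.
have [hp1 hE] := spec1; have := Ex_le_fixed Fup hp1 MN; rewrite -/a -[X in X <= _]/(Ex p1 (@covers_ind Sigma k PP n R)) hE.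
have : Ex p1 (fun A : {set {set 'I_n} * {set k.-tuple Sigma}} => (M < #|A :&: Om|)%N%:R) <= eta / 4.
  apply: le_trans ht; have := @chebyshev R _ Om p1 t (fun A => (M < #|A :&: Om|)%N) hp1 t0.
  rewrite cO -/N; apply => A; rewrite -(ltr_nat R) => hA.
  apply: le_trans (ler_norm _); have := M_lb; rewrite mulrC => h; lra.
by move: (Ex p1 _) (a M) => x y *; lra.
Qed.

(** The reason for level [eta / 4]: at a smaller [m] the product measure at [p0] would exceed size
    [m] with probability at least [1 - eta / 4], so [eta * (1 - eta / 4) <= eta / 4], which is false
    for [eta < 1 / 2]. *)
Lemma fixed_lower m : (m <= #|Om|)%N -> eta <= a m -> N * p0 - t <= m%:R.
Proof.
move=> mN ham; rewrite leNgt; apply/negP => hm.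
have [hp0 hE] := spec0.
have := fixed_le_Ex Fup hp0 mN; rewrite -/a -[X in _ <= X]/(Ex p0 (@covers_ind Sigma k PP n R)) hE.
have h1 : Ex p0 (fun A : {set {set 'I_n} * {set k.-tuple Sigma}} => (#|A :&: Om| < m)%N%:R) <= eta / 4.
  apply: (@le_trans _ _ (p0 * N / t ^+ 2)); last first.
    by apply: le_trans ht; rewrite ler_wpM2r ?invr_ge0 ?sqr_ge0 // ler_wpM2r.
  have := @chebyshev R _ Om p0 t (fun A => (#|A :&: Om| < m)%N) hp0 t0.
  rewrite cO -/N; apply => A; rewrite -(ltr_nat R) => hA.
  rewrite distrC; apply: le_trans (ler_norm _); move: hm; rewrite mulrC; lra.
have h2 : 1 - eta / 4 <= Ex p0 (fun A : {set {set 'I_n} * {set k.-tuple Sigma}} => (m <= #|A :&: Om|)%N%:R).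
  apply: (@le_trans _ _ (1 - Ex p0 (fun A : {set {set 'I_n} * {set k.-tuple Sigma}} => (#|A :&: Om| < m)%N%:R))).
    by rewrite lerD2l lerN2.
  rewrite -[X in X - _](ExC ({set 'I_n} * {set k.-tuple Sigma})%type p0) -ExB; apply: le_Ex => // A.
  by case: ltnP => _; rewrite ?subrr ?subr0.
have [e0 e1] := andP heta.
have := ler_pM (ltW e0) (_ : 0 <= 1 - eta / 4) ham h2.
move=> /(_ ltac:(lra)) h3 h4; have := le_trans h3 h4; nra.
Qed.

Lemma width_fixed_bound : 0 <= width_fixed PP eta n <= N * (p1 - p0) + 2 * t + 1.
Proof.
have [e0 e1] := andP heta; rewrite /width_fixed /fixed_size_threshold -/Om -/F.
have hM : 1 - eta <= a M by apply: le_trans fixed_upper; lra.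
have [h1 h1M] := @nat_minP (fun m => 1 - eta <= a m) M hM.
have he' : eta <= a (nat_min (fun m => 1 - eta <= a m)) by apply: le_trans h1; lra.
have [h2 h2m] := @nat_minP (fun m => eta <= a m) _ he'.
have h3 := fixed_lower (leq_trans h2m (leq_trans h1M MN)) h2.
rewrite subr_ge0 ler_nat h2m /=.
have := M_ub; move: h1M; rewrite -(ler_nat R) -/a.
by move: (nat_min _)%:R (nat_min _)%:R h3 => x y *; lra.
Qed.

Hypothesis hu : u%:R <= t.
Hypothesis hcoll : (M + u)%N%:R ^+ 2 <= eta / 4 * (u.+1%:R * N).

(** The [u] additional draws compensate for repetitions: fewer than [M] distinct elements occur with
    probability at most [eta / 4], and [(1 - eta / 2) * (1 - eta / 4) >= 1 - eta]. *)
Lemma width_indep_bound : 0 <= width_indep PP eta n <= N * (p1 - p0) + 3 * t + 1.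
Proof.
have [e0 e1] := andP heta; rewrite /width_indep /independent_threshold -/Om -/F.
have O0 : (0 < #|Om|)%N by apply: leq_trans MN.
have hM : 1 - eta <= ai (M + u)%N.
  apply: le_trans (fixed_le_independent R Fup (M + u) O0 MN).
  have := @small_range_weight R _ Om _ _ _ O0 (leqnn (M + u)).
  rewrite cO -/N; set S := \sum_(j < _ | _) _ => hS.
  have uN : 0 < u.+1%:R * N by rewrite mulr_gt0 // /N -cO ltr0n.
  have {hS}hS : S <= eta / 4.
    by rewrite -(ler_pM2r uN) (le_trans hS).
  have := fixed_upper; rewrite -/a => h.
  apply: (@le_trans _ _ ((1 - eta / 2) * (1 - eta / 4))); first by nra.
  by apply: ler_pM => //; lra.
have [h1 h1M] := @nat_minP (fun m => 1 - eta <= ai m) _ hM.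
have he' : eta <= ai (nat_min (fun m => 1 - eta <= ai m)) by apply: le_trans h1; lra.
have [h2 h2m] := @nat_minP (fun m => eta <= ai m) _ he'.
rewrite subr_ge0 ler_nat h2m /=.
have h3 : N * p0 - t <= (nat_min (fun m => eta <= ai m))%:R.
  (* The comparison with the fixed-size model needs at most [#|Om|] draws; beyond that the bound is
     trivial. *)
  have [hle|hgt] := leqP (nat_min (fun m => eta <= ai m)) #|Om|.
    by apply: fixed_lower => //; apply: le_trans h2 (independent_le_fixed R Fup O0 hle).
  apply: (@le_trans _ _ N); last by rewrite /N -cO ler_nat ltnW.
  have [/andP[_ hp] _] := spec0.
  by rewrite lerBlDr (le_trans (_ : _ <= N)) ?ler_piMr // lerDl ltW.
have := hu; have := M_ub; move: h1M; rewrite -(ler_nat R) natrD -/ai.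
by move: (nat_min _)%:R (nat_min _)%:R h3 => x y *; lra.
Qed.

End SamplingThresholds.

(** From [expR (x / 3) >= x / 3] comes [(ln n / 3) ^ 3 <= n], and one factor [ln n >= 27 / eps]
    gives the constant. *)
Lemma near_ln_sqr_le (R : realType) (eps : R) : 0 < eps ->
  \forall n \near \oo, (ln n%:R : R) ^+ 2 <= eps * n%:R.
Proof.
move=> eps0; near=> n; have n1 : (1 < n)%N by near: n; exact: nbhs_infty_gt.
have n0 : 0 < n%:R :> R by rewrite ltr0n ltnW.
have L0 : 0 < ln n%:R :> R by rewrite ln_gt0 // ltr1n.
have hL : 27 / eps <= 1 * ln n%:R by near: n; exact: near_ln_ge.
rewrite mul1r ler_pdivrMr // in hL.
have hn : (ln n%:R / 3) ^+ 3 <= n%:R :> R.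
  have e3 : n%:R = expR (ln n%:R / 3) ^+ 3 :> R.
    by rewrite -expRM_natl mulrC divfK // lnK // posrE.
  rewrite [leRHS]e3 lerXn2r ?nnegrE ?expR_ge0 ?divr_ge0 ?(ltW L0) //.
  by apply: le_trans (expR_ge1Dx _); rewrite lerDr.
apply: le_trans (ler_wpM2l (ltW eps0) hn).
have -> : eps * (ln n%:R / 3) ^+ 3 = ln n%:R ^+ 2 * (ln n%:R * eps / 27) :> R by field.
by rewrite ler_peMr ?sqr_ge0 // ler_pdivlMr // mul1r.
Unshelve. all: by end_near. Qed.

(** Since [k] is at least 2, there are quadratically many constraints, so linearly many draws have a
    bounded expected number of collisions. *)
Lemma num_constraints_ge (R : realType) (Sigma : finType) (k n : nat)
    (PP : {set {set k.-tuple Sigma}}) : (2 <= k)%N -> (2 * k <= n)%N -> PP != finset.set0 ->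
  n%:R ^+ 2 / (4 * k%:R ^+ 2) <= (num_constraints PP n)%:R :> R.
Proof.
move=> k2 kn PP0; have n0 := n_gt0 R k2 kn.
have k0 : 0 < k%:R :> R by rewrite ltr0n (leq_trans _ k2).
have h := bin1_le R k2 kn PP0; have h' := bin2_le R k2 kn PP0.
have kp : 0 <= 2 * k%:R / n%:R :> R by rewrite divr_ge0 ?mulr_ge0.
have := le_trans (bin2_ge1 R k2 kn PP0) (le_trans h' (ler_wpM2l kp h)).
rewrite ler_pdivrMr ?mulr_gt0 ?exprn_gt0 // => h1.
rewrite -(ler_pM2l (x := n%:R^-1 ^+ 2)) ?exprn_gt0 ?invr_gt0 //.
rewrite -exprMn mulVf ?gt_eqF // expr1n; apply: le_trans h1 _.
by rewrite le_eqVlt; apply/orP; left; apply/eqP; field; rewrite gt_eqF.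
Qed.

Lemma sampling_widths (R : realType) (Sigma : finType) (k : nat)
    (PP : {set {set k.-tuple Sigma}}) (Gamma : {group {perm Sigma}}) (eta C' : R) :
  0 < eta < 1 / 2 -> symmetric_system PP Gamma -> linear_scale PP (eta / 4) -> 0 < C' ->
  (\forall n \near \oo, width PP (eta / 4) n <= C' * (n%:R / ln n%:R)) ->
  \forall n \near \oo,
    `|width_fixed PP eta n| <= (C' + 4) * `|n%:R / ln n%:R| /\
    `|width_indep PP eta n| <= (C' + 4) * `|n%:R / ln n%:R|.
Proof.
move=> heta hsys [cl [C [cl0 C0 hlin]]] C'0 hwidth.
have [e0 e1] := andP heta; have k2 := system_k hsys; have PP0 := system_family hsys.
have heta4 : 0 < eta / 4 < 1 / 2 by apply/andP; split; lra.
have k0 : 0 < k%:R :> R by rewrite ltr0n (leq_trans _ k2).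
(* Solves [eta / 4 * X * n ^ 2 / (4 * k ^ 2) = ((C + 3) * n) ^ 2], where [(C + 3) * n] bounds the
   number of draws. *)
pose X := 16 * k%:R ^+ 2 * (C + 3) ^+ 2 / eta.
have X0 : 0 < X by rewrite divr_gt0 // !mulr_gt0 ?exprn_gt0 // addr_gt0.
near=> n.
have n1 : (1 < n)%N by near: n; exact: nbhs_infty_gt.
have n0 : 0 < n%:R :> R by rewrite ltr0n ltnW.
have kn : (2 * k <= n)%N by near: n; exact: nbhs_infty_ge.
have L1 : 1 <= 1 * ln n%:R :> R by near: n; apply: near_ln_ge.
rewrite mul1r in L1; have L0 : 0 < ln n%:R :> R by apply: lt_le_trans L1.
have hL1 : (ln n%:R : R) ^+ 2 <= eta / (4 * C) * n%:R.
  by near: n; apply: near_ln_sqr_le; rewrite divr_gt0 // mulr_gt0.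
have hL2 : (ln n%:R : R) ^+ 2 <= X^-1 * n%:R.
  by near: n; apply: near_ln_sqr_le; rewrite invr_gt0.
have [cne cnp] : covers PP n != finset.set0 /\ covers PP n != powerset (constraints PP n).
  by near: n; exact: (system_nontrivial hsys).
have nbig : 4 * k%:R ^+ 2 * (C + 2) <= n%:R :> R by near: n; exact: nbhs_infty_ger.
(* The deviation allowed around the mean size is the target width itself, far above the standard
   deviation of order [sqrt n]. *)
set t : R := n%:R / ln n%:R.
have t0 : 0 < t by rewrite divr_gt0.
have tn : t <= n%:R by rewrite ler_pdivrMr // ler_peMr // ltW.
have t1 : 1 <= t.
  by rewrite ler_pdivlMr // mul1r; apply: ltW; exact: ln_sublinear.
have tX : X <= t.
  have L2 : ln n%:R * X <= n%:R.
    apply: (@le_trans _ _ (ln n%:R ^+ 2 * X)).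
      by rewrite ler_wpM2r ?(ltW X0) // expr2 ler_peMr // ltW.
    by rewrite -ler_pdivlMr // mulrC.
  by rewrite ler_pdivlMr // mulrC.
have hW : width PP (eta / 4) n <= C' * t by rewrite /t; near: n; exact: hwidth.
have he' : 0 < 1 - eta / 4 < 1 by apply/andP; split; lra.
have [/andP[q0 q1] _] := threshold_spec cne cnp he'.
have hp1 : p_thr PP n (1 - eta / 4) * (num_constraints PP n)%:R <= C * n%:R.
  have : forall p, central_interval PP n (eta / 4) p ->
      cl * n%:R <= p * (num_constraints PP n)%:R <= C * n%:R by near: n; exact: hlin.
  move=> h; have hc : central_interval PP n (eta / 4) (p_thr PP n (1 - eta / 4)).
    by rewrite /central_interval /= lexx andbT; apply: threshold_mono => //; lra.
  by have /andP[] := h _ hc.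
have Nn := num_constraints_ge R k2 kn PP0.
set N : R := (num_constraints PP n)%:R in hp1 Nn.
set p1 := p_thr PP n (1 - eta / 4) in hp1 q0 q1.
have ht : p1 * N / t ^+ 2 <= eta / 4.
  rewrite ler_pdivrMr ?exprn_gt0 //; apply: le_trans hp1 _.
  rewrite /t expr_div_n mulrA ler_pdivlMr ?exprn_gt0 //.
  apply: le_trans (ler_wpM2l (mulr_ge0 (ltW C0) (ltW n0)) hL1) _.
  by rewrite le_eqVlt; apply/orP; left; apply/eqP; field; rewrite gt_eqF.
have hN : N * p1 + t + 1 <= N.
  apply: le_trans Nn; rewrite ler_pdivlMr ?mulr_gt0 ?exprn_gt0 //.
  have h1 : N * p1 + t + 1 <= (C + 2) * n%:R.
    have n1R : 1 <= n%:R :> R by rewrite ler1n ltnW.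
    by rewrite mulrC; lra.
  have k40 : 0 <= 4 * k%:R ^+ 2 :> R by rewrite mulr_ge0 ?exprn_ge0.
  apply: le_trans (ler_wpM2r k40 h1) _.
  rewrite expr2 mulrAC ler_wpM2r //.
  by rewrite mulrC.
have h2 := width_fixed_bound cne cnp heta t0 ht hN.
pose u := Num.truncn t.
have /andP[u1 u2] := Num.Theory.truncn_itv (ltW t0).
have hcoll : ((Num.truncn (N * p1 + t)).+1 + u)%N%:R ^+ 2 <= eta / 4 * (u.+1%:R * N).
  have q : 0 <= N * p1 + t by apply: addr_ge0 (ltW t0); rewrite mulr_ge0.
  have /andP[M1 _] := Num.Theory.truncn_itv q.
  have hM : ((Num.truncn (N * p1 + t)).+1 + u)%N%:R <= (C + 3) * n%:R.
    rewrite natrD -natr1; move: M1 u1; rewrite -/u.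
    move: (Num.truncn (N * p1 + t))%:R u%:R => x y hx hy.
    have n1R : 1 <= n%:R :> R by rewrite ler1n ltnW.
    by rewrite mulrC in hp1; lra.
  apply: (@le_trans _ _ (((C + 3) * n%:R) ^+ 2)).
    by rewrite lerXn2r ?nnegrE // mulr_ge0 // addr_ge0 // ltW.
  apply: (@le_trans _ _ (eta / 4 * (X * (n%:R ^+ 2 / (4 * k%:R ^+ 2))))).
    by rewrite le_eqVlt /X; apply/orP; left; apply/eqP; field; rewrite !gt_eqF.
  rewrite ler_wpM2l ?divr_ge0 ?(ltW e0) //; apply: ler_pM => //; first exact: ltW.
  by apply: le_trans tX _; exact: ltW.
have h3 := width_indep_bound cne cnp heta t0 ht hN u1 hcoll.
have nt : 0 <= n%:R / ln n%:R :> R by rewrite -/t ltW.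
have Wle : N * (p_thr PP n (1 - eta / 4) - p_thr PP n (eta / 4)) <= C' * t by [].
rewrite (ger0_norm nt) -/t.
by case/andP: h2 => h2 h2'; case/andP: h3 => h3 h3'; rewrite !ger0_norm //; split; lra.
Unshelve. all: by end_near. Qed.

Theorem theorem5p5 (R : realType) (eta : R) (Sigma : finType) (k : nat)
    (PP : {set {set k.-tuple Sigma}}) (Gamma : {group {perm Sigma}})
    (heta : 0 < eta < 1 / 2)
    (hsys : symmetric_system PP Gamma)
    (hrigid : rigid PP Gamma)
    (hpower : power_replaceable R PP)
    (hlinear : linear_scale PP eta)
    (hsmall : few_small_covers PP eta) :
  (exists C : R, \forall n \near \oo,
     width PP eta n <= C * (n%:R / ln n%:R)) /\
  (linear_scale PP (eta / 4) -> few_small_covers PP (eta / 4) ->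
     (width_fixed PP eta =O_\oo (fun n : nat => n%:R / ln n%:R : R)) /\
     (width_indep PP eta =O_\oo (fun n : nat => n%:R / ln n%:R : R))).
Proof.
split; first by have [C _ h] := width_bound heta hsys hpower hlinear hsmall; exists C.
move=> hlinear4 hsmall4.
have heta4 : 0 < eta / 4 < 1 / 2 by case/andP: heta => h1 h2; apply/andP; split; lra.
have [C C0 hW] := width_bound heta4 hsys hpower hlinear4 hsmall4.
have h := sampling_widths heta hsys hlinear4 C0 hW.
have C4 : 0 < C + 4 by rewrite addr_gt0.
by split; apply/eqO_exP; exists (C + 4) => //; near=> n;
  have [] : `|width_fixed PP eta n| <= (C + 4) * `|n%:R / ln n%:R| /\
    `|width_indep PP eta n| <= (C + 4) * `|n%:R / ln n%:R| by near: n.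
Unshelve. all: by end_near. Qed.
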